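(* Let $M$ be a compact smooth manifold of dimension at least $1$. Then there exists a non-empty open subset $\mathcal{U}\subset \mathrm{Diff}^{\infty}(M)\times C^1(M;\mathbb{R})$ such that for every $(\varphi,f)\in\mathcal{U}$, the set $L(\varphi,f)$ is finite and the set $M(\varphi,f)\subset\mathbb{R}$ has non-empty interior.
   Context: $\mathrm{Diff}^{\infty}(M)$ is the set of $C^\infty$ diffeomorphisms $M\to M$ and $C^1(M;\mathbb{R})$ the set of $C^1$ real functions on $M$. The product $\mathrm{Diff}^{\infty}(M)\times C^1(M;\mathbb{R})$ carries the product topology with the $C^1$ topology on both factors. Manifolds are without boundary. For a homeomorphism $\varphi:X\to X$ of a metric space $X$ and a continuous $f:X\to\mathbb{R}$, the dynamically defined Lagrange and Markov spectra are $$L(\varphi,f)=\Big\{\limsup_{j\to+\infty} f(\varphi^j(x)) : x\in X\Big\},\qquad M(\varphi,f)=\Big\{\sup_{j\in\mathbb{Z}} f(\varphi^j(x)) : x\in X\Big\}.$$ *)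

(* Defs.v *)
From HB Require Import structures.
From mathcomp Require Export all_boot all_order all_algebra.
From mathcomp Require Export all_classical all_reals all_analysis.
Export numFieldNormedType.Exports.
Export Order.TTheory GRing.Theory Num.Theory.
Set Implicit Arguments.
Unset Strict Implicit.
Unset Printing Implicit Defensive.
Open Scope classical_set_scope.
Open Scope ring_scope.

Section Euclidean.
Context {R : realType} {n : nat} {V : normedModType R}.
Implicit Types (U : set 'rV[R]_n) (g h : 'rV[R]_n -> V).

Definition partial (i : 'I_n) g : 'rV[R]_n -> V :=
  fun x => derive g x (delta_mx 0 i).

(* All partial derivatives of order at most [k] exist and are continuous at
   every point of [U]; meant for open [U]. *)
Fixpoint Ck_on (k : nat) U g : Prop :=
  {in U, continuous g} /\
  (if k is k'.+1 then
     forall i : 'I_n, (forall x, U x -> derivable g x (delta_mx 0 i)) /\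
                      Ck_on k' U (partial i g)
   else True).

Definition C1_close (e : R) U g h : Prop :=
  forall x, U x ->
    `|g x - h x| < e /\ forall i : 'I_n, `|partial i g x - partial i h x| < e.

End Euclidean.

(* A homeomorphism [coord] from the open set [chart_dom] onto an open subset of
   R^n; the values of [coord] outside [chart_dom], and of [coord_inv] outside
   the image of [chart_dom], are irrelevant. *)
Record chart (R : realType) (n : nat) (T : topologicalType) := Chart {
  chart_dom : set T;
  coord : T -> 'rV[R]_n;
  coord_inv : 'rV[R]_n -> T;
  chart_dom_open : open chart_dom;
  chart_im_open : open (coord @` chart_dom);
  coordK : {in chart_dom, cancel coord coord_inv};
  coord_cont : {within chart_dom, continuous coord};
  coord_inv_cont : {within coord @` chart_dom, continuous coord_inv} }.

(* The atlas need not be maximal: the notions below are unchanged when the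
   atlas is replaced by a compatible one. *)
Record smooth_manifold (R : realType) (n : nat) := SmoothManifold {
  carrier :> topologicalType;
  manifold_hausdorff : hausdorff_space carrier;
  manifold_second_countable : @second_countable carrier;
  atlas : set (chart R n carrier);
  atlas_cover : forall x : carrier, exists2 c, atlas c & chart_dom c x;
  atlas_compatible : forall c d, atlas c -> atlas d -> forall k,
    Ck_on k (coord c @` (chart_dom c `&` chart_dom d))
            (coord d \o coord_inv c) }.

Section Maps.
Context {R : realType} {n : nat} (M : smooth_manifold R n).

Definition local_rep (c d : chart R n M) (f : M -> M) : 'rV[R]_n -> 'rV[R]_n :=
  coord d \o f \o coord_inv c.

Definition function_rep (c : chart R n M) (f : M -> R) : 'rV[R]_n -> R^o :=
  f \o coord_inv c.

Definition smooth_map (f : M -> M) : Prop :=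
  continuous f /\
  forall c d : chart R n M, atlas c -> atlas d -> forall k,
    Ck_on k (coord c @` (chart_dom c `&` f @^-1` chart_dom d))
            (local_rep c d f).

Definition C1_map (f : M -> R) : Prop :=
  forall c : chart R n M, atlas c ->
    Ck_on 1 (coord c @` chart_dom c) (function_rep c f).

Record diffeo := Diffeo {
  diffeo_fun :> M -> M;
  diffeo_inv : M -> M;
  diffeo_funK : cancel diffeo_fun diffeo_inv;
  diffeo_invK : cancel diffeo_inv diffeo_fun;
  diffeo_fun_smooth : smooth_map diffeo_fun;
  diffeo_inv_smooth : smooth_map diffeo_inv }.

Record C1_function := C1Function {
  C1_fun :> M -> R;
  C1_funP : C1_map C1_fun }.

(* Subbasic sets N(f; c, d, K, e) of the compact-open C^1 topology, which for a
   compact source is the C^1 topology (weak and strong versions agree). *)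
Definition diffeo_C1_nbhd (f : diffeo) (c d : chart R n M) (K : set M) (e : R) :
    set diffeo :=
  [set g : diffeo | g @` K `<=` chart_dom d /\
                    C1_close e (coord c @` K)
                      (local_rep c d g) (local_rep c d f)].

Definition diffeo_C1_subbase : set (set diffeo) :=
  [set B | exists (f : diffeo) (c d : chart R n M) (K : set M) (e : R),
     [/\ atlas c /\ atlas d, compact K /\ K `<=` chart_dom c,
         f @` K `<=` chart_dom d, 0 < e & B = diffeo_C1_nbhd f c d K e]].

Definition C1_function_nbhd (f : C1_function) (c : chart R n M) (K : set M)
    (e : R) : set C1_function :=
  [set g : C1_function |
     C1_close e (coord c @` K) (function_rep c g) (function_rep c f)].

Definition C1_function_subbase : set (set C1_function) :=
  [set B | exists (f : C1_function) (c : chart R n M) (K : set M) (e : R),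
     [/\ atlas c, compact K, K `<=` chart_dom c, 0 < e
       & B = C1_function_nbhd f c K e]].

HB.instance Definition _ := gen_eqMixin diffeo.
HB.instance Definition _ := gen_choiceMixin diffeo.
HB.instance Definition _ :=
  @isSubBaseTopological.Build diffeo (set diffeo) diffeo_C1_subbase id.

HB.instance Definition _ := gen_eqMixin C1_function.
HB.instance Definition _ := gen_choiceMixin C1_function.
HB.instance Definition _ :=
  @isSubBaseTopological.Build C1_function (set C1_function)
    C1_function_subbase id.

End Maps.

Section Spectra.
Context {R : realType} {X : Type}.

(* [iterz phi psi j] is phi^j when psi is the inverse of phi. *)
Definition iterz (phi psi : X -> X) (j : int) (x : X) : X :=
  match j with Posz m => iter m phi x | Negz m => iter m.+1 psi x end.

(* The limsup and the sup are taken in the extended reals; when f is bounded,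
   as on a compact space, they are finite for every x. *)
Definition lagrange_spectrum (phi : X -> X) (f : X -> R) : set R :=
  [set y | exists x : X, limn_esup (fun j => (f (iter j phi x))%:E) = y%:E].

Definition markov_spectrum (phi psi : X -> X) (f : X -> R) : set R :=
  [set y | exists x : X,
     ereal_sup (range (fun j : int => (f (iterz phi psi j x))%:E)) = y%:E].

End Spectra.

(* Main.v *)
(* We perturb a gradient-like diffeomorphism phi0. A C^infinity function h whose
   critical points are all nondegenerate exists by adding, chart after chart, a
   small cut-off linear form; a good linear form is found by a counting version of
   Sard's theorem. For phi0 no flow is needed: it is a finite composition of maps
   x |-> x - e rho(x) d_k h(x) e_k, one for each chart of a finite atlas (with cut-off
   rho) and each coordinate k. Each factor decreases h, with equality only at its
   fixed points, so the fixed points of phi0 are the critical points of h, and near a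
   critical point p one has h(x) - h(phi0 x) >= kappa |x - p|^2.

   If Q is the second-order part of h at p, this yields
   Q(Dphi0 v) <= Q(v) - (kappa/2) |v|^2. Hence for every phi that is C^1-close to phi0,
   Q(phi x - phi y) <= Q(x - y) - c |x - y|^2 near p, and all orbits of phi staying near
   p converge to one and the same point. Away from the critical points h decreases
   by a definite amount under phi, more than it can regain near them, so every
   orbit ends up near one critical point: the Lagrange spectrum is finite for
   every f. For the same reason a small open set W of noncritical points never
   meets its images under phi; if f is C^0-close to a bump supported in W, the
   supremum of f along the orbit of x is f(x) as soon as f(x) is not small, and by
   the intermediate value theorem the Markov spectrum contains an interval. *)

From HB Require Import structures.
Require Import Defs.
From mathcomp Require Import perm.
From mathcomp Require Import ring lra zify.

Set Implicit Arguments.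
Unset Strict Implicit.
Unset Printing Implicit Defensive.

(** * C^k maps between Euclidean spaces *)

(** The difficulty is that a perturbation of phi0 need neither fix the critical points of h nor
    decrease h near them. An estimate on differences survives instead: in a chart phi - phi0 has a
    small Lipschitz constant, so it alters Q(phi0 x - phi0 y) by a small multiple of |x - y|^2,
    which the quadratic drop absorbs. This is where closeness in the C^1 sense and nondegeneracy of
    the critical points are used; away from these points C^0 closeness and compactness do the work.

    Each coordinate step is a shear changing a single coordinate. Its inverse comes from the
    intermediate value theorem in one variable, and the smoothness of the inverse from a bootstrap
    on the order of differentiability.

    Sard's theorem only has to supply one regular value in each ball, for the gradient of h in a
    chart; this is why the pigeonhole principle on a finite grid is enough.

    The set U is the interior of the set of all pairs with the required properties, so the whole
    task is to exhibit one pair with a neighbourhood of good pairs. *)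

Section RowNorm.
Context {R : realType} {n : nat}.
Implicit Types v x : 'rV[R]_n.

Lemma rV_coord_le v j : `|v 0 j| <= `|v|.
Proof.
rewrite [leRHS]/Num.Def.normr/= mx_normrE.
exact: (@le_bigmax _ _ _ 0 (fun ij : 'I_1 * 'I_n => `|v ij.1 ij.2|) (0, j)).
Qed.

Lemma rV_norm_le v e : 0 <= e -> (forall j, `|v 0 j| <= e) -> `|v| <= e.
Proof.
move=> e0 ve; rewrite [leLHS]/Num.Def.normr/= mx_normrE.
by apply: bigmax_le => // -[i j] _ /=; rewrite ord1.
Qed.

Lemma rV_sum_le v : \sum_j `|v 0 j| <= n%:R * `|v|.
Proof.
apply: le_trans (_ : \sum_(j < n) `|v| <= _).
  by apply: ler_sum => j _; exact: rV_coord_le.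
by rewrite sumr_const card_ord mulr_natl.
Qed.

Lemma norm_delta_mx (j : 'I_n) (t : R) : `|t *: delta_mx 0 j : 'rV[R]_n| <= `|t|.
Proof.
apply: rV_norm_le => // k; rewrite !mxE eqxx /=.
by case: (k == j); rewrite ?mulr1 ?mulr0 ?normr0.
Qed.

End RowNorm.

Lemma near_eq_continuous (T U : topologicalType) (f g : T -> U) (x : T) :
  (\forall z \near x, f z = g z) -> {for x, continuous f} -> {for x, continuous g}.
Proof.
move=> fg cf; rewrite /prop_for /continuous_at -(nbhs_singleton fg).
by apply: cvg_trans cf; exact: near_eq_cvg.
Qed.

(** * C^k regularity at a point *)

Section PointwiseCk.
Context {R : realType} {n : nat} {V : normedModType R}.
Implicit Types (g h : 'rV[R]_n -> V).

(** Pointwise form of [Ck_on]. All conditions are imposed on some neighbourhood of [x], so this is a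
    property of the germ of [g] and can be moved between charts without tracking open domains. *)
Fixpoint ck (k : nat) g (x : 'rV[R]_n) : Prop :=
  (\forall y \near x, {for y, continuous g}) /\
  (if k is k'.+1 then
     forall i : 'I_n, (\forall y \near x, derivable g y (delta_mx 0 i)) /\
                      ck k' (partial i g) x
   else True).

Lemma Ck_onP k (U : set 'rV[R]_n) g : open U ->
  Ck_on k U g <-> (forall x, U x -> ck k g x).
Proof.
move=> oU; elim: k g => [|k IHk] g /=; split.
- move=> [cg _] x Ux; split=> //; near=> y; apply: cg; rewrite inE.
  by near: y; exact: open_nbhs_nbhs.
- move=> cg; split=> // x; rewrite inE => /cg [+ _].
  exact: nbhs_singleton.
- move=> [cg dg] x Ux; split.
    near=> y; apply: cg; rewrite inE.
    by near: y; exact: open_nbhs_nbhs.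
  move=> i; have [dgi cki] := dg i; split; last exact: (IHk _).1.
  near=> y; apply: dgi.
  by near: y; exact: open_nbhs_nbhs.
- move=> cg; split=> [x|i].
    by rewrite inE => /cg [+ _]; exact: nbhs_singleton.
  split=> [x /cg [_ /(_ i) [+ _]]|]; first exact: nbhs_singleton.
  by apply/IHk => x /cg [_ /(_ i)] [].
Unshelve. all: by end_near. Qed.

Lemma ck_nbhs k g x : ck k g x -> \forall y \near x, ck k g y.
Proof.
elim: k g => [|k IHk] g /=.
  by move=> [cg _]; apply: filterS (near_join cg) => y.
move=> [cg dg]; have cg' := near_join cg.
have dg' : \forall y \near x, forall i,
    (\forall y \near y, derivable g y (delta_mx 0 i)) /\ ck k (partial i g) y.
  apply: (@filter_forall _ _ (fun i y =>
    (\forall z \near y, derivable g z (delta_mx 0 i)) /\ ck k (partial i g) y) _ (nbhs_filter x)).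
  move=> i; have [di ci] := dg i; have di' := near_join di.
  have ci' := IHk _ ci; exact: (filterS2 _ _ di' ci').
exact: (filterS2 _ _ cg' dg').
Qed.

Lemma ck_continuous k g x : ck k g x -> {for x, continuous g}.
Proof. by case: k => [|k] /= [+ _]; exact: nbhs_singleton. Qed.

Lemma ckS k g x : ck k.+1 g x -> ck k g x.
Proof.
elim: k g => [|k IHk] g; first by move=> [].
move=> [cg dg]; split => // i; have [di ci] := dg i; split => //.
exact: IHk.
Qed.

Lemma ck_le k l g x : (k <= l)%N -> ck l g x -> ck k g x.
Proof.
elim: l => [|l IHl]; first by rewrite leqn0 => /eqP ->.
rewrite leq_eqVlt => /orP[/eqP -> //|]; rewrite ltnS => kl /ckS.
exact: IHl.
Qed.

Lemma ck_near_eq k g h x : (\forall y \near x, g y = h y) -> ck k g x -> ck k h x.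
Proof.
elim: k g h => [|k IHk] g h gh /=; have gh' := near_join gh => -[cg dg].
  split=> //; apply: filterS2 gh' cg => y; exact: near_eq_continuous.
split; first by apply: filterS2 gh' cg => y; exact: near_eq_continuous.
move=> i; have [di ci] := dg i; split.
  by apply: filterS2 gh' di => y; exact: near_eq_derivable.
apply: IHk ci; apply: filterS gh' => y; exact: near_eq_derive.
Qed.

Lemma ck_partial k g x i : ck k.+1 g x -> ck k (partial i g) x.
Proof. by move=> [_ /(_ i) []]. Qed.

Lemma ck_derivable k g x i : ck k.+1 g x -> derivable g x (delta_mx 0 i).
Proof. by move=> [_ /(_ i) [+ _]]; exact: nbhs_singleton. Qed.

End PointwiseCk.

Section Line.
Context {R : realType} {n : nat} {V : normedModType R}.

Lemma is_derive_line (u : 'rV[R]_n -> V) (z v : 'rV[R]_n) (s : R) :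
  derivable u (s *: v + z) v ->
  is_derive s 1 (fun s => u (s *: v + z)) ('D_v u (s *: v + z)).
Proof.
move=> du.
have E : (fun h : R => h^-1 *: (u ((h *: 1 + s) *: v + z) - u (s *: v + z)))
       = (fun h : R => h^-1 *: (u (h *: v + (s *: v + z)) - u (s *: v + z))).
  by apply/funext => h; rewrite [h *: 1]mulr1 scalerDl addrA.
by apply: DeriveDef; rewrite ?/derivable ?/derive /= E.
Qed.

End Line.

Lemma line_mean_value (R : realType) (n : nat) (u : 'rV[R]_n -> R^o) (z : 'rV[R]_n)
    (k : 'I_n) (t : R) :
  let seg (s : R) := (0 <= s <= t) || (t <= s <= 0) in
  (forall s, seg s -> derivable u (s *: delta_mx 0 k + z) (delta_mx 0 k)) ->
  exists2 s, seg s &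
    u (t *: delta_mx 0 k + z) - u z = t * partial k u (s *: delta_mx 0 k + z).
Proof.
move=> seg du; pose f (s : R) : R^o := u (s *: delta_mx 0 k + z).
have df (s : R) : seg s -> is_derive s (1 : R) f (partial k u (s *: delta_mx 0 k + z)).
  by move=> /du dus; exact: is_derive_line.
have f0 : f 0 = u z by rewrite /f scale0r add0r.
have [t0|t0] := leP 0 t.
  have st (s : R) : s \in `[0, t] -> seg s by rewrite in_itv /seg /= => ->.
  have [||s sI] := @MVT_segment R f (fun s => partial k u (s *: delta_mx 0 k + z)) 0 t t0.
  - by move=> s /subset_itv_oo_cc /st; exact: df.
  - by apply: derivable_within_continuous => s /st /df [].
  - by rewrite f0 subr0 mulrC => E; exists s; first exact: st.
have st (s : R) : s \in `[t, 0] -> seg s by rewrite in_itv /seg /= => ->; rewrite orbT.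
have [||s sI] := @MVT_segment R f (fun s => partial k u (s *: delta_mx 0 k + z)) t 0 (ltW t0).
- by move=> s /subset_itv_oo_cc /st; exact: df.
- by apply: derivable_within_continuous => s /st /df [].
- rewrite f0 sub0r => E; exists s; first exact: st.
  by rewrite -opprB E mulrN opprK mulrC.
Qed.

(** * Mean value estimates on cubes *)

Section BoxMeanValue.
Context {R : realType} {n : nat}.
Variables (u : 'rV[R]_n -> R^o) (L : 'I_n -> R) (x0 : 'rV[R]_n) (r e : R).
Hypothesis du : forall z, `|z - x0| <= r -> forall j,
  derivable u z (delta_mx 0 j) /\ `|partial j u z - L j| <= e.

Lemma edge_mean_value z j t : `|z - x0| <= r ->
  `|t *: delta_mx 0 j + z - x0| <= r ->
  `|u (t *: delta_mx 0 j + z) - u z - L j * t| <= e * `|t|.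
Proof.
move=> zr tr; set d : 'rV[R]_n := delta_mx 0 j.
have seg (s : R) : (0 <= s <= t) || (t <= s <= 0) -> `|s *: d + z - x0| <= r.
  move=> st; apply: rV_norm_le; first exact: le_trans zr.
  move=> k; have := le_trans (rV_coord_le _ k) zr.
  have := le_trans (rV_coord_le _ k) tr.
  rewrite !mxE eqxx /=; case: (k == j); rewrite ?mulr1 ?mulr0 // !ler_norml.
  by lra.
have [s|s st ->] := @line_mean_value R n u z j t.
  by move=> /seg /du /(_ j) [].
have [_ Le] := du (seg s st) j.
by rewrite mulrC -mulrBl normrM ler_wpM2r.
Qed.

(** The path from [x] to [y] that changes one coordinate at a time stays in the cube, because the
    norm is the maximum norm; the estimate telescopes along its edges and uses partial derivatives
    only. *)
Lemma box_mean_value x y : `|x - x0| <= r -> `|y - x0| <= r ->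
  `|u y - u x - \sum_j L j * (y 0 j - x 0 j)| <= e * \sum_j `|y 0 j - x 0 j|.
Proof.
move=> xr yr.
pose z (m : nat) : 'rV[R]_n := \row_j if (j < m)%N then y 0 j else x 0 j.
have zr m : `|z m - x0| <= r.
  apply: rV_norm_le; first exact: le_trans xr.
  move=> k; rewrite !mxE; case: ifP => _.
    by have := le_trans (rV_coord_le _ k) yr; rewrite !mxE.
  by have := le_trans (rV_coord_le _ k) xr; rewrite !mxE.
have z0 : z 0 = x by apply/rowP => k; rewrite mxE.
have zn : z n = y by apply/rowP => k; rewrite mxE ltn_ord.
have zS (j : 'I_n) : z j.+1 = (y 0 j - x 0 j) *: delta_mx 0 j + z j.
  apply/rowP => k; rewrite !mxE eqxx /= ltnS.
  case: (eqVneq k j) => [->|kj]; first by rewrite leqnn ltnn mulr1 subrK.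
  by rewrite mulr0 add0r leq_eqVlt (inj_eq val_inj) (negbTE kj).
have -> : u y - u x = \sum_(j < n) (u (z j.+1) - u (z j)).
  by rewrite -(big_mkord xpredT (fun m => u (z m.+1) - u (z m)))
     telescope_sumr // zn z0.
rewrite -sumrB mulr_sumr; apply: le_trans (ler_norm_sum _ _ _) _.
apply: ler_sum => j _; rewrite zS; apply: edge_mean_value => //.
by rewrite -zS.
Qed.

End BoxMeanValue.

Section NearBall.
Context {R : realType} {V : normedModType R}.

Lemma near_closed_ballP (x : V) (P : set V) :
  (\forall y \near x, P y) <->
  exists2 r : R, 0 < r & forall y, `|y - x| <= r -> P y.
Proof.
split.
  move=> /nbhs_ballP[e /= e0 eP]; exists (e / 2); first by rewrite divr_gt0.
  move=> y yx; apply: eP; rewrite -ball_normE /= distrC.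
  by apply: le_lt_trans yx _; rewrite ltr_pdivrMr// mulr_natr mulr2n ltrDl.
move=> [r r0 rP]; apply/nbhs_ballP; exists r => //= y.
by rewrite -ball_normE /= distrC => /ltW; exact: rP.
Qed.

End NearBall.

Section StrictDifferentiability.
Context {R : realType} {n : nat}.
Implicit Types (u : 'rV[R]_n -> R^o).

(** Both points vary, while the linear part stays that at [x]. This two-point form is what the later
    Lipschitz and contraction estimates rest on. *)
Lemma ck1_strict u x e : ck 1 u x -> 0 < e ->
  exists2 r, 0 < r & forall y z, `|y - x| <= r -> `|z - x| <= r ->
    `|u y - u z - \sum_j partial j u x * (y 0 j - z 0 j)| <= e * `|y - z|.
Proof.
(* Errors are divided by [n.+1] rather than [n], which keeps the quotient meaningful in dimension
   0. *)
move=> [_ du] e0; have n0 : 0 < n.+1%:R :> R by rewrite ltr0Sn.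
have nr : \forall z \near x, forall j : 'I_n,
    derivable u z (delta_mx 0 j) /\ `|partial j u z - partial j u x| <= e / n.+1%:R.
  apply: (@filter_forall _ _ (fun j z => derivable u z (delta_mx 0 j) /\
    `|partial j u z - partial j u x| <= e / n.+1%:R) _ (nbhs_filter x)) => j.
  have [dj [cj _]] := du j; apply: filterS2 dj _; first by move=> z a b; split; [exact: a|exact: b].
  have /cvgrPdist_le/(_ (e / n.+1%:R)) := nbhs_singleton cj.
  rewrite divr_gt0 // => /(_ isT).
  by apply: filterS => z; rewrite distrC.
have [r r0 rP] := (near_closed_ballP _ _).1 nr.
exists r => // y z yr zr.
apply: le_trans (_ : _ <= e / n.+1%:R * \sum_j `|y 0 j - z 0 j|) _.
  exact: (@box_mean_value _ _ u (fun j => partial j u x) x r _ rP).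
rewrite -mulrA; apply: ler_wpM2l; first exact: ltW.
rewrite ler_pdivrMl //.
have := @rV_sum_le _ _ (y - z).
under eq_bigr do rewrite !mxE.
move=> /le_trans; apply; by rewrite ler_wpM2r // ler_nat.
Qed.

Lemma ck1_differentiable u x : ck 1 u x ->
  differentiable u x /\ forall v, 'd u x v = \sum_j partial j u x * v 0 j.
Proof.
move=> u1; pose d (v : 'rV[R]_n) : R^o := \sum_j partial j u x * v 0 j.
have lin_d : linear d.
  move=> a v w; rewrite /d scaler_sumr -big_split /=; apply: eq_bigr => j _.
  by rewrite !mxE mulrDr -[a *: _]/(a * _); ring.
pose dM := GRing.isLinear.Build _ _ _ _ _ lin_d.
pose dL : {linear _ -> _} := HB.pack d dM.
have dle v : `|dL v| <= (\sum_j `|partial j u x|) * `|v|.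
  rewrite mulr_suml; apply: le_trans (ler_norm_sum _ _ _) _.
  by apply: ler_sum => j _; rewrite normrM ler_wpM2l // rV_coord_le.
have cd : continuous dL.
  apply/linear_bounded_continuous/linear_boundedP.
  apply: filterS (nbhs_pinfty_ge (num_real (\sum_j `|partial j u x|))) => M CM v.
  by apply: le_trans (dle v) _; exact: ler_wpM2r.
have o : u \o shift x = cst (u x) + dL +o_ (0 : 'rV[R]_n) id.
  apply/eqaddoP => e e0; have [r r0 rP] := ck1_strict u1 e0.
  apply: (near_closed_ballP (0 : 'rV[R]_n) _).2; exists r => // v; rewrite subr0 => vr.
  have := rP (v + x) x; rewrite addrK subrr normr0 => /(_ vr (ltW r0)).
  rewrite -[(_ - _) v]/(u (v + x) - (u x + d v)) opprD addrA.
  by under eq_bigr do rewrite mxE addrK.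
have E := diff_unique cd o.
by split; [apply/diff_locallyP; rewrite E|move=> v; rewrite E].
Qed.

Lemma ck1_derive u x v : ck 1 u x ->
  derivable u x v /\ 'D_v u x = \sum_j partial j u x * v 0 j.
Proof.
move=> /ck1_differentiable[du dE]; split; first exact: diff_derivable.
by rewrite deriveE // dE.
Qed.

End StrictDifferentiability.

Section ChainRule.
Context {R : realType} {n m : nat}.

(** Restricting [F] to the line through [x] in direction [v] gives a differentiable curve, so a
    single directional derivative of [F] suffices. *)
Lemma chain_rule (u : 'rV[R]_m -> R^o) (F : 'rV[R]_n -> 'rV[R]_m) x v :
  ck 1 u (F x) -> derivable F x v ->
  derivable (u \o F) x v /\
  'D_v (u \o F) x = \sum_j partial j u (F x) * ('D_v F x) 0 j.
Proof.
move=> /ck1_differentiable[du dE] dF.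
pose g (h : R) := F (h *: v + x).
have g0 : g 0 = F x by rewrite /g scale0r add0r.
have dg : is_derive (0 : R) 1 g ('D_v F x).
  have -> : 'D_v F x = 'D_v F (0 *: v + x) by rewrite scale0r add0r.
  by apply: is_derive_line; rewrite scale0r add0r.
have [dg1 gE] := dg; have dgd : differentiable g 0 := (derivable1_diffP _ _).1 dg1.
have dud : differentiable u (g 0) by rewrite g0.
have dc : differentiable (u \o g) 0 by exact: differentiable_comp.
have der : derivable (u \o F) x v.
  by apply/derivable1P; exact: (derivable1_diffP _ _).2 dc.
split=> //.
have [_ <-] : is_derive (0 : R) 1 (fun s => (u \o F) (s *: v + x)) ('D_v (u \o F) x).
  have -> : 'D_v (u \o F) x = 'D_v (u \o F) (0 *: v + x) by rewrite scale0r add0r.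
  by apply: is_derive_line; rewrite scale0r add0r.
have E : 'D_1 (u \o g) 0 = 'd u (g 0) ('D_1 g 0).
  rewrite (deriveE _ dc) (deriveE _ dgd).
  by have /(congr1 (fun f => f 1)) := diff_comp dgd dud.
transitivity ('D_1 (u \o g) 0); first by [].
by rewrite E gE g0 dE.
Qed.

End ChainRule.

Lemma continuous_near (T U : topologicalType) (f : T -> U) (x : T) (P : set U) :
  {for x, continuous f} -> (\forall y \near f x, P y) ->
  \forall z \near x, P (f z).
Proof. by move=> cf; exact: cf. Qed.

(** * Closure properties of C^k maps *)

Section CkVector.
Context {R : realType} {n : nat} {V : normedModType R}.
Implicit Types (g h : 'rV[R]_n -> V).

Lemma ck_cst k (c : V) x : ck k (fun _ : 'rV[R]_n => c) x.
Proof.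
elim: k c => [|k IHk] c.
  by split=> //; near=> y; exact: cst_continuous.
split; first by near=> y; exact: cst_continuous.
move=> i; split; first by near=> y; exact: derivable_cst.
suff -> : partial i (fun _ : 'rV[R]_n => c) = fun=> 0 by [].
by apply/funext => y; rewrite /partial derive_cst.
Unshelve. all: by end_near. Qed.

Lemma ckD k g h x : ck k g x -> ck k h x -> ck k (fun y => g y + h y) x.
Proof.
elim: k g h => [|k IHk] g h [cg dg] [ch dh].
  by split=> //; apply: filterS2 cg ch => y; exact: continuousD.
split; first by apply: filterS2 cg ch => y; exact: continuousD.
move=> i; have [dgi cgi] := dg i; have [dhi chi] := dh i; split.
  by apply: filterS2 dgi dhi => y; exact: derivableD.
apply: ck_near_eq (IHk _ _ cgi chi).
by apply: filterS2 dgi dhi => y gy hy; rewrite /partial -deriveD.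
Qed.

Lemma ck_sum k (I : Type) (r : seq I) (P : pred I) (g : I -> 'rV[R]_n -> V) x :
  (forall i, P i -> ck k (g i) x) -> ck k (fun y => \sum_(i <- r | P i) g i y) x.
Proof.
move=> ckg; elim: r => [|i r IHr].
  have -> : (fun y => \sum_(i <- [::] | P i) g i y) = (fun=> 0).
    by apply/funext => y; rewrite big_nil.
  exact: ck_cst.
have -> : (fun y => \sum_(j <- i :: r | P j) g j y) =
    (fun y => if P i then g i y + \sum_(j <- r | P j) g j y
              else \sum_(j <- r | P j) g j y).
  by apply/funext => y; rewrite big_cons.
by case Pi: (P i) => //; apply: ckD => //; exact: ckg.
Qed.

End CkVector.

Section CkScalar.
Context {R : realType} {n : nat}.
Implicit Types (g h : 'rV[R]_n -> R^o).

Lemma ckM k g h x : ck k g x -> ck k h x -> ck k (fun y => g y * h y : R^o) x.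
Proof.
elim: k g h => [|k IHk] g h kg kh; have [cg dg] := kg; have [ch dh] := kh.
  by split=> //; apply: filterS2 cg ch => y; exact: continuousM.
split; first by apply: filterS2 cg ch => y; exact: continuousM.
move=> i; have [dgi cgi] := dg i; have [dhi chi] := dh i; split.
  by apply: filterS2 dgi dhi => y; exact: derivableM.
apply: (@ck_near_eq _ _ _ _
  (fun y => g y * partial i h y + h y * partial i g y)); last first.
  by apply: ckD; apply: IHk => //; exact: ckS.
by apply: filterS2 dgi dhi => y gy hy; rewrite /partial (deriveM gy hy).
Qed.

Lemma ck_prod k (I : Type) (r : seq I) (P : pred I) (g : I -> 'rV[R]_n -> R^o) x :
  (forall i, P i -> ck k (g i) x) ->
  ck k (fun y => \prod_(i <- r | P i) g i y : R^o) x.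
Proof.
move=> ckg; elim: r => [|i r IHr].
  have -> : (fun y => \prod_(i <- [::] | P i) g i y) = (fun=> 1 : R^o).
    by apply/funext => y; rewrite big_nil.
  exact: ck_cst.
have -> : (fun y => \prod_(j <- i :: r | P j) g j y : R^o) =
    (fun y => if P i then g i y * \prod_(j <- r | P j) g j y
              else \prod_(j <- r | P j) g j y).
  by apply/funext => y; rewrite big_cons.
by case Pi: (P i) => //; apply: ckM => //; exact: ckg.
Qed.

Lemma ckN k g x : ck k g x -> ck k (fun y => - g y : R^o) x.
Proof.
move=> kg; have -> : (fun y => - g y) = (fun y => (-1 : R^o) * g y).
  by apply/funext => y; rewrite mulN1r.
by apply: ckM => //; exact: ck_cst.
Qed.

Lemma ckB k g h x : ck k g x -> ck k h x -> ck k (fun y => g y - h y : R^o) x.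
Proof. by move=> kg kh; apply: ckD => //; exact: ckN. Qed.

Lemma derive_coord (x v : 'rV[R]_n) j :
  is_derive x v (fun y : 'rV[R]_n => y 0 j : R^o) (v 0 j).
Proof.
have dv : derivable (@id 'rV[R]_n) x v by exact: derivable_id.
apply: DeriveDef; first exact: (derivable_mxP _ _ _).1 dv 0 j.
have := derive_mx dv; rewrite derive_id => /(congr1 (fun M : 'rV[R]_n => M 0 j)).
by rewrite mxE => ->.
Qed.

Lemma ck_coord k j x : ck k (fun y : 'rV[R]_n => y 0 j : R^o) x.
Proof.
have ct : \forall y \near x, {for y, continuous (fun y : 'rV[R]_n => y 0 j : R^o)}.
  by near=> y; exact: coord_continuous.
case: k => [|k]; split=> // i; split.
  by near=> y; have [] := derive_coord y (delta_mx 0 i) j.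
have -> : partial i (fun y : 'rV[R]_n => y 0 j : R^o) = fun=> (delta_mx 0 i : 'rV[R]_n) 0 j.
  by apply/funext => y; have [] := derive_coord y (delta_mx 0 i) j.
exact: ck_cst.
Unshelve. all: by end_near. Qed.

Lemma partial_coord i j x : partial i (fun y : 'rV[R]_n => y 0 j : R^o) x = (i == j)%:R.
Proof.
have [_] := derive_coord x (delta_mx 0 i) j; rewrite /partial => ->.
by rewrite mxE eqxx /= eq_sym.
Qed.

Lemma ckV k g x : g x != 0 -> ck k g x -> ck k (fun y => (g y)^-1 : R^o) x.
Proof.
move=> gx0 kg.
have g0 : \forall y \near x, g y != 0.
  have /= := ck_continuous kg; move=> cg.
  exact: (cg _ (open_nbhs_nbhs (conj (@open_neq R 0) gx0))).
elim: k kg => [|k IHk] kg; have [cg dg] := kg.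
  by split=> //; apply: filterS2 g0 cg => y; exact: continuousV.
split; first by apply: filterS2 g0 cg => y; exact: continuousV.
move=> i; have [dgi cgi] := dg i; split.
  by apply: filterS2 g0 dgi => y; exact: derivableV.
have kV := IHk (ckS kg).
apply: (@ck_near_eq _ _ _ _
  (fun y => - ((g y)^-1 * (g y)^-1 * partial i g y))); last first.
  by apply: ckN; apply: ckM => //; exact: ckM.
apply: filterS2 g0 dgi => y gy dy; rewrite /partial (deriveV gy dy).
by rewrite scaleNr -exprVn expr2.
Qed.

End CkScalar.

Section CkComp.
Context {R : realType} {n m : nat}.

Lemma ck_rowP k (F : 'rV[R]_n -> 'rV[R]_m) x :
  ck k F x <-> forall j, ck k (fun y => F y 0 j : R^o) x.
Proof.
have cP (G : 'rV[R]_n -> 'rV[R]_m) : (\forall y \near x, {for y, continuous G}) <->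
    forall j, \forall y \near x, {for y, continuous (fun y => G y 0 j : R^o)}.
  split=> [cF j|cF].
    apply: filterS cF => y cFy.
    exact: (continuous_comp cFy (@coord_continuous R 1 m 0 j _)).
  have : \forall y \near x, forall j, {for y, continuous (fun y => G y 0 j : R^o)}.
    exact: (@filter_forall _ _ (fun j y => _) _ (nbhs_filter x)).
  apply: filterS => y cy; apply/(@cvgrPdist_le _ _ _ (nbhs y) (nbhs_filter y)) => e e0.
  have : \forall t \near y, forall j, `|G y 0 j - G t 0 j| <= e.
    apply: (@filter_forall _ _ (fun j t => `|G y 0 j - G t 0 j| <= e) _ (nbhs_filter y)).
    by move=> j; move: (cy j) => /cvgrPdist_le /(_ _ e0).
  apply: filterS => t ty; apply: rV_norm_le => [|j]; first exact: ltW.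
  by rewrite !mxE.
elim: k F => [|k IHk] F.
  split=> [[/cP cF _] j|cF]; first by split.
  by split=> //; apply/cP => j; have [] := cF j.
have pE (y : 'rV[R]_n) i : derivable F y (delta_mx 0 i) ->
    forall j, partial i F y 0 j = partial i (fun y => F y 0 j : R^o) y.
  by move=> dF j; rewrite /partial derive_mx // mxE.
split=> [[/cP cF dF] j|cF].
  split=> // i; have [dFi /IHk/(_ j) cFi] := dF i; split.
    apply: filterS dFi => y dy; exact: (derivable_mxP _ _ _).1 dy 0 j.
  by apply: ck_near_eq cFi; apply: filterS dFi => y dy; exact: pE.
split; first by apply/cP => j; have [] := cF j.
move=> i.
have dFi : \forall y \near x, derivable F y (delta_mx 0 i).
  have : \forall y \near x, forall j,
      derivable (fun y => F y 0 j : R^o) y (delta_mx 0 i).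
    apply: (@filter_forall _ _ (fun j y => derivable (fun y => F y 0 j : R^o) y
      (delta_mx 0 i)) _ (nbhs_filter x)).
    by move=> j; have [_ /(_ i) []] := cF j.
  apply: filterS => y dy; apply/derivable_mxP => i0 j; rewrite ord1; exact: dy.
split=> //; apply/IHk => j.
have [_ /(_ i) [_ ckj]] := cF j.
apply: ck_near_eq ckj.
by apply: filterS dFi => y dy; rewrite pE.
Qed.

End CkComp.

Lemma ck_comp (R : realType) (n m k : nat) (u : 'rV[R]_m -> R^o)
    (F : 'rV[R]_n -> 'rV[R]_m) x :
  ck k u (F x) -> ck k F x -> ck k (fun y => u (F y)) x.
Proof.
elim: k u => [|k IHk] u ku kF.
all: have cF := ck_continuous kF.
all: have ct : \forall y \near x, {for y, continuous (u \o F)} by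
  apply: filterS2 (ck_nbhs kF) (continuous_near cF (ck_nbhs ku)) => y ky kuy;
  exact: continuous_comp (ck_continuous ky) (ck_continuous kuy).
- by split.
split=> // i.
have u1 : \forall y \near x, ck 1 u (F y).
  apply: filterS (continuous_near cF (ck_nbhs ku)) => y; exact: ck_le.
have [_ /(_ i) [dF kFi]] := kF.
split; first by apply: filterS2 u1 dF => y uy Fy; have [] := chain_rule uy Fy.
apply: (@ck_near_eq _ _ _ _
  (fun y => \sum_j (partial j u (F y) * partial i F y 0 j : R^o))).
  by apply: filterS2 u1 dF => y uy Fy; have [] := chain_rule uy Fy.
apply: ck_sum => j _; apply: ckM; last exact: (ck_rowP _ _ _).1 kFi j.
by apply: IHk; [exact: ck_partial|exact: ckS].
Qed.

Lemma ck_comp_row (R : realType) (n m p k : nat) (G : 'rV[R]_m -> 'rV[R]_p)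
    (F : 'rV[R]_n -> 'rV[R]_m) x :
  ck k G (F x) -> ck k F x -> ck k (fun y => G (F y)) x.
Proof.
move=> /ck_rowP kG kF; apply/ck_rowP => j.
exact: (ck_comp (kG j) kF).
Qed.

Lemma ck_id (R : realType) (n k : nat) (x : 'rV[R]_n) : ck k (fun y : 'rV[R]_n => y) x.
Proof. by apply/ck_rowP => j; exact: ck_coord. Qed.

(** * Bump functions *)

Section FlatFunction.
Context {R : realType}.

(** For [m = 0] this is the classical function that is flat at 0; the powers [t ^- m] are carried
    along because they appear in its derivatives. *)
Definition flat (m : nat) (t : R) : R :=
  if 0 < t then t ^- m * expR (- t^-1) else 0.

Lemma flat_gt0 m t : 0 < t -> 0 < flat m t.
Proof. by move=> t0; rewrite /flat t0 mulr_gt0 ?expR_gt0// invr_gt0 exprn_gt0. Qed.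

Lemma flat_le0 m t : t <= 0 -> flat m t = 0.
Proof. by move=> t0; rewrite /flat ltNge t0. Qed.

Lemma flat_ge0 m t : 0 <= flat m t.
Proof. by case: (ltP 0 t) => [/(flat_gt0 m)/ltW|/(flat_le0 m) ->]. Qed.

(** The term of order [m.+1] of the exponential series bounds [expR t^-1] from below. The resulting
    linear bound gives the limit of the difference quotient at 0. *)
Lemma flat_le m t : flat m t <= m.+1`!%:R * `|t|.
Proof.
case: (ltP 0 t) => [t0|/(flat_le0 m) ->]; last by rewrite mulr_ge0.
rewrite /flat t0 (gtr0_norm t0) expRN ler_pdivrMr ?expR_gt0//.
have M0 : 0 < m.+1`!%:R :> R by rewrite ltr0n fact_gt0.
have : t^-1 ^+ m.+1 / m.+1`!%:R <= expR t^-1.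
  by apply: le_trans (expR_ge1Dxn m _); rewrite ?lerDr// invr_ge0 ltW.
have c0 : 0 <= m.+1`!%:R * t by rewrite mulr_ge0 ?ltW.
move=> /(ler_wpM2l c0); apply: le_trans.
have tm0 : t ^+ m != 0 by rewrite expf_neq0 // lt0r_neq0.
rewrite exprVn exprS; move: (t ^+ m) tm0 (lt0r_neq0 t0) (lt0r_neq0 M0) => X X0 tn0 Mn0.
suff -> : m.+1`!%:R * t * ((t * X)^-1 / m.+1`!%:R) = X^-1 by [].
by field; rewrite X0 tn0 Mn0.
Qed.

Lemma flatS m t : flat m t = t * flat m.+1 t.
Proof.
rewrite /flat; case: ifP => [t0|_]; last by rewrite mulr0.
by rewrite exprS invfM !mulrA divff ?lt0r_neq0// mul1r.
Qed.

Lemma is_derive_flat m (t : R) :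
  is_derive t 1 (flat m : R -> R^o) (flat m.+2 t - m%:R * flat m.+1 t).
Proof.
have [t0|t0|t0] := ltgtP t 0.
- rewrite !flat_le0 ?ltW// mulr0 subr0.
  have E : \forall s \near t, 0 = flat m s.
    by near=> s; rewrite flat_le0 // ltW //; near: s; exact: lt_nbhsl.
  apply: (near_eq_is_derive E); exact: is_derive_cst.
- have E : \forall s \near t, s ^- m * expR (- s^-1) = flat m s.
    by near=> s; rewrite /flat ifT //; near: s; exact: lt_nbhsr.
  apply: (near_eq_is_derive E).
  have tn0 := lt0r_neq0 t0.
  have dV : derivable (fun s : R => s^-1 : R^o) t 1.
    by apply: derivableV => //; exact: derivable_id.
  have DV : 'D_1 (fun s : R => s^-1 : R^o) t = - t ^- 2.
    by rewrite (deriveV tn0 (@derivable_id _ _ _ _)) derive_id [LHS]mulr1.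
  have dN : derivable (fun s : R => - s^-1 : R^o) t 1 by exact: derivableN.
  have DN : 'D_1 (fun s : R => - s^-1 : R^o) t = t ^- 2.
    by rewrite (deriveN dV) DV opprK.
  have dE : derivable (expR \o (fun s : R => - s^-1) : R -> R^o) t 1.
    apply/derivable1_diffP/differentiable_comp; first exact: (derivable1_diffP _ _).1.
    by apply/derivable1_diffP; exact: derivable_expR.
  have DE : 'D_1 (expR \o (fun s : R => - s^-1) : R -> R^o) t = expR (- t^-1) * t ^- 2.
    rewrite -derive1E (derive1_comp dN (@derivable_expR _ _)) !derive1E DN.
    by rewrite derive_val.
  have tm0 : t ^+ m != 0 by rewrite expf_neq0.
  have dX : derivable (fun s : R => (s ^+ m)^-1 : R^o) t 1.
    exact: (@derivableV _ _ (fun s : R => s ^+ m) _ _ tm0 (@exprn_derivable R m t 1)).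
  have DX : 'D_1 (fun s : R => (s ^+ m)^-1 : R^o) t = - (m%:R * t ^- m.+1).
    have -> := @deriveV _ _ (fun s : R => s ^+ m) _ _ tm0 (@exprn_derivable R m t 1).
    have -> := @exp_derive R m t 1.
    have -> (a b : R) : (- a *: (m%:R *: b *: 1) : R) = - (a * (m%:R * b)).
      by rewrite -[_ *: 1]/(_ * 1) mulr1 scaleNr.
    congr (- _).
    case: (m) => [|k]; first by rewrite !mul0r mulr0.
    rewrite /= mulrCA; congr (_ * _); have := tn0; rewrite !exprS.
    have : t ^+ k != 0 by rewrite expf_neq0.
    by move: (t ^+ k) => X X0 Y0; field; rewrite X0 Y0.
  apply: DeriveDef; first exact: (derivableM dX dE).
  rewrite (deriveM dX dE) DX DE /flat t0 /=.
  rewrite -![_ *: _]/(_ * _) !exprS.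
  by move: (t ^+ m) tm0 => X X0; field; rewrite X0 tn0.
- rewrite t0 !flat_le0 // mulr0 subr0.
  (* By [flatS] the difference quotient of [flat m] at 0 is [flat m.+1], which tends to 0 by
     [flat_le]. *)
  have H : h^-1 *: (flat m (h *: 1 + 0) - flat m 0 : R^o) @[h --> 0^'] --> (0 : R^o).
    have -> : (fun h : R => h^-1 *: (flat m (h *: 1 + 0) - flat m 0 : R^o)) =
              (fun h : R => (h != 0)%:R * flat m.+1 h).
      apply/funext => h; rewrite [h *: 1]mulr1 addr0 (flat_le0 m (lexx 0)) subr0 flatS.
      rewrite -[_ *: _]/(_ * _) mulrA; case: eqVneq => [->|h0]; first by rewrite mulr0.
      by rewrite mulVf.
    apply/cvgrPdist_le => e e0; near=> h.
    rewrite sub0r normrN normrM normr_nat.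
    apply: le_trans (_ : flat m.+1 h <= _).
      rewrite ger0_norm ?flat_ge0// -[leRHS]mul1r ler_wpM2r ?flat_ge0 // lern1.
      by case: (h != 0).
    apply: le_trans (flat_le _ _) _.
    rewrite -ler_pdivlMl ?ltr0n ?fact_gt0//.
    near: h; apply: dnbhs0_le; rewrite mulr_gt0 // invr_gt0 ltr0n fact_gt0 //.
  by apply: DeriveDef; [apply/cvg_ex; exists 0|apply: cvg_lim].
Unshelve. all: by end_near. Qed.

End FlatFunction.

Lemma chain_rule1 (R : realType) (n : nat) (f : R -> R^o) (df : R)
    (u : 'rV[R]_n -> R^o) (x v : 'rV[R]_n) :
  is_derive (u x) 1 f df -> derivable u x v ->
  derivable (f \o u) x v /\ 'D_v (f \o u) x = df * 'D_v u x.
Proof.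
move=> [df1 dfE] dux.
pose g (h : R) : R^o := u (h *: v + x).
have g0 : g 0 = u x by rewrite /g scale0r add0r.
have [dg gE] : is_derive (0 : R) 1 g ('D_v u x).
  have -> : 'D_v u x = 'D_v u (0 *: v + x) by rewrite scale0r add0r.
  by apply: is_derive_line; rewrite scale0r add0r.
have df1' := df1; rewrite -g0 in df1'.
have dc : derivable (f \o g) 0 1.
  apply: (derivable1_diffP _ _).2.
  exact: (differentiable_comp ((derivable1_diffP _ _).1 dg) ((derivable1_diffP _ _).1 df1')).
have der : derivable (f \o u) x v by apply/derivable1P.
split=> //.
have [_ <-] : is_derive (0 : R) 1 (fun s => (f \o u) (s *: v + x)) ('D_v (f \o u) x).
  have -> : 'D_v (f \o u) x = 'D_v (f \o u) (0 *: v + x) by rewrite scale0r add0r.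
  by apply: is_derive_line; rewrite scale0r add0r.
transitivity (derive1 (f \o g) 0); first by rewrite derive1E.
by rewrite (derive1_comp dg df1') !derive1E gE g0 dfE.
Qed.

(* The derivative of [flat m] is a combination of [flat m.+1] and [flat m.+2], so the
   induction on the order of differentiability treats all [m] at once. *)
Lemma ck_flat (R : realType) (n k m : nat) (u : 'rV[R]_n -> R^o) x :
  ck k u x -> ck k (fun y => flat m (u y) : R^o) x.
Proof.
elim: k m => [|k IHk] m ku.
all: have ct : \forall y \near x, {for y, continuous (fun y => flat m (u y) : R^o)} by
  apply: filterS (ck_nbhs ku) => y /ck_continuous cu; apply: continuous_comp cu _;
  apply: differentiable_continuous; have [d _] := is_derive_flat m (u y);
  exact: (derivable1_diffP _ _).1 d.
- by split.
split=> // i; have [_ /(_ i) [du ku']] := ku.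
split.
  by apply: filterS du => y dy; have [] := chain_rule1 (is_derive_flat m (u y)) dy.
apply: (@ck_near_eq _ _ _ _
  (fun y => (flat m.+2 (u y) - m%:R * flat m.+1 (u y)) * partial i u y : R^o)).
  by apply: filterS du => y dy; have [_] := chain_rule1 (is_derive_flat m (u y)) dy.
apply: ckM => //; apply: ckB; first exact: IHk (ckS ku).
by apply: ckM; [exact: ck_cst|exact: IHk (ckS ku)].
Qed.

Section Bump.
Context {R : realType} {n : nat}.

Definition smoothstep (t : R) : R := flat 0 t / (flat 0 t + flat 0 (1 - t)).

Lemma smoothstep_den t : 0 < flat 0 t + flat 0 (1 - t) :> R.
Proof.
case: (ltP 0 t) => t0; first by rewrite ltr_wpDr ?flat_ge0 // flat_gt0.
by rewrite ltr_wpDl ?flat_ge0 // flat_gt0 // subr_gt0 (le_lt_trans t0).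
Qed.

Lemma smoothstep_ge0 t : 0 <= smoothstep t.
Proof. by rewrite divr_ge0 ?flat_ge0// ltW// smoothstep_den. Qed.

Lemma smoothstep_le1 t : smoothstep t <= 1.
Proof. by rewrite ler_pdivrMr ?smoothstep_den// mul1r lerDl flat_ge0. Qed.

Lemma smoothstep_0 t : t <= 0 -> smoothstep t = 0.
Proof. by move=> t0; rewrite /smoothstep flat_le0 // mul0r. Qed.

Lemma smoothstep_1 t : 1 <= t -> smoothstep t = 1.
Proof.
move=> t1; have := smoothstep_den t; rewrite /smoothstep.
have -> : flat 0 (1 - t) = 0 by rewrite flat_le0 // subr_le0.
by rewrite addr0 => /lt0r_neq0 d; rewrite divff.
Qed.

Lemma ck_smoothstep k (u : 'rV[R]_n -> R^o) x :
  ck k u x -> ck k (fun y => smoothstep (u y) : R^o) x.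
Proof.
move=> ku; apply: ckM; first exact: ck_flat.
apply: ckV; first by rewrite lt0r_neq0 // smoothstep_den.
apply: ckD; first exact: ck_flat.
by apply: (ck_flat 0 (u := fun y => 1 - u y)); apply: ckB => //; exact: ck_cst.
Qed.

(** [smoothstep (3 - s)] is 1 for [s <= 2] and 0 for [s >= 3]; the two factors treat the two signs
    of each coordinate. *)
Definition cube_bump (y : 'rV[R]_n) (r : R) (x : 'rV[R]_n) : R :=
  \prod_j (smoothstep (3 - (x 0 j - y 0 j) / r) * smoothstep (3 + (x 0 j - y 0 j) / r)).

Lemma ck_cube_bump k y r x : ck k (cube_bump y r : _ -> R^o) x.
Proof.
have ka j : ck k (fun x : 'rV[R]_n => (x 0 j - y 0 j) / r : R^o) x.
  apply: ckM; last exact: ck_cst.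
  by apply: ckB; [exact: ck_coord|exact: ck_cst].
apply: ck_prod => j _; apply: ckM.
  apply: (@ck_smoothstep _ (fun x : 'rV[R]_n => 3 - (x 0 j - y 0 j) / r)).
  by apply: ckB => //; exact: ck_cst.
apply: (@ck_smoothstep _ (fun x : 'rV[R]_n => 3 + (x 0 j - y 0 j) / r)).
by apply: ckD => //; exact: ck_cst.
Qed.

Lemma cube_bump_ge0 y r x : 0 <= cube_bump y r x.
Proof. by apply: prodr_ge0 => j _; rewrite mulr_ge0 ?smoothstep_ge0. Qed.

Lemma cube_bump_le1 y r x : cube_bump y r x <= 1.
Proof.
apply: prodr_ile1 => j _; rewrite mulr_ge0 ?smoothstep_ge0//=.
by rewrite mulr_ile1 ?smoothstep_ge0 ?smoothstep_le1.
Qed.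

Lemma cube_bump_1 y r x : 0 < r -> `|x - y| <= 2 * r -> cube_bump y r x = 1.
Proof.
move=> r0 xy; apply: big1 => j _.
have := le_trans (rV_coord_le _ j) xy; rewrite !mxE => xyj.
have : `|(x 0 j - y 0 j) / r| <= 2 by rewrite normrM normfV (gtr0_norm r0) ler_pdivrMr.
by rewrite ler_norml => /andP[a b]; rewrite !smoothstep_1 ?mulr1 //; lra.
Qed.

Lemma cube_bump_0 y r x : 0 < r -> 3 * r <= `|x - y| -> cube_bump y r x = 0.
Proof.
move=> r0 xy.
have [j xyj] : exists j, 3 * r <= `|x 0 j - y 0 j|.
  apply: contrapT => /forallNP H.
  have r3 : 0 < 3 * r by rewrite mulr_gt0.
  have [v0|/mx_norm_neq0 [[i j] /= E]] := eqVneq (mx_norm (x - y)) 0.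
    by have := lt_le_trans r3 xy; rewrite /Num.Def.normr/= v0 ltxx.
  apply: (H j); move: xy; rewrite [leRHS]/Num.Def.normr/= E !mxE.
  by rewrite (ord1 i).
rewrite /cube_bump (bigD1 j) //=.
suff -> : smoothstep (3 - (x 0 j - y 0 j) / r) * smoothstep (3 + (x 0 j - y 0 j) / r) = 0.
  by rewrite mul0r.
have : 3 <= `|(x 0 j - y 0 j) / r| by rewrite normrM normfV (gtr0_norm r0) ler_pdivlMr.
rewrite ler_normr => /orP[a|a].
  by rewrite (smoothstep_0 (t := 3 - _)) ?mul0r // subr_le0.
rewrite (smoothstep_0 (t := 3 + (x 0 j - y 0 j) / r)) ?mulr0 //.
by rewrite -lerBrDr sub0r.
Qed.

End Bump.

(** * Smooth inverses of shears *)

Section Shear.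
Context {R : realType} {n : nat}.
Variables (b : 'rV[R]_n -> R^o) (i0 : 'I_n).
Hypothesis b_smooth : forall k x, ck k b x.
Hypothesis b_small : forall x, `|partial i0 b x| <= 2^-1.
Let e0 : 'rV[R]_n := delta_mx 0 i0.

Definition shear (x : 'rV[R]_n) : 'rV[R]_n := x - b x *: e0.

Lemma shear_contract z s t : `|b (s *: e0 + z) - b (t *: e0 + z)| <= 2^-1 * `|s - t|.
Proof.
pose w := t *: e0 + z.
have -> : s *: e0 + z = (s - t) *: e0 + w by rewrite /w addrA -scalerDl subrK.
have [u _|u _ ->] := @line_mean_value R n b w i0 (s - t).
  exact: ck_derivable (b_smooth 1 _).
by rewrite normrM mulrC ler_wpM2r.
Qed.

(** A preimage of [y] under [shear] must have the form [y + s *: e0], and then [s] solves this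
    scalar fixed point equation. *)
Lemma shear_solution y : exists s, b (s *: e0 + y) = s.
Proof.
(* The slope of [b] along [e0] is at most 1/2, so |b (s e0 + y)| <= |b y| + |s| / 2; hence [g]
   changes sign on [-C, C] for [C = 2 |b y|]. *)
pose g (s : R) := s - b (s *: e0 + y); pose C := 2 * `|b y|.
have C0 : 0 <= C by rewrite mulr_ge0.
have cg : continuous g.
  move=> s; apply: continuousB; first exact: cvg_id.
  apply: differentiable_continuous.
  have [d _] := is_derive_line (@ck_derivable _ _ _ _ _ _ i0 (b_smooth 1 (s *: e0 + y))).
  exact: (derivable1_diffP _ _).1 d.
have Cb s : `|b (s *: e0 + y) - b y| <= 2^-1 * `|s|.
  by have := shear_contract y s 0; rewrite scale0r add0r subr0.
have gN : g (- C) <= 0.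
  have := Cb (- C); rewrite normrN (ger0_norm C0) ler_norml /g => /andP[+ _].
  by have := ler_norm (- b y); rewrite normrN /C; lra.
have gP : 0 <= g C.
  have := Cb C; rewrite (ger0_norm C0) ler_norml /g => /andP[_ +].
  by have := ler_norm (b y); rewrite /C; lra.
have CC : - C <= C by lra.
have [||s _ gs] := @IVT R g (- C) C 0 CC.
- exact: continuous_subspaceT.
- by rewrite ge_min gN /= le_max gP orbT.
by exists s; apply/esym/eqP; rewrite -subr_eq0 -/(g s) gs.
Qed.

Definition shear_shift y := sval (cid (shear_solution y)).
Definition shear_inv y := y + shear_shift y *: e0.

Lemma shear_shiftE y : shear_shift y = b (shear_inv y).
Proof.
by rewrite /shear_inv addrC /shear_shift; case: cid => s /= ->.
Qed.

Lemma shear_invK : cancel shear_inv shear.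
Proof. by move=> y; rewrite /shear -shear_shiftE /shear_inv addrK. Qed.

Lemma shear_inj : injective shear.
Proof.
move=> x y; rewrite /shear => /eqP; rewrite subr_eq addrAC eq_sym subr_eq => /eqP E.
have {}E : y = (b y - b x) *: e0 + x.
  by apply/eqP; rewrite scalerBl addrAC eq_sym subr_eq addrC E.
have := shear_contract x (b y - b x) 0; rewrite -E scale0r add0r subr0.
have [b0|byx] := eqVneq (b y - b x) 0.
  by move=> _; rewrite [RHS]E b0 scale0r add0r.
have : 0 < `|b y - b x| by rewrite normr_gt0.
by move=> p H; exfalso; move: p H; lra.
Qed.

Lemma shearK : cancel shear shear_inv.
Proof. by move=> x; apply: shear_inj; rewrite shear_invK. Qed.

(** The rate 1/2 of [shear_contract] lets half of the left side be absorbed. What remains on the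
    right involves [b] alone, so continuity and difference quotients of the shift are governed by
    those of [b]. *)
Lemma shear_shift_le y z : `|shear_shift z - shear_shift y| <=
  2 * `|b (shear_inv y + (z - y)) - b (shear_inv y)|.
Proof.
have := shear_contract z (shear_shift z) (shear_shift y).
have -> : shear_shift z *: e0 + z = shear_inv z by rewrite addrC.
have -> : shear_shift y *: e0 + z = shear_inv y + (z - y).
  by rewrite /shear_inv [y + _]addrC -addrA subrKC.
have := ler_normD (b (shear_inv z) - b (shear_inv y + (z - y)))
  (b (shear_inv y + (z - y)) - b (shear_inv y)).
rewrite subrKA (shear_shiftE z) (shear_shiftE y).
lra.
Qed.

Lemma shear_shift_continuous : continuous (shear_shift : _ -> R^o).
Proof.
move=> y; apply/(@cvgrPdist_le _ _ _ (nbhs y) (nbhs_filter y)) => e e_gt0.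
have e2 : 0 < e / 2 by rewrite divr_gt0.
have /cvgrPdist_le/(_ _ e2) cb := ck_continuous (b_smooth 0 (shear_inv y)).
have [r r0 rP] := (near_closed_ballP _ _).1 cb.
apply: (near_closed_ballP y _).2; exists r => // z zy.
rewrite distrC; apply: le_trans (shear_shift_le _ _) _.
have := rP (shear_inv y + (z - y)); rewrite addrAC subrr add0r => /(_ zy).
by rewrite distrC; lra.
Qed.

Lemma shear_den x : 2^-1 <= 1 - partial i0 b x.
Proof. by have := b_small x; rewrite ler_norml => /andP[_]; lra. Qed.

(** The value is the one found by differentiating the equation s(y) = b (y + s(y) e0) implicitly;
    [shear_den] keeps the denominator away from 0. *)
Lemma is_derive_shear_shift y i : is_derive y (delta_mx 0 i) (shear_shift : _ -> R^o)
  (partial i b (shear_inv y) / (1 - partial i0 b (shear_inv y))).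
Proof.
set x := shear_inv y; set L := _ / _; set v := delta_mx 0 i.
have d0 := shear_den x.
suff H : h^-1 *: (shear_shift (h *: v + y) - shear_shift y : R^o) @[h --> 0^'] --> (L : R^o).
  by apply: DeriveDef; [apply/cvg_ex; exists L|apply: cvg_lim].
apply/cvgrPdist_le => e e_gt0.
(* [C] bounds the difference quotients of the shift (claim [DC]): the 2 comes from [shear_shift_le],
   the summand 1 from strict differentiability with error 1. In [e1] the factor 1/2 pays for the
   denominator, which is at least 1/2, and [1 + C] for the length of the displacement in [Gx]. *)
pose C := 2 * (`|partial i b x| + 1).
have C0 : 0 <= C by rewrite mulr_ge0 // addr_ge0.
have C1 : 0 < 1 + C by rewrite ltr_pwDl.
pose e1 := e / 2 / (1 + C).
have e1_gt0 : 0 < e1 by rewrite !divr_gt0.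
have [r r0 rP] := ck1_strict (b_smooth 1 x) e1_gt0.
have [r1 r10 r1P] := ck1_strict (b_smooth 1 x) (@ltr01 R).
have rC : 0 < r / (1 + C) by rewrite divr_gt0.
near=> h.
have h0 : h != 0 by near: h; exact: nbhs_dnbhs_neq.
have hr1 : `|h| <= r1 by near: h; exact: dnbhs0_le.
have hr : `|h| <= r / (1 + C) by near: h; exact: dnbhs0_le.
set D := shear_shift _ - _.
have sumd (a : 'I_n -> R) (s : R) (j : 'I_n) :
    \sum_k a k * (s *: delta_mx 0 j : 'rV[R]_n) 0 k = a j * s.
  rewrite (bigD1 j) //= big1 ?addr0; last first.
    by move=> k kj; rewrite !mxE (negbTE kj) !mulr0.
  by rewrite !mxE !eqxx mulr1.
have DC : `|D| <= C * `|h|.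
  apply: le_trans (shear_shift_le _ _) _; rewrite -/x addrK [x + _]addrC.
  have := r1P (h *: v + x) x; rewrite addrK subrr normr0.
  move=> /(_ (le_trans (norm_delta_mx _ _) hr1) (ltW r10)); rewrite mul1r.
  under eq_bigr do rewrite mxE addrK.
  rewrite sumd => H; have /(le_trans H) {}H := norm_delta_mx i h.
  have := ler_normD (b (h *: v + x) - b x - partial i b x * h) (partial i b x * h).
  rewrite subrK normrM /C -mulrA => H1; apply: ler_wpM2l => //.
  by rewrite mulrDl mul1r [leRHS]addrC; exact: le_trans H1 (lerD H (lexx _)).
have GE : shear_inv (h *: v + y) = D *: e0 + h *: v + x.
  by apply/rowP => j; rewrite /x /shear_inv /D !mxE; ring.
have Gx : `|D *: e0 + h *: v| <= (1 + C) * `|h|.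
  apply: le_trans (ler_normD _ _) _; rewrite mulrDl mul1r addrC lerD//.
    exact: norm_delta_mx.
  by apply: le_trans (norm_delta_mx _ _) _.
have Gr : `|D *: e0 + h *: v| <= r.
  by apply: le_trans Gx _; rewrite mulrC -ler_pdivlMr.
have := rP (D *: e0 + h *: v + x) x; rewrite addrK subrr normr0 -GE.
move=> /(_ Gr (ltW r0)); rewrite -!shear_shiftE -/D.
have GEj j : shear_inv (h *: v + y) 0 j - x 0 j = (D *: e0) 0 j + (h *: v) 0 j.
  by rewrite GE mxE addrK mxE.
under eq_bigr do rewrite GEj mulrDr.
rewrite big_split /= !sumd => H.
have {}H : `|D - (partial i0 b x * D + partial i b x * h)| <= e / 2 * `|h|.
  apply: le_trans H _; apply: le_trans (ler_wpM2l (ltW e1_gt0) Gx) _.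
  by rewrite mulrA divfK // lt0r_neq0.
have dn0 : 1 - partial i0 b x != 0 by rewrite lt0r_neq0 //; lra.
have -> : L - h^-1 *: (D : R^o) =
    - (D - (partial i0 b x * D + partial i b x * h)) / (h * (1 - partial i0 b x)).
  rewrite /L -[_ *: _]/(_ * _); field; by rewrite dn0 h0.
rewrite mulNr normrN normrM normfV normrM ler_pdivrMr; last first.
  by rewrite mulr_gt0 ?normr_gt0.
apply: le_trans H _; rewrite -[e / 2]/(e * 2^-1) -mulrA; apply: ler_wpM2l; first exact: ltW.
rewrite mulrC; apply: ler_wpM2l => //.
by rewrite ger0_norm // (le_trans _ d0) // invr_ge0.
Unshelve. all: by end_near. Qed.

(* Bootstrapping: the partial derivatives of the shift are smooth functions of
   [shear_inv], hence of the shift itself. *)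
Lemma ck_shear_shift k y : ck k (shear_shift : _ -> R^o) y.
Proof.
elim: k y => [|k IHk] y.
  by split=> //; near=> z; exact: shear_shift_continuous.
split; first by near=> z; exact: shear_shift_continuous.
move=> i; split; first by near=> z; have [] := is_derive_shear_shift z i.
have -> : partial i (shear_shift : _ -> R^o) = fun z =>
    partial i b (shear_inv z) * (1 - partial i0 b (shear_inv z))^-1 : R^o.
  by apply/funext => z; have [] := is_derive_shear_shift z i.
have ck_inv : ck k shear_inv y.
  apply: ckD; first exact: ck_id.
  apply/ck_rowP => j.
  have -> : (fun y => (shear_shift y *: e0) 0 j : R^o) = (fun y => shear_shift y * e0 0 j).
    by apply/funext => z; rewrite mxE.
  by apply: ckM => //; exact: ck_cst.
have ckp j : ck k (fun z => partial j b (shear_inv z)) y.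
  by apply: ck_comp ck_inv; exact: ck_partial (b_smooth k.+1 _).
apply: ckM => //; apply: ckV; last by apply: ckB => //; exact: ck_cst.
by rewrite lt0r_neq0 // (lt_le_trans _ (shear_den _)) // invr_gt0.
Unshelve. all: by end_near. Qed.

Lemma ck_shear k x : ck k shear x.
Proof.
apply/ck_rowP => j.
have -> : (fun y => shear y 0 j : R^o) = (fun y => y 0 j - b y * e0 0 j).
  by apply/funext => z; rewrite !mxE.
by apply: ckB; [exact: ck_coord|apply: ckM => //; exact: ck_cst].
Qed.

Lemma ck_shear_inv k x : ck k shear_inv x.
Proof.
apply/ck_rowP => j.
have -> : (fun y => shear_inv y 0 j : R^o) = (fun y => y 0 j + shear_shift y * e0 0 j).
  by apply/funext => z; rewrite !mxE.
apply: ckD; first exact: ck_coord.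
by apply: ckM; [exact: ck_shear_shift|exact: ck_cst].
Qed.

Lemma shear_fix x : b x = 0 -> shear x = x.
Proof. by move=> bx; rewrite /shear bx scale0r subr0. Qed.

Lemma shear_inv_fix x : b x = 0 -> shear_inv x = x.
Proof. by move=> bx; rewrite -[in LHS](shear_fix bx) shearK. Qed.

End Shear.

(** * Smooth maps and functions on a manifold *)

Section Charts.
Context {R : realType} {n : nat} (M : smooth_manifold R n).
Implicit Types (c d : chart R n M) (h : M -> R) (F : M -> M) (x : M).

Definition chart_im c : set 'rV[R]_n := coord c @` chart_dom c.

Lemma open_chart_im c : open (chart_im c).
Proof. exact: chart_im_open. Qed.

Lemma coord_im c x : chart_dom c x -> chart_im c (coord c x).
Proof. by move=> cx; exists x. Qed.

Lemma coordKP c x : chart_dom c x -> coord_inv c (coord c x) = x.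
Proof. by move=> cx; apply: coordK; rewrite inE. Qed.

Lemma coord_inv_dom c y : chart_im c y -> chart_dom c (coord_inv c y).
Proof. by move=> [x cx <-]; rewrite coordKP. Qed.

Lemma coord_invK c y : chart_im c y -> coord c (coord_inv c y) = y.
Proof. by move=> [x cx <-]; rewrite coordKP. Qed.

Lemma near_dom c x : chart_dom c x -> \forall z \near x, chart_dom c z.
Proof. by move=> cx; apply: open_nbhs_nbhs; split=> //; exact: chart_dom_open. Qed.

Lemma near_im c y : chart_im c y -> \forall z \near y, chart_im c z.
Proof. by move=> cx; apply: open_nbhs_nbhs; split=> //; exact: open_chart_im. Qed.

Lemma continuous_coord c x : chart_dom c x -> {for x, continuous (coord c)}.
Proof.
move=> cx; have := @coord_cont _ _ _ c.
by rewrite (continuous_open_subspace _ (chart_dom_open c)); apply; rewrite inE.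
Qed.

Lemma continuous_coord_inv c y : chart_im c y -> {for y, continuous (coord_inv c)}.
Proof.
move=> cy; have := @coord_inv_cont _ _ _ c.
by rewrite (continuous_open_subspace _ (@chart_im_open _ _ _ c)); apply; rewrite inE.
Qed.

Lemma near_coord c x (P : set 'rV[R]_n) : chart_dom c x ->
  (\forall y \near coord c x, P y) -> \forall z \near x, P (coord c z).
Proof. by move=> /continuous_coord; exact: continuous_near. Qed.

Lemma near_coord_inv c y (P : set M) : chart_im c y ->
  (\forall x \near coord_inv c y, P x) -> \forall z \near y, P (coord_inv c z).
Proof. by move=> /continuous_coord_inv; exact: continuous_near. Qed.

Lemma transition_open c d : open (coord c @` (chart_dom c `&` chart_dom d)).
Proof.
rewrite openE => y [x [cx dx] <-].
have cy := coord_im cx.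
have : \forall z \near coord c x, chart_im c z /\ chart_dom d (coord_inv c z).
  apply: filterS2 (near_im cy) (near_coord_inv cy _); last first.
    by rewrite coordKP //; exact: near_dom dx.
  by move=> z.
apply: filterS => z [cz dz]; exists (coord_inv c z); last exact: coord_invK.
by split=> //; exact: coord_inv_dom.
Qed.

Lemma ck_transition c d k x : atlas c -> atlas d -> chart_dom c x -> chart_dom d x ->
  ck k (coord d \o coord_inv c) (coord c x).
Proof.
move=> ac ad cx dx; have := atlas_compatible ac ad k.
by move=> /(Ck_onP _ _ (@transition_open c d)); apply; exists x.
Qed.

Lemma ck_change_chart c d k h x : atlas c -> atlas d ->
  chart_dom c x -> chart_dom d x ->
  ck k (function_rep d h) (coord d x) -> ck k (function_rep c h) (coord c x).
Proof.
move=> ac ad cx dx kh.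
have cy := coord_im cx.
have {}kh : ck k (function_rep d h) ((coord d \o coord_inv c) (coord c x)).
  by rewrite /= coordKP.
apply: ck_near_eq (ck_comp kh (ck_transition k ac ad cx dx)).
apply: filterS (near_coord_inv cy _); last first.
  by rewrite coordKP //; exact: near_dom dx.
by move=> y dy; rewrite /function_rep /= coordKP.
Qed.

Definition smooth_fun h := forall c, atlas c -> forall k x, chart_dom c x ->
  ck k (function_rep c h) (coord c x).

Lemma smooth_funP h :
  (forall x, exists c, [/\ atlas c, chart_dom c x &
     forall k, ck k (function_rep c h) (coord c x)]) -> smooth_fun h.
Proof.
move=> H c ac k x cx; have [d [ad dx kd]] := H x.
exact: ck_change_chart (kd k).
Qed.

Lemma smooth_fun_im h c y k : smooth_fun h -> atlas c -> chart_im c y ->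
  ck k (function_rep c h) y.
Proof. by move=> sh ac [x cx <-]; exact: sh. Qed.

Lemma smooth_fun_continuous h : smooth_fun h -> continuous (h : M -> R^o).
Proof.
move=> sh x; have [c ac cx] := @atlas_cover _ _ M x.
have := continuous_comp (continuous_coord cx) (ck_continuous (sh c ac 0 x cx)).
apply: near_eq_continuous; apply: filterS (near_dom cx) => z cz.
by rewrite /function_rep /= coordKP.
Qed.

Lemma smooth_fun_C1 h : smooth_fun h -> C1_map h.
Proof.
move=> sh c ac; apply/(Ck_onP _ _ (@open_chart_im c)) => y [x cx <-].
exact: sh.
Qed.

Lemma smooth_fun_cst (a : R) : smooth_fun (fun=> a).
Proof. by move=> c ac k x cx; exact: ck_cst. Qed.

Lemma smooth_funD h1 h2 : smooth_fun h1 -> smooth_fun h2 ->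
  smooth_fun (fun x => h1 x + h2 x).
Proof. by move=> s1 s2 c ac k x cx; apply: ckD; [exact: s1|exact: s2]. Qed.

Lemma smooth_funZ (a : R) h : smooth_fun h -> smooth_fun (fun x => a * h x).
Proof. by move=> s1 c ac k x cx; apply: ckM; [exact: ck_cst|exact: s1]. Qed.

Lemma smooth_fun_sum (I : Type) (r : seq I) (u : I -> M -> R) :
  (forall i, smooth_fun (u i)) -> smooth_fun (fun x => \sum_(i <- r) u i x).
Proof.
move=> su c ac k x cx.
by apply: (@ck_sum R n R^o k I r xpredT (fun i => function_rep c (u i))) => i _; exact: su.
Qed.

Lemma local_rep_open c d F : continuous F ->
  open (coord c @` (chart_dom c `&` F @^-1` chart_dom d)).
Proof.
move=> cF; rewrite openE => y [x [cx dx] <-].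
have cy := coord_im cx.
have : \forall z \near coord c x, chart_im c z /\ chart_dom d (F (coord_inv c z)).
  apply: filterS2 (near_im cy) (near_coord_inv (P := fun x => chart_dom d (F x)) cy _); last first.
    by rewrite coordKP //; apply: continuous_near (cF x) _; exact: near_dom dx.
  by move=> z.
apply: filterS => z [cz dz]; exists (coord_inv c z); last exact: coord_invK.
by split=> //; exact: coord_inv_dom.
Qed.

Lemma smooth_map_ck F c d k x : smooth_map F -> atlas c -> atlas d ->
  chart_dom c x -> chart_dom d (F x) -> ck k (local_rep c d F) (coord c x).
Proof.
move=> [cF sF] ac ad cx dx; have := sF c d ac ad k.
by move=> /(Ck_onP _ _ (@local_rep_open c d F cF)); apply; exists x.
Qed.

Lemma smooth_mapP F : continuous F ->
  (forall x, exists c d, [/\ atlas c, atlas d, chart_dom c x, chart_dom d (F x) &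
     forall k, ck k (local_rep c d F) (coord c x)]) -> smooth_map F.
Proof.
move=> cF H; split=> // c d ac ad k; apply/(Ck_onP _ _ (@local_rep_open c d F cF)).
move=> _ [x [cx dx] <-]; have [c' [d' [ac' ad' cx' dx' kF]]] := H x.
have cy := coord_im cx.
have k1 := ck_transition k ac ac' cx cx'.
have k2 : ck k (local_rep c' d' F) ((coord c' \o coord_inv c) (coord c x)).
  by rewrite /= coordKP.
have k3 := ck_transition k ad' ad dx' dx.
have k12 := ck_comp_row k2 k1.
have k3' : ck k (coord d \o coord_inv d')
    (local_rep c' d' F ((coord c' \o coord_inv c) (coord c x))).
  by rewrite /local_rep /= !coordKP.
have H3 := ck_comp_row (F := fun y => local_rep c' d' F ((coord c' \o coord_inv c) y)) k3' k12.
apply: (ck_near_eq _ H3).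
have near1 : \forall y \near coord c x, chart_dom c' (coord_inv c y).
  by apply: near_coord_inv cy _; rewrite coordKP //; exact: near_dom cx'.
have near2 : \forall y \near coord c x, chart_dom d' (F (coord_inv c y)).
  apply: (near_coord_inv (P := fun x => chart_dom d' (F x)) cy).
  by rewrite coordKP //; apply: continuous_near (cF x) _; exact: near_dom dx'.
apply: filterS2 near1 near2 => y y1 y2.
by rewrite /local_rep /= (coordKP y1) (coordKP y2).
Qed.

Lemma smooth_map_id : smooth_map (@id M).
Proof.
apply: smooth_mapP => [x|x]; first exact: cvg_id.
have [c ac cx] := @atlas_cover _ _ M x; exists c, c; split=> // k.
exact: ck_transition.
Qed.

Lemma smooth_map_comp F1 F2 : smooth_map F1 -> smooth_map F2 -> smooth_map (F2 \o F1).
Proof.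
move=> s1 s2; have [[c1 _] [c2 _]] := (s1, s2).
apply: smooth_mapP => [x|x]; first exact: continuous_comp (c1 x) (c2 (F1 x)).
have [c ac cx] := @atlas_cover _ _ M x.
have [d ad dx] := @atlas_cover _ _ M (F1 x).
have [e ae ex] := @atlas_cover _ _ M (F2 (F1 x)).
exists c, e; split=> // k.
have k1 := smooth_map_ck k s1 ac ad cx dx.
have k2 := smooth_map_ck k s2 ad ae dx ex.
have k2' : ck k (local_rep d e F2) (local_rep c d F1 (coord c x)).
  by rewrite /local_rep /= coordKP.
apply: ck_near_eq (ck_comp_row k2' k1).
have cy := coord_im cx.
have near2 : \forall y \near coord c x, chart_dom d (F1 (coord_inv c y)).
  apply: (near_coord_inv (P := fun x => chart_dom d (F1 x)) cy).
  by rewrite coordKP //; apply: continuous_near (c1 x) _; exact: near_dom dx.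
by apply: filterS near2 => y y2; rewrite /local_rep /= (coordKP y2).
Qed.

Definition diffeo_id : diffeo M :=
  @Diffeo R n M id id (fun=> erefl) (fun=> erefl) smooth_map_id smooth_map_id.

Definition diffeo_comp (f g : diffeo M) : diffeo M :=
  @Diffeo R n M (g \o f) (diffeo_inv f \o diffeo_inv g)
    (can_comp (diffeo_funK g) (diffeo_funK f))
    (can_comp (diffeo_invK f) (diffeo_invK g))
    (smooth_map_comp (diffeo_fun_smooth f) (diffeo_fun_smooth g))
    (smooth_map_comp (diffeo_inv_smooth g) (diffeo_inv_smooth f)).

End Charts.

(** * Extension of functions and maps from a chart to the manifold *)

Section Transplant.
Context {R : realType} {n : nat} (M : smooth_manifold R n).
Variables (c : chart R n M) (K : set 'rV[R]_n).
Hypotheses (ac : atlas c) (cK : compact K) (Kc : K `<=` chart_im c).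

(** The Hausdorff property enters here. Since the support is closed in the whole of [M], extensions
    by 0 or by the identity are locally trivial at points outside the chart. *)
Lemma closed_coord_inv_compact : closed (coord_inv c @` K).
Proof.
apply: compact_closed; first exact: manifold_hausdorff.
apply: continuous_compact cK; apply: continuous_in_subspaceT => y /[!inE] Ky.
by apply: continuous_coord_inv; exact: Kc.
Qed.

Lemma near_off_support x : ~ chart_dom c x ->
  \forall z \near x, chart_dom c z -> ~ K (coord c z).
Proof.
move=> cx.
have xK : (~` (coord_inv c @` K)) x.
  by move=> [y Ky yx]; apply: cx; rewrite -yx; apply: coord_inv_dom; exact: Kc.
have oK : open (~` (coord_inv c @` K)).
  by apply: closed_openC; exact: closed_coord_inv_compact.
apply: filterS (open_nbhs_nbhs (conj oK xK)) => z zK cz Kz.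
by apply: zK; exists (coord c z) => //; rewrite coordKP.
Qed.

Definition extend_fun (u : 'rV[R]_n -> R) (x : M) : R :=
  if `[< chart_dom c x >] then u (coord c x) else 0.

Lemma extend_funE u x : chart_dom c x -> extend_fun u x = u (coord c x).
Proof. by move=> cx; rewrite /extend_fun asboolT. Qed.

Lemma extend_fun_out u x : ~ chart_dom c x -> extend_fun u x = 0.
Proof. by move=> cx; rewrite /extend_fun asboolF. Qed.

Lemma extend_fun_rep (u : 'rV[R]_n -> R^o) y : chart_im c y ->
  function_rep c (extend_fun u) y = u y.
Proof.
by move=> cy; rewrite /function_rep /= (extend_funE _ (coord_inv_dom cy)) coord_invK.
Qed.

Lemma smooth_extend_fun (u : 'rV[R]_n -> R^o) : (forall y, ~ K y -> u y = 0) ->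
  (forall k y, chart_im c y -> ck k u y) -> smooth_fun (extend_fun u).
Proof.
move=> u0 su; apply: smooth_funP => x.
have [cx|cx] := pselect (chart_dom c x).
  exists c; split=> // k; apply: ck_near_eq (su k _ (coord_im cx)).
  by apply: filterS (near_im (coord_im cx)) => y cy; rewrite extend_fun_rep.
have [d ad dx] := @atlas_cover _ _ M x; exists d; split=> // k.
apply: ck_near_eq (ck_cst k (0 : R^o) _).
have := near_coord_inv (coord_im dx) (P := fun z => extend_fun u z = 0).
rewrite coordKP // => H; apply: filterS (H _); first by move=> y; rewrite /function_rep.
apply: filterS (near_off_support cx) => z zK.
have [cz|cz] := pselect (chart_dom c z); last exact: extend_fun_out.
by rewrite extend_funE // u0 //; exact: zK.
Qed.

Section TransplantMap.
Variables (F G : 'rV[R]_n -> 'rV[R]_n).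
Hypotheses (FK : cancel F G) (GK : cancel G F).
Hypothesis (F_id : forall y, ~ K y -> F y = y).

Definition transplant (x : M) : M :=
  if `[< chart_dom c x >] then coord_inv c (F (coord c x)) else x.

Lemma transplantE x : chart_dom c x -> transplant x = coord_inv c (F (coord c x)).
Proof. by move=> cx; rewrite /transplant asboolT. Qed.

Lemma transplant_out x : ~ chart_dom c x -> transplant x = x.
Proof. by move=> cx; rewrite /transplant asboolF. Qed.

(** A point sent outside [K] is sent to a fixed point of [F], hence equals it by injectivity; so [F]
    cannot move a point of [K] out of [K]. *)
Lemma transplant_im y : chart_im c y -> chart_im c (F y).
Proof.
have [Ky _|Ky cy] := pselect (K y); last by rewrite F_id.
have [KF|KF] := pselect (K (F y)); first exact: Kc.
by have := F_id KF => /(can_inj FK) ->; exact: Kc.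
Qed.

Lemma transplant_dom x : chart_dom c x -> chart_dom c (transplant x).
Proof.
by move=> cx; rewrite transplantE //; apply: coord_inv_dom; apply: transplant_im; exact: coord_im.
Qed.

Lemma coord_transplant x : chart_dom c x -> coord c (transplant x) = F (coord c x).
Proof.
by move=> cx; rewrite transplantE // coord_invK //; apply: transplant_im; exact: coord_im.
Qed.

Lemma transplant_fix x : ~ K (coord c x) -> transplant x = x.
Proof.
have [cx|cx _] := pselect (chart_dom c x); last exact: transplant_out.
by move=> Kx; rewrite transplantE // F_id // coordKP.
Qed.

Lemma near_transplant_out x : ~ chart_dom c x -> \forall z \near x, transplant z = z.
Proof.
move=> cx; apply: filterS (near_off_support cx) => z zK.
have [cz|cz] := pselect (chart_dom c z); last exact: transplant_out.
by apply: transplant_fix; exact: zK.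
Qed.

Lemma continuous_transplant : (forall y, ck 0 F y) -> continuous transplant.
Proof.
move=> cF x; have [cx|cx] := pselect (chart_dom c x).
  have c1 : {for x, continuous (F \o coord c)}.
    exact: continuous_comp (continuous_coord cx) (ck_continuous (cF _)).
  have c2 : {for (F \o coord c) x, continuous (coord_inv c)}.
    by apply: continuous_coord_inv; apply: transplant_im; exact: coord_im.
  apply: near_eq_continuous (continuous_comp c1 c2).
  by apply: filterS (near_dom cx) => z cz; rewrite transplantE.
apply: (@near_eq_continuous _ _ id); last exact: cvg_id.
by apply: filterS (near_transplant_out cx) => z ->.
Qed.

Lemma smooth_transplant : (forall k y, ck k F y) -> smooth_map transplant.
Proof.
move=> sF; apply: smooth_mapP => [|x]; first exact: continuous_transplant.
have [cx|cx] := pselect (chart_dom c x).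
  exists c, c; split=> //; first exact: transplant_dom.
  move=> k; apply: ck_near_eq (sF k _).
  apply: filterS (near_im (coord_im cx)) => y cy.
  by rewrite /local_rep /= (coord_transplant (coord_inv_dom cy)) coord_invK.
have [d ad dx] := @atlas_cover _ _ M x; exists d, d; split=> //.
  by rewrite transplant_out.
move=> k; apply: ck_near_eq (ck_transition k ad ad dx dx).
have := near_coord_inv (coord_im dx) (P := fun z => transplant z = z).
rewrite coordKP // => /(_ (near_transplant_out cx)).
by apply: filterS => y E; rewrite /local_rep /= E.
Qed.

End TransplantMap.

Lemma transplantK F G : cancel F G -> (forall y, ~ K y -> F y = y) ->
  cancel (transplant F) (transplant G).
Proof.
move=> FG Fid x; have [cx|cx] := pselect (chart_dom c x); last first.
  by rewrite !transplant_out.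
rewrite {1}/transplant asboolT; last exact: transplant_dom.
by rewrite (coord_transplant FG Fid cx) FG coordKP.
Qed.

End Transplant.

(** * A Sard lemma *)

Section CompactUniform.
Context {R : realType} {V : normedModType R}.

(** A Lebesgue number argument: around each point half of the local radius is spent on moving the
    centre, the other half on the distance from the new centre. *)
Lemma compact_uniform (K : set V) (P : V -> V -> Prop) : compact K ->
  (forall x, K x -> exists2 r : R, 0 < r & forall y z,
     `|y - x| <= r -> `|z - x| <= r -> P y z) ->
  exists2 e : R, 0 < e & forall x z, K x -> `|z - x| <= e -> P x z.
Proof.
move=> /compact_near_coveringP cK H.
pose Q (e : R) (x : V) := forall z, `|z - x| <= e -> P x z.
have HQ x : K x -> \forall x' \near x & e \near (0 : R)^'+, Q e x'.
  move=> /H[r r0 rP].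
  exists (closed_ball_ (fun v : V => `|v|) x (r / 2), [set e | e <= r / 2]) => /=.
    split.
      apply: (near_closed_ballP x _).2; exists (r / 2); first by rewrite divr_gt0.
      by move=> y yx; rewrite /closed_ball_ /= distrC.
    by near=> e; near: e; apply: nbhs_right_le; rewrite divr_gt0.
  move=> [x' e] /= [x'x er] z zx'; apply: rP.
    by rewrite distrC; apply: le_trans x'x _; rewrite ler_pdivrMr// mulr_natr mulr2n lerDl ltW.
  rewrite -(subrKA x'); apply: le_trans (ler_normD _ _) _.
  rewrite (splitr r) lerD //; first exact: le_trans zx' er.
  by rewrite distrC.
have near0 := cK R (0^'+) Q (at_right_proper_filter _) HQ.
have [e [e0 eK]] : exists e : R, 0 < e /\ K `<=` Q e.
  near (0 : R)^'+ => e; exists e; split; first by near: e; exact: nbhs_right_gt.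
  by near: e.
by exists e => // x z Kx; exact: eK.
Unshelve. all: by end_near. Qed.

Lemma compact_bounded_above (K : set V) (f : V -> R) : compact K ->
  (forall x, K x -> {for x, continuous (f : V -> R^o)}) ->
  exists2 C : R, 0 < C & forall x, K x -> f x <= C.
Proof.
move=> /compact_near_coveringP cK cf.
pose Q (C : R) (x : V) := f x <= C.
have HQ x : K x -> \forall x' \near x & C \near +oo, Q C x'.
  move=> /cf/cvgrPdist_le /(_ _ ltr01) fx.
  exists ([set t | `|f x - f t| <= 1], [set C | f x + 1 <= C]) => /=.
    by split=> //; near=> C; near: C; apply: nbhs_pinfty_ge; rewrite num_real.
  move=> [x' C] /= [+ xC]; rewrite /Q ler_norml => /andP[+ _]; lra.
have nearC := cK R +oo Q proper_pinfty_nbhs HQ.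
near +oo_R => C; exists C; first by near: C; apply: nbhs_pinfty_gt; rewrite num_real.
by near: C.
Unshelve. all: by end_near. Qed.

End CompactUniform.

Lemma continuous_sum_at (R : realType) (T : topologicalType) (I : finType)
    (F : I -> T -> R) (x : T) : (forall i, {for x, continuous (F i)}) ->
  {for x, continuous (fun y => \sum_i F i y)}.
Proof.
move=> cF; apply: (@cvg_big R I +%R 0 xpredT) => [|i _]; last exact: cF.
exact: add_continuous.
Qed.

Lemma compact_cube (R : realType) (n : nat) (y : 'rV[R]_n) (r : R) :
  compact [set x : 'rV[R]_n | `|x - y| <= r].
Proof.
apply: bounded_closed_compact.
  exists (`|y| + r); split; first by rewrite num_real.
  move=> t yt x /= xy; apply: le_trans (ltW yt).
  by rewrite -(subrK y x) addrC; apply: le_trans (ler_normD _ _) _; rewrite lerD2l.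
have -> : [set x : 'rV[R]_n | `|x - y| <= r] = (fun x => `|x - y|) @^-1` [set t | t <= r] by [].
apply: closed_comp; last exact: closed_le.
move=> x _; apply: continuous_comp; last exact: norm_continuous.
by apply: continuousB; [exact: cvg_id|exact: cst_continuous].
Qed.

Section UniformDifferentiability.
Context {R : realType} {n : nat}.

(** Continuity of the partial derivatives moves the linear part from [x] to [y]. In this form the
    estimate can be made uniform by [compact_uniform]. *)
Lemma ck1_strict_moving (u : 'rV[R]_n -> R^o) x e : ck 1 u x -> 0 < e ->
  exists2 r, 0 < r & forall y z, `|y - x| <= r -> `|z - x| <= r ->
    `|u z - u y - \sum_j partial j u y * (z 0 j - y 0 j)| <= e * `|z - y|.
Proof.
move=> u1 e0; have e2 : 0 < e / 2 by rewrite divr_gt0.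
have n0 : 0 < n.+1%:R :> R by rewrite ltr0Sn.
have en : 0 < e / 2 / n.+1%:R by rewrite divr_gt0.
have [r r0 rP] := ck1_strict u1 e2.
have nr : \forall y \near x, forall j : 'I_n,
    `|partial j u x - partial j u y| <= e / 2 / n.+1%:R.
  apply: (@filter_forall _ _ (fun j y =>
    `|partial j u x - partial j u y| <= e / 2 / n.+1%:R) _ (nbhs_filter x)) => j.
  by have /cvgrPdist_le/(_ _ en) := ck_continuous (ck_partial j u1).
have [s s0 sP] := (near_closed_ballP _ _).1 nr.
exists (Num.min r s); first by rewrite lt_min r0.
move=> y z; rewrite !le_min => /andP[yr ys] /andP[zr _].
have -> : u z - u y - \sum_j partial j u y * (z 0 j - y 0 j) =
    (u z - u y - \sum_j partial j u x * (z 0 j - y 0 j)) +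
    \sum_j (partial j u x - partial j u y) * (z 0 j - y 0 j).
  rewrite -[RHS]addrA; congr (_ + _); rewrite -sumrN -sumrN -big_split /=.
  by apply: eq_bigr => j _; ring.
apply: le_trans (ler_normD _ _) _; rewrite (splitr e) mulrDl lerD //; first exact: rP.
apply: le_trans (ler_norm_sum _ _ _) _.
apply: le_trans (_ : \sum_j e / 2 / n.+1%:R * `|(z - y) 0 j| <= _).
  apply: ler_sum => j _; rewrite normrM !mxE; apply: ler_wpM2r => //; exact: sP.
rewrite -mulr_sumr -mulrA; apply: ler_wpM2l; first exact: ltW.
rewrite ler_pdivrMl //; apply: le_trans (rV_sum_le _) _.
by rewrite ler_wpM2r // ler_nat.
Qed.

Lemma ler_term_sum (I : finType) (F : I -> R) i : (forall i, 0 <= F i) -> F i <= \sum_i F i.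
Proof. by move=> F0; rewrite (bigD1 i) //= lerDl sumr_ge0. Qed.

End UniformDifferentiability.

Section MiniSard.
Context {R : realType} {p : nat}.
Notation n := p.+1.
Variables (g : 'I_n -> 'rV[R]_n -> R^o) (y0 : 'rV[R]_n) (r : R).
Hypothesis r0 : 0 < r.
Let K : set 'rV[R]_n := [set x | `|x - y0| <= r].
Hypothesis g1 : forall i x, K x -> ck 1 (g i) x.

Let uniform_strict e : 0 < e -> exists2 d, 0 < d & forall x z, K x -> `|z - x| <= d ->
  forall i, `|g i z - g i x - \sum_j partial j (g i) x * (z 0 j - x 0 j)| <= e * `|z - x|.
Proof.
move=> e0; apply: (@compact_uniform R _ K (fun x z => forall i,
  `|g i z - g i x - \sum_j partial j (g i) x * (z 0 j - x 0 j)| <= e * `|z - x|)).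
  exact: compact_cube.
move=> x Kx.
have : \forall d \near (0 : R)^'+, forall i, forall y z, `|y - x| <= d -> `|z - x| <= d ->
    `|g i z - g i y - \sum_j partial j (g i) y * (z 0 j - y 0 j)| <= e * `|z - y|.
  apply: filter_forall => i; have [s s0 sP] := ck1_strict_moving (g1 i Kx) e0.
  near=> d => y z yd zd; apply: sP.
    by apply: le_trans yd _; near: d; exact: nbhs_right_le.
  by apply: le_trans zd _; near: d; exact: nbhs_right_le.
move=> near0; near (0 : R)^'+ => d; exists d; first by near: d; exact: nbhs_right_gt.
move=> y z yd zd i.
have H : forall i, forall y z, `|y - x| <= d -> `|z - x| <= d ->
    `|g i z - g i y - \sum_j partial j (g i) y * (z 0 j - y 0 j)| <= e * `|z - y|.
  by near: d.
exact: H.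
Unshelve. all: by end_near. Qed.

Let jacobian_bounded : exists2 C : R, 0 < C &
  forall x, K x -> forall i, \sum_j `|partial j (g i) x| <= C.
Proof.
have [||C C0 CP] := @compact_bounded_above R _ K (fun x => \sum_i \sum_j `|partial j (g i) x|).
- exact: compact_cube.
- move=> x Kx; apply: continuous_sum_at => i; apply: continuous_sum_at => j.
  apply: continuous_comp; last exact: norm_continuous.
  exact: ck_continuous (ck_partial j (g1 i Kx)).
exists C => // x Kx i; apply: le_trans (CP _ Kx).
apply: (@ler_term_sum R _ (fun i => \sum_j `|partial j (g i) x|)) => k.
exact: sumr_ge0.
Qed.

Let max_coord (u : 'rV[R]_n) : u != 0 -> exists i, u 0 i != 0 /\ forall j, `|u 0 j| <= `|u 0 i|.
Proof.
move=> u0; have [i _ iP] := @arg_maxP _ _ _ (ord0 : 'I_n) xpredT (fun i => `|u 0 i|) isT.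
exists i; split; last by move=> j; exact: iP.
apply: contra u0 => /eqP ui; apply/eqP/rowP => j; rewrite mxE.
by apply/eqP; rewrite -normr_le0 (le_trans (iP j isT)) // ui normr0.
Qed.

(** Labels (cells, residues of the other [p] coordinates, one parity) against grid points. For fixed
    [Z], [L] both sides grow like N^n, but like W^p and W^n in [W], with [n = p.+1]. The condition
    on [W] does not involve [N], which is chosen after [W]. *)
Let counting (Z L N W : nat) : (0 < N)%N ->
  (2 * (3 * Z.+1) ^ n * L.+1 ^ p < W)%N ->
  ((2 * (Z.+1 * N)).+1 ^ n * (L.+1 * W) ^ p * 2 < (N * W) ^ n)%N.
Proof.
move=> N0 HW; have W0 : (0 < W)%N by exact: leq_ltn_trans HW.
have h1 : ((2 * (Z.+1 * N)).+1 ^ n <= (3 * Z.+1 * N) ^ n)%N by rewrite leq_exp2r //; lia.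
apply: (@leq_ltn_trans ((3 * Z.+1 * N) ^ n * (L.+1 * W) ^ p * 2)).
  by rewrite leq_mul2r leq_mul2r h1 !orbT.
rewrite !expnMn.
have NW : (0 < N ^ n * W ^ p)%N by rewrite muln_gt0 !expn_gt0 N0 W0.
have -> : (3 ^ n * Z.+1 ^ n * N ^ n * (L.+1 ^ p * W ^ p) * 2 =
  (N ^ n * W ^ p) * (2 * (3 ^ n * Z.+1 ^ n) * L.+1 ^ p))%N by ring.
have -> : (N ^ n * W ^ n = (N ^ n * W ^ p) * W)%N by rewrite [(W ^ n)%N]expnSr mulnA.
by rewrite ltn_mul2l NW /= -expnMn.
Qed.

Let mod_close (a b q : nat) : `|a%:R - b%:R : R| < q%:R -> (a %% q = b %% q)%N -> a = b.
Proof.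
wlog ab : a b / (a <= b)%N => [H|].
  case: (leqP a b) => [|/ltnW] ab abq E; first exact: H.
  by apply/esym; apply: H => //; rewrite distrC.
rewrite distrC -natrB // normr_nat ltr_nat => bq /esym/eqP.
rewrite eqn_mod_dvd // => qb; apply/eqP; rewrite eqn_leq ab /= -subn_eq0.
by apply: contraTT bq => /= ; rewrite -lt0n -leqNgt => /dvdn_leq; exact.
Qed.

(* Suppose that every grid point [a = delta * k], [k] in [{0, ..., m - 1}^n], is the value of
   [g] at a singular point [x k]. Cut the cube into cells of side [eta = W * delta]. If [x k]
   and [x l] lie in the same cell, then [|k_j - l_j| < L.+1 * W] for all [j] since [g] is
   Lipschitz; and if [k] and [l] agree except in one coordinate [i], chosen so that the
   covector annihilating the image of [Dg] at a point of the cell is largest at [i],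
   then [|k_i - l_i| <= 1]. So [k] is determined by the cell, the residues of the [k_j]
   modulo [L.+1 * W] for [j != i] and the parity of [k_i], which leaves fewer
   possibilities than there are grid points. *)
Lemma mini_sard rho : 0 < rho -> exists a : 'rV[R]_n, `|a| <= rho /\
  forall x, K x -> (forall i, g i x = a 0 i) ->
    \det (\matrix_(i, j) partial j (g i) x) != 0.
Proof.
move=> rho0; apply: contrapT => noa.
have singular (a : 'rV[R]_n) : exists x, `|a| <= rho ->
    [/\ K x, forall i, g i x = a 0 i & \det (\matrix_(i, j) partial j (g i) x) = 0].
  apply: contrapT => /forallNP nox; apply: noa; exists a.
  have ar : `|a| <= rho by apply: contrapT => ar; apply: (nox 0).
  split=> // x Kx gx; apply/eqP => d0; apply: (nox x) => _; split=> //.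
have [C C0 CP] := jacobian_bounded.
pose L := Num.truncn (C + 1); have CL : C + 1 < L.+1%:R by exact: truncnS_gt.
pose Z := Num.truncn (r / rho).
have ZP : r / Z.+1%:R <= rho.
  by rewrite ler_pdivrMr ?ltr0Sn// mulrC -ler_pdivrMr// ltW// truncnS_gt.
pose W := (2 * (3 * Z.+1) ^ n * L.+1 ^ p).+1.
(* With this relative error in the linearization, the two errors bounded in [bound] add up to
   [delta] times the largest coordinate of the covector, that is, to one grid step. *)
pose w : R := (2 * n%:R * W%:R)^-1.
have W0 : 0 < W%:R :> R by rewrite ltr0Sn.
have n0 : 0 < n%:R :> R by rewrite ltr0Sn.
have w0 : 0 < w by rewrite invr_gt0 !mulr_gt0.
have [d d0 dP] := uniform_strict w0.
have [d1 d10 d1P] := uniform_strict (@ltr01 R).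
pose dd := Num.min d d1; have dd0 : 0 < dd by rewrite lt_min d0.
pose N := (Num.truncn (r / dd)).+1.
have Nd : r / N%:R <= dd.
  by rewrite ler_pdivrMr ?ltr0Sn// mulrC -ler_pdivrMr// ltW// truncnS_gt.
(* [A] is a multiple of [Z.+1] so that [m] grid steps of length [delta] add up to r / Z.+1, which is
   at most [rho], while [2 * A] cells of side [eta] span an edge of the cube. *)
pose A := (Z.+1 * N)%N; have A0 : 0 < A%:R :> R by rewrite ltr0n muln_gt0.
pose eta := r / A%:R; have eta0 : 0 < eta by rewrite divr_gt0.
have etad : eta <= dd.
  apply: le_trans Nd; rewrite /eta ler_pM2l // lef_pV2 ?posrE ?ltr0Sn //.
  by rewrite ler_nat /A leq_pmull.
pose m := (N * W)%N; pose delta := eta / W%:R.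
have delta0 : 0 < delta by rewrite divr_gt0.
have mdelta : m%:R * delta <= rho.
  suff -> : m%:R * delta = r / Z.+1%:R by [].
  have N0 : N%:R != 0 :> R by rewrite pnatr_eq0.
  have Z0 : Z.+1%:R != 0 :> R by rewrite pnatr_eq0.
  rewrite /m /delta /eta /A !natrM; move: (lt0r_neq0 W0) N0 Z0.
  move: (W%:R) (N%:R) (Z.+1%:R) => a b c a0 b0 c0.
  by field; rewrite a0 b0 c0.
pose T := {ffun 'I_n -> 'I_m}.
pose a (k : T) : 'rV[R]_n := \row_i ((k i : nat)%:R * delta).
have ak k : `|a k| <= rho.
  apply: rV_norm_le => [|i]; first exact: ltW.
  rewrite mxE ger0_norm; last by rewrite mulr_ge0 // ltW.
  apply: le_trans mdelta; apply: ler_wpM2r; first exact: ltW.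
  by rewrite ler_nat ltnW.
have [x xP] := choice (fun k => singular (a k)).
have Kx k : K (x k) by have [] := xP k (ak k).
have gx k i : g i (x k) = (k i : nat)%:R * delta.
  by have [_ -> _] := xP k (ak k); rewrite mxE.
have dx k : \det (\matrix_(i, j) partial j (g i) (x k)) = 0.
  by have [] := xP k (ak k).
pose t k j := (x k 0 j - y0 0 j + r) / eta.
have t_ge0 k j : 0 <= t k j.
  have := le_trans (rV_coord_le _ j) (Kx k); rewrite !mxE ler_norml => /andP[h _].
  by rewrite divr_ge0 ?(ltW eta0) // -lerBlDr sub0r.
have t_le k j : t k j <= (2 * A)%:R.
  have := le_trans (rV_coord_le _ j) (Kx k); rewrite !mxE ler_norml => /andP[_ h].
  rewrite ler_pdivrMr // natrM /eta.
  have -> : 2%:R * A%:R * (r / A%:R) = r + r by field; exact: lt0r_neq0.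
  by rewrite lerD2r.
pose cell k : {ffun 'I_n -> 'I_(2 * A).+1} := [ffun j => inord (Num.truncn (t k j))].
have cellE k j : cell k j = Num.truncn (t k j) :> nat.
  rewrite ffunE inordK // ltnS -(ler_nat R); apply: le_trans (t_le k j).
  by rewrite truncn_le.
have near_cell k l : cell k = cell l -> `|x k - x l| <= eta.
  move=> kl; apply: rV_norm_le => [|j]; first exact: ltW.
  have := cellE k j; rewrite kl cellE => E.
  have hk := truncn_itv (t_ge0 k j); have hl := truncn_itv (t_ge0 l j).
  have : `|t k j - t l j| <= 1.
    move: hk hl; rewrite E => /andP[a1 a2] /andP[b1 b2]; rewrite ler_norml.
    by rewrite -natr1 in a2 b2; lra.
  have -> : t k j - t l j = (x k - x l) 0 j / eta by rewrite /t !mxE; field; exact: lt0r_neq0.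
  by rewrite normrM normfV (gtr0_norm eta0) ler_pdivrMr // mul1r.
have lip k l i : `|x k - x l| <= eta -> `|g i (x k) - g i (x l)| < L.+1%:R * eta.
  move=> kl; have kl1 : `|x k - x l| <= d1.
    by apply: le_trans kl _; apply: le_trans etad _; rewrite ge_min lexx orbT.
  have := d1P _ _ (Kx l) kl1 i; rewrite mul1r => H.
  rewrite -[X in `|X|](subrK (\sum_j partial j (g i) (x l) * (x k 0 j - x l 0 j))).
  apply: le_lt_trans (ler_normD _ _) _.
  have H2 : `|\sum_j partial j (g i) (x l) * (x k 0 j - x l 0 j)| <= C * `|x k - x l|.
    apply: le_trans (ler_norm_sum _ _ _) _.
    apply: le_trans (ler_wpM2r (normr_ge0 _) (CP _ (Kx l) i)).
    rewrite mulr_suml; apply: ler_sum => j _; rewrite normrM; apply: ler_wpM2l => //.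
    by have := rV_coord_le (x k - x l) j; rewrite !mxE.
  apply: le_lt_trans (lerD H H2) _; rewrite -[X in X + _]mul1r -mulrDl addrC.
  have C1 : 0 <= C + 1 by rewrite addr_ge0 // ltW.
  by apply: le_lt_trans (ler_wpM2l C1 kl) _; rewrite ltr_pM2r.
have null k : exists u : 'rV[R]_n, exists i, [/\ u 0 i != 0, forall j, `|u 0 j| <= `|u 0 i| &
    forall j, \sum_i u 0 i * partial j (g i) (x k) = 0].
  have /eqP/det0P[u u0 uM] := dx k; exists u.
  have [i [ui iP]] := max_coord u0; exists i; split=> // j.
  move: uM => /rowP/(_ j); rewrite !mxE => E; rewrite -[RHS]E.
  by apply: eq_bigr => s _; rewrite mxE.
have {}null k : exists ui : 'rV[R]_n * 'I_n, [/\ ui.1 0 ui.2 != 0,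
    forall j, `|ui.1 0 j| <= `|ui.1 0 ui.2| &
    forall j, \sum_i ui.1 0 i * partial j (g i) (x k) = 0].
  by have [u [i ?]] := null k; exists (u, i).
have [ui uiP] := choice null.
have m0 : (0 < m)%N by rewrite muln_gt0.
pose k0 : T := [ffun=> Ordinal m0].
(* A representative of each cell, so that the covector and the direction [ic k] can be recovered
   from the cell alone. Otherwise equal labels would not refer to the same direction. *)
pose ref c := odflt k0 [pick k | cell k == c].
have refP k : cell (ref (cell k)) = cell k.
  rewrite /ref; case: pickP => [l /eqP //|/(_ k)]; by rewrite eqxx.
pose Q' := (L.+1 * W).-1.
have Q'E : Q'.+1 = (L.+1 * W)%N by rewrite prednK // muln_gt0.
pose ic k := (ui (ref (cell k))).2.
pose lab k : {ffun 'I_n -> 'I_(2 * A).+1} * {ffun 'I_p -> 'I_Q'.+1} * 'I_2 :=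
  (cell k, [ffun j => inord (k (lift (ic k) j) %% Q'.+1)%N], inord (k (ic k) %% 2)%N).
suff lab_inj : injective lab.
  have := leq_card lab lab_inj.
  rewrite !card_prod !card_ffun !card_ord Q'E leqNgt.
  by rewrite counting // /W.
move=> k l; rewrite /lab => -[ckl Hj Hi].
have ikl : ic k = ic l by rewrite /ic ckl.
set i := ic l in ikl.
have klx := near_cell _ _ ckl.
have close j : `|(k j : nat)%:R - (l j : nat)%:R : R| < Q'.+1%:R.
  have := lip k l j klx; rewrite !gx -mulrBl normrM (gtr0_norm delta0) -ltr_pdivlMr //.
  move=> /lt_le_trans; apply; rewrite Q'E natrM /delta.
  by rewrite le_eqVlt; apply/orP; left; apply/eqP; field; rewrite !lt0r_neq0.
have eqj j : k (lift i j) = l (lift i j).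
  apply: val_inj; apply: mod_close (close _) _.
  have := congr1 (fun F : {ffun 'I_p -> 'I_Q'.+1} => nat_of_ord (F j)) Hj.
  by rewrite !ffunE !inordK ?ltn_pmod // ikl.
have eqi : k i = l i.
  apply: val_inj; apply: (@mod_close _ _ 2); last first.
    by have := congr1 (fun f : 'I_2 => nat_of_ord f) Hi; rewrite !inordK ?ltn_pmod // ikl.
  have [] := uiP (ref (cell l)); rewrite -/(ic l) -/i.
  set u := (ui _).1; set xr := x _ => ui0 uimax unull.
  have bound s : cell s = cell l ->
      `|\sum_j u 0 j * (g j (x s) - g j xr)| <= n%:R * `|u 0 i| * (w * eta).
    move=> sl; have sr : `|x s - xr| <= eta by apply: near_cell; rewrite refP.
    have srd : `|x s - xr| <= d.
      by apply: le_trans sr _; apply: le_trans etad _; rewrite ge_min lexx.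
    (* The linear part may be subtracted freely: [u] annihilates the image of the differential at
       [xr]. *)
    have -> : \sum_j u 0 j * (g j (x s) - g j xr) = \sum_j u 0 j *
        (g j (x s) - g j xr - \sum_q partial q (g j) xr * (x s 0 q - xr 0 q)).
      apply/esym; under eq_bigr do rewrite mulrBr.
      rewrite sumrB [X in _ - X](_ : _ = 0) ?subr0 //.
      under eq_bigr do rewrite mulr_sumr.
      rewrite exchange_big /= big1 // => q _.
      under eq_bigr do rewrite mulrA.
      by rewrite -mulr_suml unull mul0r.
    apply: le_trans (ler_norm_sum _ _ _) _.
    apply: le_trans (_ : \sum_(j < n) `|u 0 i| * (w * eta) <= _).
      apply: ler_sum => j _; rewrite normrM; apply: ler_pM => //.
      apply: le_trans (dP _ _ (Kx _) srd j) _; apply: ler_wpM2l => //; exact: ltW.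
    by rewrite sumr_const card_ord -[leLHS]mulr_natl mulrA.
  (* Only the term of index [i] survives, as [k] and [l] agree in all other coordinates. *)
  have E : u 0 i * (((k i : nat)%:R - (l i : nat)%:R) * delta) =
      \sum_j u 0 j * (g j (x k) - g j xr) - \sum_j u 0 j * (g j (x l) - g j xr).
    rewrite -sumrB (bigD1 i) //= big1 ?addr0.
      by rewrite !gx; ring.
    move=> j; case: (unliftP i j) => [j' ->|->]; last by rewrite eqxx.
    by move=> _; rewrite !gx eqj subrr.
  have := ler_normB (\sum_j u 0 j * (g j (x k) - g j xr)) (\sum_j u 0 j * (g j (x l) - g j xr)).
  rewrite -E => /le_trans /(_ (lerD (bound k ckl) (bound l erefl))).
  rewrite 2!normrM (gtr0_norm delta0).
  have -> : n%:R * `|u 0 i| * (w * eta) + n%:R * `|u 0 i| * (w * eta) = `|u 0 i| * (1 * delta).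
    rewrite /w /delta; field.
    by rewrite !lt0r_neq0.
  have ui_gt0 : 0 < `|u 0 i| by rewrite normr_gt0.
  rewrite ler_pM2l // ler_pM2r // => /le_lt_trans; apply.
  by rewrite ltr1n.
by apply/ffunP => j; case: (unliftP i j) => [j' ->|->].
Qed.

End MiniSard.

Arguments ck : simpl never.

(** * Functions with nondegenerate critical points *)

Section ContinuityAt.
Context {R : realType} {T : topologicalType} {I : finType}.

Lemma continuous_prod_at (F : I -> T -> R) (x : T) :
  (forall i, {for x, continuous (F i)}) ->
  {for x, continuous (fun y => \prod_i F i y)}.
Proof.
move=> cF; apply: (@cvg_big R I *%R 1 xpredT) => [|i _]; last exact: cF.
exact: mul_continuous.
Qed.

End ContinuityAt.

Lemma continuous_det_at (R : realType) (T : topologicalType) (n : nat)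
    (A : 'I_n -> 'I_n -> T -> R) (x : T) :
  (forall i j, {for x, continuous (A i j)}) ->
  {for x, continuous (fun y => \det (\matrix_(i, j) A i j y))}.
Proof.
move=> cA.
have -> : (fun y => \det (\matrix_(i, j) A i j y)) =
    (fun y => \sum_(s : {perm 'I_n}) (-1) ^+ s * \prod_i A i (s i) y).
  apply/funext => y; apply: eq_bigr => s _; congr (_ * _).
  by apply: eq_bigr => i _; rewrite mxE.
apply: continuous_sum_at => s; apply: continuousM; first exact: cst_continuous.
by apply: continuous_prod_at => i; exact: cA.
Qed.

Section Nondegenerate.
Context {R : realType} {n : nat}.
Implicit Types (f : 'rV[R]_n -> R^o).

Definition hessian f v : 'M[R]_n := \matrix_(i, j) partial j (partial i f) v.

Definition nondegenerate f v := (exists k, partial k f v != 0) \/ \det (hessian f v) != 0.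

Lemma partial_near_eq f g v j : (\forall y \near v, f y = g y) ->
  partial j f v = partial j g v.
Proof. exact: near_eq_derive. Qed.

Lemma partial_near_eq2 f g v i j : (\forall y \near v, f y = g y) ->
  partial j (partial i f) v = partial j (partial i g) v.
Proof.
move=> fg; apply: partial_near_eq; apply: filterS (near_join fg) => y.
exact: partial_near_eq.
Qed.

End Nondegenerate.

Section LinearCombination.
Context {R : realType} {n q : nat}.
Implicit Types (f : 'rV[R]_n -> R^o) (w : 'I_q -> 'rV[R]_n -> R^o).

Definition lincomb w f (a : 'rV[R]_q) (v : 'rV[R]_n) : R^o := f v + \sum_k a 0 k * w k v.

Lemma partial_lincomb w f a j v : ck 1 f v -> (forall l, ck 1 (w l) v) ->
  partial j (lincomb w f a) v = lincomb (fun l => partial j (w l)) (partial j f) a v.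
Proof.
move=> kf kw.
have df := @ck_derivable _ _ _ _ _ _ j kf.
have dwl l := @ck_derivable _ _ _ _ _ _ j (kw l).
have dw l : derivable (fun v => a 0 l * w l v : R^o) v (delta_mx 0 j).
  by apply: derivableM; [exact: derivable_cst|exact: dwl].
have E : lincomb w f a = f + \sum_l (fun v => a 0 l * w l v : R^o).
  by apply/funext => y; rewrite /lincomb fctE fct_sumE.
rewrite /partial E (deriveD df (derivable_sum dw)) (derive_sum dw); congr (_ + _); apply: eq_bigr => l _.
have := @deriveM _ _ (fun=> a 0 l) (w l) v (delta_mx 0 j) (@derivable_cst _ _ _ _ _ _) (dwl l).
by rewrite derive_cst scaler0 addr0 => ->.
Qed.

Lemma near_ck_family w k v : (forall l, ck k (w l) v) ->
  \forall y \near v, forall l, ck k (w l) y.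
Proof.
move=> kw; apply: (@filter_forall _ _ (fun l y => ck k (w l) y) _ (nbhs_filter v)) => l.
exact: ck_nbhs.
Qed.

Lemma partial2_lincomb w f a i j v : ck 2 f v -> (forall l, ck 2 (w l) v) ->
  partial j (partial i (lincomb w f a)) v =
  lincomb (fun l => partial j (partial i (w l))) (partial j (partial i f)) a v.
Proof.
move=> kf kw.
have E : \forall y \near v, partial i (lincomb w f a) y =
    lincomb (fun l => partial i (w l)) (partial i f) a y.
  apply: filterS2 (ck_nbhs kf) (near_ck_family kw) => y fy wy.
  exact: (partial_lincomb a i (ckS fy) (fun l => ckS (wy l))).
rewrite (partial_near_eq j E).
exact: (partial_lincomb a j (ck_partial i kf) (fun l => ck_partial i (kw l))).
Qed.

Lemma continuous_lincomb w f v : {for v, continuous f} -> (forall l, {for v, continuous (w l)}) ->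
  {for (v, 0 : 'rV[R]_q), continuous (fun va : 'rV[R]_n * 'rV[R]_q => lincomb w f va.2 va.1)}.
Proof.
move=> cf cw.
have c1 (u : 'rV[R]_n -> R^o) : {for v, continuous u} ->
    {for (v, 0 : 'rV[R]_q), continuous (fun va : 'rV[R]_n * 'rV[R]_q => u va.1)}.
  by move=> cu; apply: continuous_comp; [exact: cvg_fst|exact: cu].
apply: continuousD; first exact: c1.
apply: continuous_sum_at => l; apply: continuousM; last exact: c1.
have c2 : {for (v, 0 : 'rV[R]_q), continuous (fun va : 'rV[R]_n * 'rV[R]_q => va.2)}.
  exact: cvg_snd.
exact: (continuous_comp c2 (@coord_continuous R 1 q 0 l _)).
Qed.

(** Near each point of [K] a nonzero partial derivative, or a nonzero Hessian determinant, stays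
    nonzero as a continuous function of the pair (point, parameter); compactness makes the parameter
    neighbourhood uniform. *)
Lemma nondegenerate_stable w f (K : set 'rV[R]_n) : compact K ->
  (forall v, K v -> ck 2 f v) -> (forall l v, K v -> ck 2 (w l) v) ->
  (forall v, K v -> nondegenerate f v) ->
  \forall a \near (0 : 'rV[R]_q), forall v, K v -> nondegenerate (lincomb w f a) v.
Proof.
move=> /compact_near_coveringP cK kf kw nd.
apply: (cK _ _ (fun a v => nondegenerate (lincomb w f a) v) (nbhs_filter _)).
move=> v Kv.
have f2 := kf v Kv; have w2 l := kw l v Kv.
have nf : \forall va \near (v, 0 : 'rV[R]_q), ck 2 f va.1 /\ forall l, ck 2 (w l) va.1.
  have : \forall y \near v, ck 2 f y /\ forall l, ck 2 (w l) y.
    exact: (filterS2 _ _ (ck_nbhs f2) (near_ck_family w2)).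
  by move=> H; apply: (@cvg_fst _ _ (nbhs v) (nbhs (0 : 'rV[R]_q)) _ _ H).
have lin0 (u : 'I_q -> 'rV[R]_n -> R^o) g : lincomb u g 0 v = g v.
  by rewrite /lincomb big1 ?addr0 // => l _; rewrite mxE mul0r.
case: (nd v Kv) => [[k fk]|dk].
  have ct : {for (v, 0 : 'rV[R]_q), continuous (fun va : 'rV[R]_n * 'rV[R]_q =>
      lincomb (fun l => partial k (w l)) (partial k f) va.2 va.1)}.
    apply: continuous_lincomb => [|l]; first exact: ck_continuous (ck_partial k f2).
    exact: ck_continuous (ck_partial k (w2 l)).
  have : \forall va \near (v, 0 : 'rV[R]_q),
      lincomb (fun l => partial k (w l)) (partial k f) va.2 va.1 != 0.
    apply: (continuous_near (P := fun t => t != 0) ct).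
    by apply: (open_nbhs_nbhs (conj (@open_neq R 0) _)); rewrite /= lin0.
  apply: filterS2 nf => -[y a] /= [fy wy] ne; left; exists k.
  by rewrite (partial_lincomb a k (ckS fy) (fun l => ckS (wy l))).
have ct : {for (v, 0 : 'rV[R]_q), continuous (fun va : 'rV[R]_n * 'rV[R]_q =>
    \det (\matrix_(i, j) lincomb (fun l => partial j (partial i (w l)))
      (partial j (partial i f)) va.2 va.1))}.
  apply: continuous_det_at => i j.
  apply: continuous_lincomb => [|l].
    exact: ck_continuous (ck_partial j (ck_partial i f2)).
  exact: ck_continuous (ck_partial j (ck_partial i (w2 l))).
have : \forall va \near (v, 0 : 'rV[R]_q),
    \det (\matrix_(i, j) lincomb (fun l => partial j (partial i (w l)))
      (partial j (partial i f)) va.2 va.1) != 0.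
  apply: (continuous_near (P := fun t => t != 0) ct).
  apply: (open_nbhs_nbhs (conj (@open_neq R 0) _)) => /=.
  by under eq_mx do rewrite lin0.
apply: filterS2 nf => -[y a] /= [fy wy] ne; right.
rewrite /hessian; move: ne; congr (\det _ != 0); apply/matrixP => i j; rewrite !mxE.
by rewrite (partial2_lincomb a i j fy wy).
Qed.

End LinearCombination.

Lemma compact_finite_cover (T : topologicalType) (U : T -> set T) :
  compact [set: T] -> (forall x, nbhs x (U x)) ->
  exists s : seq T, forall x, exists2 y, y \in s & U y x.
Proof.
move=> /compact_near_coveringP cT nU.
(* The filter of properties holding for all sufficiently large finite lists. Compactness in its
   near-covering form, applied along this filter, yields one list that serves every point. *)
pose F : set_system (seq T) := [set A | exists s0 : seq T, forall s : seq T,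
  {subset s0 <= s} -> A s].
have FF : Filter F.
  split=> [|A B [s sA] [t tB]|A B AB [s sA]]; first by exists [::].
  - exists (s ++ t) => w sw; split; [apply: sA|apply: tB] => x xs; apply: sw;
      by rewrite mem_cat xs ?orbT.
  - by exists s => w sw; apply: AB; exact: sA.
have [|s sP] := cT _ F (fun s x => exists2 y, y \in s & U y x) FF.
  move=> x _; exists (U x, [set s : seq T | x \in s]) => /=.
    by split; [exact: nU|exists [:: x] => s; apply; rewrite inE].
  by move=> [y s] /= [Uy xs]; exists x.
by exists s => x; exact: sP.
Qed.

(** * Cubical patches and cut-off coordinates *)

Section Patches.
Context {R : realType} {n : nat} (M : smooth_manifold R n).

(* With [r] the radius of a patch: its core is the cube of radius [r], its bump is 1 on
   the cube of radius [2 * r] and vanishes off the cube of radius [3 * r], and the cube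
   of radius [4 * r] lies in the image of the chart. *)
Record patch := Patch {
  patch_chart : chart R n M;
  patch_center : 'rV[R]_n;
  patch_radius : R }.

Definition patch_cube (P : patch) (t : R) : set 'rV[R]_n :=
  [set v | `|v - patch_center P| <= t * patch_radius P].

Definition good_patch P := [/\ atlas (patch_chart P), 0 < patch_radius P &
  patch_cube P 4 `<=` chart_im (patch_chart P)].

Definition patch_core P : set M :=
  [set x | chart_dom (patch_chart P) x /\ patch_cube P 1 (coord (patch_chart P) x)].

Lemma compact_patch_cube P t : compact (patch_cube P t).
Proof. exact: compact_cube. Qed.

Lemma patch_cube_le P s t : 0 < patch_radius P -> s <= t -> patch_cube P s `<=` patch_cube P t.
Proof.
by move=> r0 st v /= vs; apply: le_trans vs _; apply: ler_wpM2r => //; exact: ltW.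
Qed.

Lemma patch_at x : exists P, [/\ good_patch P, chart_dom (patch_chart P) x &
  patch_center P = coord (patch_chart P) x].
Proof.
have [c ac cx] := @atlas_cover _ _ M x.
have [r r0 rP] := (near_closed_ballP _ _).1 (near_im (coord_im cx)).
exists (Patch c (coord c x) (r / 4)); split=> //; split=> //=.
  by rewrite divr_gt0.
by move=> v /= vr; apply: rP; apply: le_trans vr _; rewrite mulrCA divff // mulr1.
Qed.

Lemma patch_cover : compact [set: M] -> exists (m : nat) (P : 'I_m -> patch),
  (forall i, good_patch (P i)) /\ forall x, exists i, patch_core (P i) x.
Proof.
move=> cM.
have [Q QP] := choice patch_at.
have nQ x : nbhs x (patch_core (Q x)).
  have [[_ r0 _] cx E] := QP x.
  have : \forall v \near coord (patch_chart (Q x)) x, patch_cube (Q x) 1 v.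
    apply: (near_closed_ballP _ _).2; exists (patch_radius (Q x)) => // v.
    by rewrite /patch_cube /= mul1r E.
  by move=> /(near_coord cx) H; exact: (filterS2 _ _ (near_dom cx) H).
have [s sP] := compact_finite_cover cM nQ.
exists (size s), (fun i => Q (tnth (in_tuple s) i)); split=> [i|x].
  by have [] := QP (tnth (in_tuple s) i).
have [y ys Qyx] := sP x.
have ys' : y \in in_tuple s by exact: ys.
by have [i yi] := tnthP _ _ ys'; exists i; rewrite -yi.
Qed.

Definition patch_bump P (v : 'rV[R]_n) : R := cube_bump (patch_center P) (patch_radius P) v.

Lemma patch_bump_1 P v : 0 < patch_radius P -> patch_cube P 2 v -> patch_bump P v = 1.
Proof. exact: cube_bump_1. Qed.

Lemma patch_bump_0 P v : 0 < patch_radius P -> ~ patch_cube P 3 v -> patch_bump P v = 0.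
Proof.
move=> r0 /= v3; apply: cube_bump_0 => //; apply: ltW.
by rewrite ltNge; apply/negP.
Qed.

Definition patch_coord P (k : 'I_n) : M -> R :=
  extend_fun (patch_chart P) (fun v => patch_bump P v * v 0 k).

Lemma smooth_patch_coord P k : good_patch P -> smooth_fun (patch_coord P k).
Proof.
move=> [ac r0 Pc].
apply: (@smooth_extend_fun _ _ _ _ (patch_cube P 3)) => //.
- exact: compact_patch_cube.
- by apply: subset_trans Pc; apply: patch_cube_le => //; rewrite ler_nat.
- by move=> v /patch_bump_0 -> //; rewrite mul0r.
- by move=> q v _; apply: ckM; [exact: ck_cube_bump|exact: ck_coord].
Qed.

Lemma patch_coord_near P k v : good_patch P -> patch_cube P 1 v ->
  \forall y \near v, function_rep (patch_chart P) (patch_coord P k) y = y 0 k.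
Proof.
move=> [ac r0 Pc] v1; apply: (near_closed_ballP v _).2; exists (patch_radius P) => // y yv.
have y2 : patch_cube P 2 y.
  rewrite /patch_cube /= -(subrKA v) mulrDl mul1r.
  by apply: le_trans (ler_normD _ _) _; rewrite lerD //; move: v1; rewrite /patch_cube /= mul1r.
rewrite /patch_coord extend_fun_rep ?patch_bump_1 ?mul1r //.
by apply: Pc; apply: patch_cube_le y2 => //; rewrite ler_nat.
Qed.

Lemma patch_cube1_im P v : good_patch P -> patch_cube P 1 v -> chart_im (patch_chart P) v.
Proof.
by move=> [ac r0 Pc] v1; apply: Pc; apply: patch_cube_le v1 => //; rewrite ler1n.
Qed.

End Patches.

Section MorseFunction.
Context {R : realType} {p : nat} (M : smooth_manifold R p.+1).
Notation n := p.+1.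

Definition morse_on (h : M -> R) (P : patch M) := forall v, patch_cube P 1 v ->
  nondegenerate (function_rep (patch_chart P) h) v.

Definition perturb (P : patch M) (h : M -> R) (a : 'rV[R]_n) : M -> R :=
  fun x => h x + \sum_k a 0 k * patch_coord P k x.

Lemma smooth_perturb P h a : good_patch P -> smooth_fun h -> smooth_fun (perturb P h a).
Proof.
move=> gP sh; apply: smooth_funD => //; apply: smooth_fun_sum => k.
by apply: smooth_funZ; exact: smooth_patch_coord.
Qed.

Lemma morse_on_stable P Q h : good_patch P -> good_patch Q -> smooth_fun h ->
  morse_on h Q -> \forall a \near (0 : 'rV[R]_n), morse_on (perturb P h a) Q.
Proof.
move=> gP gQ sh mh; have [aQ _ _] := gQ.
apply: (@nondegenerate_stable _ _ _ (fun k => function_rep (patch_chart Q) (patch_coord P k))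
  (function_rep (patch_chart Q) h) (patch_cube Q 1)) mh.
- exact: compact_patch_cube.
- by move=> v v1; apply: smooth_fun_im => //; exact: patch_cube1_im.
- move=> k v v1; apply: smooth_fun_im => //; last exact: patch_cube1_im.
  exact: smooth_patch_coord.
Qed.

(** On the core the perturbation by [- a] subtracts the linear form with coefficients [a]. Its
    critical points are the solutions of grad f = a and its Hessian is that of f, so it is enough
    that [a] be a regular value of the gradient. *)
Lemma morse_on_perturb P h rho : good_patch P -> smooth_fun h -> 0 < rho ->
  exists2 a : 'rV[R]_n, `|a| <= rho & morse_on (perturb P h a) P.
Proof.
move=> gP sh rho0; have [ac r0 Pc] := gP.
pose f := function_rep (patch_chart P) h.
have f2 v : patch_cube P 1 v -> ck 2 f v.
  by move=> v1; apply: smooth_fun_im => //; exact: patch_cube1_im.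
have cubeE v : patch_cube P 1 v = (`|v - patch_center P| <= patch_radius P) :> Prop.
  by rewrite /patch_cube /= mul1r.
have [|a [ar aP]] := @mini_sard R p (fun i => partial i f) (patch_center P)
    (patch_radius P) r0 _ rho rho0.
  by move=> i v /=; rewrite -cubeE => /f2; exact: ck_partial.
exists (- a); first by rewrite normrN.
move=> v v1; have f2v := f2 v v1.
have E : \forall y \near v, lincomb (fun k y => y 0 k) f (- a) y =
    function_rep (patch_chart P) (perturb P h (- a)) y.
  have : \forall y \near v, forall k,
      function_rep (patch_chart P) (patch_coord P k) y = y 0 k.
    apply: (@filter_forall _ _ (fun k y =>
      function_rep (patch_chart P) (patch_coord P k) y = y 0 k) _ (nbhs_filter v)) => k.
    exact: patch_coord_near.
  apply: filterS => y yE; rewrite /lincomb /perturb /function_rep /=.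
  by congr (_ + _); apply: eq_bigr => k _; congr (_ * _); rewrite -yE.
have c2 l := @ck_coord R n 2 l v.
have [[k fk]|/forallNP nk] := pselect (exists k,
    partial k (lincomb (fun k y => y 0 k) f (- a)) v != 0).
  by left; exists k; rewrite -(partial_near_eq k E).
right; rewrite /hessian.
have -> : (\matrix_(i, j) partial j (partial i (function_rep (patch_chart P) (perturb P h (- a)))) v)
    = \matrix_(i, j) partial j (partial i f) v.
  apply/matrixP => i j; rewrite [LHS]mxE [RHS]mxE -(partial_near_eq2 i j E).
  rewrite (partial2_lincomb (- a) i j f2v c2) /lincomb big1 ?addr0 // => l _.
  have -> : partial i (fun y : 'rV[R]_n => y 0 l : R^o) = fun=> (i == l)%:R.
    by apply/funext => y; rewrite partial_coord.
  by rewrite /partial derive_cst mulr0.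
apply: aP; first by rewrite /= -cubeE.
move=> i; have := nk i; move=> /negP; rewrite negbK => /eqP.
rewrite (partial_lincomb (- a) i (ckS f2v) (fun l => ckS (c2 l))) /lincomb.
rewrite (bigD1 i) //= big1 ?addr0; last first.
  by move=> l li; rewrite partial_coord eq_sym (negbTE li) mulr0.
by rewrite partial_coord eqxx mulr1 mxE => /eqP; rewrite subr_eq0 => /eqP.
Qed.

(** Each new perturbation is taken so small that the patches already treated stay nondegenerate. *)
Lemma morse_function (m : nat) (P : 'I_m -> patch M) : (forall i, good_patch (P i)) ->
  exists2 h : M -> R, smooth_fun h & forall i, morse_on h (P i).
Proof.
move=> gP.
suff H k : exists2 h : M -> R, smooth_fun h & forall i : 'I_m, (i < k)%N -> morse_on h (P i).
  by have [h sh mh] := H m; exists h => // i; exact: mh.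
elim: k => [|k [h sh mh]]; first by exists (fun=> 0) => //; exact: smooth_fun_cst.
have [km|km] := ltnP k m; last first.
  by exists h => // i _; apply: mh; exact: leq_trans km.
pose i0 := Ordinal km.
have : \forall a \near (0 : 'rV[R]_n), forall i : 'I_m, (i < k)%N ->
    morse_on (perturb (P i0) h a) (P i).
  apply: (@filter_forall _ _ (fun (i : 'I_m) a => (i < k)%N -> morse_on (perturb (P i0) h a) (P i)) _
    (nbhs_filter (0 : 'rV[R]_n))) => i.
  have [ik|ik] := boolP (i < k)%N; last by apply: filterE.
  by apply: filterS (morse_on_stable (gP i0) (gP i) sh (mh i ik)) => a.
move=> /near_closed_ballP [r r0 rP].
have [a ar aP] := morse_on_perturb (gP i0) sh r0.
exists (perturb (P i0) h a); first exact: smooth_perturb.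
move=> i; rewrite ltnS leq_eqVlt => /orP[/eqP ik|ik].
  by have -> : i = i0 by exact: val_inj.
by apply: rP => //; rewrite subr0.
Qed.

End MorseFunction.

(** * Gradient-like diffeomorphisms *)

Lemma cube_lipschitz (R : realType) (n : nat) (u : 'rV[R]_n -> R^o) (y : 'rV[R]_n) (r : R) :
  (forall v, `|v - y| <= r -> ck 1 u v) ->
  exists2 C : R, 0 < C & forall v w, `|v - y| <= r -> `|w - y| <= r ->
    `|u w - u v| <= C * `|w - v|.
Proof.
move=> u1.
have [||C C0 CP] := @compact_bounded_above R _ [set v | `|v - y| <= r]
    (fun v => \sum_j `|partial j u v|).
- exact: compact_cube.
- move=> v vr; apply: continuous_sum_at => j; apply: continuous_comp; last exact: norm_continuous.
  exact: ck_continuous (ck_partial j (u1 v vr)).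
exists (C * n.+1%:R); first by rewrite mulr_gt0.
move=> v w vr wr.
have := @box_mean_value R n u (fun=> 0) y r C _ v w vr wr.
rewrite big1 => [|j _]; last by rewrite mul0r.
rewrite subr0 => H; apply: le_trans (H _) _.
  move=> z zr j; split; first exact: (ck_derivable (u1 z zr)).
  rewrite subr0; apply: le_trans (CP z zr).
  by apply: (@ler_term_sum R _ (fun j => `|partial j u z|)).
rewrite -mulrA; apply: ler_wpM2l; first exact: ltW.
have := @rV_sum_le R n (w - v); under eq_bigr do rewrite !mxE.
by move=> /le_trans; apply; rewrite ler_wpM2r // ler_nat.
Qed.

(** * One coordinate step of descent *)

Section GradientStep.
Context {R : realType} {n : nat} (M : smooth_manifold R n).
Variables (P : patch M) (k : 'I_n) (h : M -> R).
Hypotheses (gP : good_patch P) (sh : smooth_fun h).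
Let c := patch_chart P.
Let y := patch_center P.
Let r := patch_radius P.
Let f := function_rep c h.
Let b (v : 'rV[R]_n) : R^o := patch_bump P v * partial k f v.

Let r0 : 0 < r. Proof. by have [] := gP. Qed.
Let ac : atlas c. Proof. by have [] := gP. Qed.
Let im4 v : patch_cube P 4 v -> chart_im c v.
Proof. by have [_ _] := gP; exact. Qed.
Let cube34 v : patch_cube P 3 v -> patch_cube P 4 v.
Proof. by apply: patch_cube_le => //; rewrite ler_nat. Qed.
Let f_smooth q v : chart_im c v -> ck q f v.
Proof. by move=> cv; apply: smooth_fun_im. Qed.

Let b_out v : ~ patch_cube P 3 v -> b v = 0.
Proof. by move=> /patch_bump_0 E; rewrite /b E // mul0r. Qed.

Let b_near_out v : ~ patch_cube P 3 v -> \forall w \near v, b w = 0.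
Proof.
move=> v3; have oC : open (~` patch_cube P 3).
  apply: closed_openC; apply: compact_closed; last exact: compact_patch_cube.
  exact: norm_hausdorff.
by apply: filterS (open_nbhs_nbhs (conj oC v3)) => w; exact: b_out.
Qed.

Let b_smooth q v : ck q b v.
Proof.
have [v3|v3] := pselect (patch_cube P 3 v).
  apply: ckM; first exact: ck_cube_bump.
  by apply: ck_partial; apply: f_smooth; apply: im4; exact: cube34.
apply: (ck_near_eq _ (ck_cst q (0 : R^o) v)).
by apply: filterS (b_near_out v3) => w ->.
Qed.

Let bounded_out (u : 'rV[R]_n -> R^o) : (forall v, ck 0 u v) ->
  (forall v, ~ patch_cube P 3 v -> u v = 0) ->
  exists2 C : R, 0 < C & forall v, `|u v| <= C.
Proof.
move=> cu u_out.
have [||C C0 CP] := @compact_bounded_above R _ (patch_cube P 3) (fun v => `|u v|).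
- exact: compact_patch_cube.
- move=> v _; apply: continuous_comp; last exact: norm_continuous.
  exact: ck_continuous (cu v).
exists C => // v; have [v3|v3] := pselect (patch_cube P 3 v); first exact: CP.
by rewrite u_out // normr0 ltW.
Qed.

(** The mean value theorem expresses the drop of [h] as the displacement times a partial derivative
    at an intermediate point. For small [e] this derivative keeps at least half of its value at the
    start, whence the factor 1/2. *)
Lemma gradient_step : exists (G : diffeo M) (e : R), [/\ 0 < e,
  forall x, ~ chart_dom c x -> G x = x,
  forall x, chart_dom c x -> chart_dom c (G x) /\
    coord c (G x) = coord c x - (e * b (coord c x)) *: delta_mx 0 k &
  forall x, chart_dom c x ->
    e / 2 * (patch_bump P (coord c x) * partial k f (coord c x) ^+ 2) <= h x - h (G x)].
Proof.
have [B B0 BP] := bounded_out (b_smooth 0) b_out.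
have [|B' B'0 B'P] := @bounded_out (partial k b) (fun v => ck_partial k (b_smooth 1 v)).
  move=> v /b_near_out H; have : \forall w \near v, b w = (fun=> 0 : R^o) w by [].
  by move=> /partial_near_eq ->; rewrite /partial derive_cst.
have [|L L0 LP] := @cube_lipschitz R n (partial k f) y (4 * r).
  by move=> v v4; apply: ck_partial; apply: f_smooth; exact: im4.
near (0 : R)^'+ => e.
have e0 : 0 < e by near: e; exact: nbhs_right_gt.
(* Three bounds on the step: [eB] keeps the segment of motion inside the cube of radius [4 * r],
   [eB'] makes the shear invertible, and [eL] limits the variation of the partial derivative along
   the segment. *)
have eB : e * B <= r.
  by rewrite -ler_pdivlMr //; near: e; apply: nbhs_right_le; rewrite divr_gt0.
have eB' : e * B' <= 2^-1.
  by rewrite -ler_pdivlMr //; near: e; apply: nbhs_right_le; rewrite divr_gt0.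
have eL : e * L <= 2^-1.
  by rewrite -ler_pdivlMr //; near: e; apply: nbhs_right_le; rewrite divr_gt0.
pose eb (v : 'rV[R]_n) : R^o := e * b v.
have eb_smooth q v : ck q eb v by apply: ckM; [exact: ck_cst|exact: b_smooth].
have eb_small v : `|partial k eb v| <= 2^-1.
  have db := @ck_derivable _ _ _ _ _ _ k (b_smooth 1 v).
  have -> : partial k eb v = e * partial k b v.
    have := @deriveM _ _ (fun=> e) b v (delta_mx 0 k) (@derivable_cst _ _ _ _ _ _) db.
    by rewrite derive_cst scaler0 addr0.
  by rewrite normrM (gtr0_norm e0); apply: le_trans eB'; rewrite ler_pM2l.
pose F := shear eb k; pose F' := shear_inv eb_smooth eb_small.
have FK : cancel F F' by exact: shearK.
have F'K : cancel F' F by exact: shear_invK.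
have eb_out v : ~ patch_cube P 3 v -> eb v = 0 by move=> /b_out; rewrite /eb => ->; rewrite mulr0.
have Fid v : ~ patch_cube P 3 v -> F v = v by move=> /eb_out; exact: shear_fix.
have F'id v : ~ patch_cube P 3 v -> F' v = v by move=> /eb_out; exact: shear_inv_fix.
have K3 : compact (patch_cube P 3) by exact: compact_patch_cube.
have K3c : patch_cube P 3 `<=` chart_im c by move=> v /cube34 /im4.
pose G : diffeo M := @Diffeo R n M (transplant c F) (transplant c F')
  (transplantK K3c FK Fid) (transplantK K3c F'K F'id)
  (smooth_transplant ac K3 K3c FK Fid (ck_shear _ eb_smooth))
  (smooth_transplant ac K3 K3c F'K F'id (ck_shear_inv eb_smooth eb_small)).
have Gc x : chart_dom c x -> chart_dom c (G x) /\
    coord c (G x) = coord c x - (e * b (coord c x)) *: delta_mx 0 k.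
  move=> cx; split; first exact: (transplant_dom K3c FK Fid cx).
  by rewrite /G /= (coord_transplant K3c FK Fid cx).
exists G, e; split=> //; first by move=> x cx; exact: transplant_out.
move=> x cx; have [cGx Gx] := Gc x cx.
set v := coord c x in Gx *; set d := partial k f v.
have fx : h x = f v by rewrite /f /function_rep /= coordKP.
have fGx : h (G x) = f (- eb v *: delta_mx 0 k + v).
  by rewrite scaleNr addrC -Gx /f /function_rep /= coordKP.
rewrite fx fGx.
have [v3|v3] := pselect (patch_cube P 3 v); last first.
  by rewrite eb_out // patch_bump_0 // oppr0 scale0r add0r subrr mul0r mulr0.
have ebr : `|eb v| <= r.
  by rewrite /eb normrM (gtr0_norm e0); apply: le_trans eB; rewrite ler_pM2l.
have in4 s : `|s| <= `|- eb v| -> patch_cube P 4 (s *: delta_mx 0 k + v).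
  rewrite normrN => sv; rewrite /patch_cube /= -addrA.
  apply: le_trans (ler_normD _ _) _.
  have -> : 4 * patch_radius P = r + 3 * r by rewrite -/r; ring.
  apply: lerD => //; apply: le_trans (norm_delta_mx _ _) _; exact: le_trans sv ebr.
have segN (s t : R) : (0 <= s <= t) || (t <= s <= 0) -> `|s| <= `|t|.
  by move=> /orP[] /andP[s1 s2];
    [rewrite !ger0_norm|rewrite !ler0_norm ?lerN2] => //; apply: le_trans s1 s2.
have [|s /segN sv E] := @line_mean_value R n f v k (- eb v).
  by move=> s /segN /in4 s4; apply: (@ck_derivable _ _ _ 0); apply: f_smooth; exact: im4.
have -> : f v - f (- eb v *: delta_mx 0 k + v) = eb v * partial k f (s *: delta_mx 0 k + v).
  by rewrite -opprB E mulNr opprK.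
set rho := patch_bump P v; have ebE : eb v = e * (rho * d) by [].
have rho0 : 0 <= rho by exact: cube_bump_ge0.
have rho1 : rho <= 1 by exact: cube_bump_le1.
have : `|partial k f (s *: delta_mx 0 k + v) - d| <= `|d| / 2.
  apply: le_trans (LP _ _ (cube34 v3) (in4 _ sv)) _; rewrite addrK.
  apply: le_trans (ler_wpM2l (ltW L0) (norm_delta_mx _ _)) _.
  apply: le_trans (ler_wpM2l (ltW L0) sv) _.
  rewrite normrN ebE !normrM (gtr0_norm e0) (ger0_norm rho0).
  have -> : L * (e * (rho * `|d|)) = e * L * (rho * `|d|) by ring.
  rewrite [leRHS]mulrC; apply: ler_pM => //.
  - by rewrite mulr_ge0 // ltW.
  - by rewrite mulr_ge0.
  - by rewrite ler_piMl.
set d' := partial k f _ => dd'.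
have H : d ^+ 2 / 2 <= d * d'.
  have H1 : `|d * (d' - d)| <= d ^+ 2 / 2.
    rewrite normrM -real_normK ?num_real // expr2 -mulrA; exact: ler_wpM2l.
  move: H1; rewrite ler_norml => /andP[H1 _].
  by rewrite -(subrK d d') mulrDr -expr2; lra.
rewrite ebE -!mulrA; apply: ler_wpM2l; first exact: ltW.
rewrite mulrCA; apply: ler_wpM2l => //.
by apply: le_trans H; rewrite mulrC.
Unshelve. all: by end_near. Qed.

End GradientStep.

Section LocallyLipschitz.
Context {R : realType} {n m : nat}.

Lemma ck1_lipschitz (u : 'rV[R]_n -> R^o) x : ck 1 u x -> exists2 C, 0 < C &
  \forall d \near (0 : R)^'+, forall y z, `|y - x| <= d -> `|z - x| <= d ->
    `|u y - u z| <= C * `|y - z|.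
Proof.
move=> u1; have [r r0 rP] := ck1_strict u1 (@ltr01 R).
exists (1 + \sum_j `|partial j u x|); first by rewrite ltr_pwDl // sumr_ge0.
near=> d => y z yd zd.
have dr : d <= r by near: d; exact: nbhs_right_le.
have := rP y z (le_trans yd dr) (le_trans zd dr); rewrite mul1r => H.
rewrite -[X in `|X| <= _](subrK (\sum_j partial j u x * (y 0 j - z 0 j))).
apply: le_trans (ler_normD _ _) _; rewrite mulrDl mul1r lerD //.
apply: le_trans (ler_norm_sum _ _ _) _; rewrite mulr_suml.
apply: ler_sum => j _; rewrite normrM; apply: ler_wpM2l => //.
by have := rV_coord_le (y - z) j; rewrite !mxE.
Unshelve. all: by end_near. Qed.

Lemma ck1_lipschitz_row (F : 'rV[R]_n -> 'rV[R]_m) x : ck 1 F x -> exists2 C, 0 < C &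
  \forall d \near (0 : R)^'+, forall y z, `|y - x| <= d -> `|z - x| <= d ->
    `|F y - F z| <= C * `|y - z|.
Proof.
move=> /ck_rowP F1.
have [C CP] := choice (fun j => (exists2P _ _).1 (ck1_lipschitz (F1 j))).
exists (1 + \sum_j C j).
  by rewrite ltr_pwDl // sumr_ge0 // => j _; have [/ltW] := CP j.
have : \forall d \near (0 : R)^'+, forall j, forall y z, `|y - x| <= d -> `|z - x| <= d ->
    `|F y 0 j - F z 0 j| <= C j * `|y - z|.
  by apply: filter_forall => j; have [_] := CP j.
apply: filterS => d dP y z yd zd.
have C0 : 0 <= 1 + \sum_j C j by rewrite addr_ge0 // sumr_ge0 // => j _; have [/ltW] := CP j.
apply: rV_norm_le => [|j]; first by rewrite mulr_ge0.
rewrite !mxE; apply: le_trans (dP j y z yd zd) _; apply: ler_wpM2r => //.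
rewrite (bigD1 j) //= addrCA lerDl addr_ge0 // sumr_ge0 // => i _.
by have [/ltW] := CP i.
Qed.

End LocallyLipschitz.

(** * Quadratic control of the drop under composition *)

Section Descent.
Context {R : realType} {n : nat} (M : smooth_manifold R n).
Variable (h : M -> R).
Hypothesis sh : smooth_fun h.
Implicit Types (Phi Psi : M -> M) (P : patch M).

(* All three properties below pass to compositions; [controls] says that a quadratic
   drop of [h] bounds the [k]-th partial derivative of [h] in the chart of [P]. *)
Definition descends Phi := [/\ continuous Phi, forall x, h (Phi x) <= h x &
  forall x, h (Phi x) = h x -> Phi x = x].

Definition moves_little Phi := forall p c, atlas c -> chart_dom c p -> Phi p = p ->
  exists2 C : R, 0 < C & \forall x \near p,
    `|coord c (Phi x) - coord c x| ^+ 2 <= C * (h x - h (Phi x)).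

Definition controls Phi P (k : 'I_n) := forall p, patch_core P p -> Phi p = p ->
  exists2 C : R, 0 < C & \forall x \near p,
    partial k (function_rep (patch_chart P) h) (coord (patch_chart P) x) ^+ 2
      <= C * (h x - h (Phi x)).

Lemma descends_id : descends id.
Proof. by split=> // x; exact: cvg_id. Qed.

Lemma moves_little_id : moves_little id.
Proof.
move=> p c ac cp _; exists 1 => //; apply: nearW => x.
by rewrite !subrr normr0 expr2 mul0r mulr0.
Qed.

(** At a fixed point of the composite, [h] cannot have dropped under either factor. So composing
    descent steps creates no new fixed points. *)
Lemma descends_fix Phi Psi x : descends Phi -> descends Psi -> Psi (Phi x) = x ->
  Phi x = x /\ Psi x = x.
Proof.
move=> [_ d1 e1] [_ d2 _] E.
have P1 : Phi x = x by apply: e1; apply/eqP; rewrite eq_le d1 /= -[X in h X <= _]E d2.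
by split=> //; rewrite -[in LHS]P1.
Qed.

Lemma descends_comp Phi Psi : descends Phi -> descends Psi -> descends (Psi \o Phi).
Proof.
move=> [c1 d1 e1] [c2 d2 e2]; split.
- by move=> x; exact: continuous_comp (c1 x) (c2 (Phi x)).
- by move=> x; exact: le_trans (d2 _) (d1 x).
- move=> x /= E; have P1 : Phi x = x.
    by apply: e1; apply/eqP; rewrite eq_le d1 /= -E d2.
  by rewrite P1 e2 // -[in LHS]P1.
Qed.

Lemma moves_little_comp Phi Psi : descends Phi -> descends Psi ->
  moves_little Phi -> moves_little Psi -> moves_little (Psi \o Phi).
Proof.
move=> D1 D2 m1 m2 p c ac cp /(descends_fix D1 D2)[p1 p2].
have [[c1 d1 _] [_ d2 _]] := (D1, D2).
have [C1 C10 H1] := m1 p c ac cp p1; have [C2 C20 H2] := m2 p c ac cp p2.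
exists (2 * (C1 + C2)); first by rewrite mulr_gt0 // addr_gt0.
have H2' : \forall x \near p,
    `|coord c (Psi (Phi x)) - coord c (Phi x)| ^+ 2 <= C2 * (h (Phi x) - h (Psi (Phi x))).
  by apply: (continuous_near (c1 p)
    (P := fun x => `|coord c (Psi x) - coord c x| ^+ 2 <= C2 * (h x - h (Psi x)))); rewrite p1.
apply: filterS2 H1 H2' => x /=; have := d1 x; have := d2 (Phi x).
have := ler_normD (coord c (Psi (Phi x)) - coord c (Phi x)) (coord c (Phi x) - coord c x).
rewrite subrKA.
move: `|_ - coord c x| (normr_ge0 (coord c (Psi (Phi x)) - coord c x)) => t.
move: `|_ - coord c (Phi x)| `|_ - coord c x| => a b t0 tab h1 h2 ha hb.
have : t ^+ 2 <= (a + b) ^+ 2 by rewrite lerXn2r ?nnegrE // (le_trans t0).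
have : 0 <= (a - b) ^+ 2 by exact: sqr_ge0.
have : 0 <= C1 * (h (Phi x) - h (Psi (Phi x))) by rewrite mulr_ge0 ?subr_ge0 // ltW.
have : 0 <= C2 * (h x - h (Phi x)) by rewrite mulr_ge0 ?subr_ge0 // ltW.
move: ha hb; rewrite !expr2; nra.
Qed.

Lemma controls_compl Phi Psi P k : descends Phi -> descends Psi ->
  controls Phi P k -> controls (Psi \o Phi) P k.
Proof.
move=> D1 D2 c1 p pP /(descends_fix D1 D2)[p1 p2]; have [C C0 H] := c1 p pP p1.
exists C => //; apply: filterS H => x /le_trans; apply; apply: ler_wpM2l; first exact: ltW.
by have [_ d2 _] := D2; rewrite lerD2l lerN2; exact: d2.
Qed.

(** [Psi] controls the partial derivative at [Phi x], not at [x]. The two values differ by at most a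
    Lipschitz constant times the displacement by [Phi], and [moves_little] bounds the square of this
    displacement by the drop of [h]. *)
Lemma controls_compr Phi Psi P k : good_patch P -> descends Phi -> descends Psi ->
  moves_little Phi -> controls Psi P k -> controls (Psi \o Phi) P k.
Proof.
move=> gP D1 D2 m1 c2 p pP /(descends_fix D1 D2)[p1 p2].
have [[c1 d1 _] [_ d2 _]] := (D1, D2); have [ac _ _] := gP.
have [cp _] := pP.
set c := patch_chart P in ac cp *.
have [C C0 H] := c2 p pP p2; have [C1 C10 H1] := m1 p c ac cp p1.
set d := partial k (function_rep c h) in H *.
have [L L0 LP] := @ck1_lipschitz R n d (coord c p) (ck_partial k (sh ac 2 cp)).
have {}H : \forall x \near p, d (coord c (Phi x)) ^+ 2 <= C * (h (Phi x) - h (Psi (Phi x))).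
  by apply: (continuous_near (c1 p)
    (P := fun x => d (coord c x) ^+ 2 <= C * (h x - h (Psi x)))); rewrite p1.
exists (2 * C + 2 * L ^+ 2 * C1).
  by rewrite addr_gt0 // !mulr_gt0 // exprn_gt0.
near (0 : R)^'+ => e.
have e0 : 0 < e by near: e; exact: nbhs_right_gt.
have eP y z : `|y - coord c p| <= e -> `|z - coord c p| <= e -> `|d y - d z| <= L * `|y - z|.
  by move: y z; near: e.
have ne : \forall x \near p, `|coord c x - coord c p| <= e.
  apply: (near_coord cp (P := fun v => `|v - coord c p| <= e)).
  by apply: (near_closed_ballP _ _).2; exists e.
have ne' : \forall x \near p, `|coord c (Phi x) - coord c p| <= e.
  by apply: (continuous_near (c1 p) (P := fun x => `|coord c x - coord c p| <= e)); rewrite p1.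
apply: filterS2 (filterI H H1) (filterI ne ne') => x /= [hx hx1] [xe xe'].
have := eP _ _ xe xe'; rewrite distrC [in X in _ <= X]distrC.
move: hx hx1; rewrite -/c.
move: (d (coord c x)) (d (coord c (Phi x))) => a b.
move: `|coord c (Phi x) - coord c x| (normr_ge0 (coord c (Phi x) - coord c x)) => t t0 hb ht.
have := d1 x; have := d2 (Phi x) => h2 h1 ab.
have k1 : (b - a) ^+ 2 <= L ^+ 2 * t ^+ 2.
  by rewrite -exprMn -real_normK ?num_real // lerXn2r ?nnegrE // mulr_ge0 // ltW.
have k2 : L ^+ 2 * t ^+ 2 <= L ^+ 2 * (C1 * (h x - h (Phi x))).
  by apply: ler_wpM2l => //; exact: sqr_ge0.
have k3 : 0 <= (2 * b - a) ^+ 2 by exact: sqr_ge0.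
have k4 : 0 <= C * (h x - h (Phi x)) by rewrite mulr_ge0 ?subr_ge0 // ltW.
have k5 : 0 <= L ^+ 2 * (C1 * (h (Phi x) - h (Psi (Phi x)))).
  by rewrite mulr_ge0 ?sqr_ge0 // mulr_ge0 ?subr_ge0 // ltW.
apply: le_trans (_ : 2 * b ^+ 2 + 2 * (b - a) ^+ 2 <= _).
  by rewrite -subr_ge0; have -> : 2 * b ^+ 2 + 2 * (b - a) ^+ 2 - a ^+ 2 = (2 * b - a) ^+ 2 by ring.
have -> : (2 * C + 2 * L ^+ 2 * C1) * (h x - h (Psi (Phi x))) =
  2 * (C * (h (Phi x) - h (Psi (Phi x))) + C * (h x - h (Phi x))) +
  2 * (L ^+ 2 * (C1 * (h x - h (Phi x))) + L ^+ 2 * (C1 * (h (Phi x) - h (Psi (Phi x))))) by ring.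
move: hb k1 k2 k4 k5; lra.
Unshelve. all: by end_near. Qed.

Lemma controlled_step P k : good_patch P -> exists G : diffeo M,
  [/\ descends G, moves_little G & controls G P k].
Proof.
move=> gP; have [G [e [e0 Gout Gin Gdesc]]] := gradient_step k gP sh.
have [ac r0 _] := gP.
set c := patch_chart P in Gout Gin Gdesc ac.
set d := partial k (function_rep c h) in Gin Gdesc.
have cG : continuous G by have [] := diffeo_fun_smooth G.
have rho0 v : 0 <= patch_bump P v by exact: cube_bump_ge0.
have rho1 v : patch_bump P v <= 1 by exact: cube_bump_le1.
have Gle x : h (G x) <= h x.
  have [cx|cx] := pselect (chart_dom c x); last by rewrite Gout.
  rewrite -subr_ge0; apply: le_trans (Gdesc x cx).
  apply: mulr_ge0; first by apply/ltW/divr_gt0.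
  by apply: mulr_ge0; [exact: rho0|exact: sqr_ge0].
have Gdisp x : chart_dom c x -> `|coord c (G x) - coord c x| ^+ 2 <= 2 * e * (h x - h (G x)).
  move=> cx; have [_ ->] := Gin x cx; rewrite addrAC subrr add0r normrN.
  set v := coord c x; apply: le_trans (_ : (e * (patch_bump P v * d v)) ^+ 2 <= _).
    rewrite -[leRHS]real_normK ?num_real // lerXn2r ?nnegrE //; exact: norm_delta_mx.
  have := Gdesc x cx; rewrite -/v.
  have H : patch_bump P v ^+ 2 * d v ^+ 2 <= patch_bump P v * d v ^+ 2.
    by apply: ler_wpM2r; [exact: sqr_ge0|rewrite expr2 ler_piMl].
  move=> /(ler_wpM2l (_ : 0 <= 2 * e)); rewrite mulr_ge0 ?(ltW e0) // => /(_ isT).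
  apply: le_trans; rewrite !exprMn.
  have -> : 2 * e * (e / 2 * (patch_bump P v * d v ^+ 2)) =
    e ^+ 2 * (patch_bump P v * d v ^+ 2) by field.
  by apply: ler_wpM2l => //; exact: sqr_ge0.
have Gfix x : h (G x) = h x -> G x = x.
  have [cx|cx] := pselect (chart_dom c x); last by rewrite Gout.
  move=> E; have [cGx _] := Gin x cx.
  have := Gdisp x cx; rewrite E subrr mulr0 => H.
  have : `|coord c (G x) - coord c x| ^+ 2 == 0 by rewrite eq_le H sqr_ge0.
  rewrite expf_eq0 /= normr_eq0 subr_eq0 => /eqP /(congr1 (coord_inv c)).
  by rewrite !coordKP.
exists G; split=> //.
- move=> p c' ac' cp' Gp; have [cp|cp] := pselect (chart_dom c p); last first.
    have Kc : patch_cube P 3 `<=` chart_im c.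
      have [_ _ Pc] := gP; apply: subset_trans Pc; apply: patch_cube_le => //.
      by rewrite ler_nat.
    exists 1 => //.
    have H := near_off_support (@compact_patch_cube _ _ _ P 3) Kc cp.
    apply: filterS H => x xK; suff -> : G x = x by rewrite !subrr expr2 normr0 mul0r mulr0.
    have [cx|cx] := pselect (chart_dom c x); last exact: Gout.
    have [cGx Gx] := Gin x cx.
    have {}Gx : coord c (G x) = coord c x.
      by rewrite Gx (patch_bump_0 r0 (xK cx)) mul0r mulr0 scale0r subr0.
    by have := congr1 (coord_inv c) Gx; rewrite !coordKP.
  have [C C0 CP] := ck1_lipschitz_row (ck_transition 1 ac ac' cp cp').
  exists (C ^+ 2 * (2 * e)); first by rewrite !mulr_gt0 // exprn_gt0.
  near (0 : R)^'+ => d0.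
  have d00 : 0 < d0 by near: d0; exact: nbhs_right_gt.
  have dP y z : `|y - coord c p| <= d0 -> `|z - coord c p| <= d0 ->
      `|(coord c' \o coord_inv c) y - (coord c' \o coord_inv c) z| <= C * `|y - z|.
    by move: y z; near: d0.
  have ne : \forall x \near p, chart_dom c x /\ `|coord c x - coord c p| <= d0.
    have H : \forall x \near p, `|coord c x - coord c p| <= d0.
      apply: (near_coord cp (P := fun v => `|v - coord c p| <= d0)).
      by apply: (near_closed_ballP _ _).2; exists d0.
    exact: (filterS2 _ _ (near_dom cp) H).
  have ne' : \forall x \near p, chart_dom c (G x) /\ `|coord c (G x) - coord c p| <= d0.
    by apply: (continuous_near (cG p)
      (P := fun x => chart_dom c x /\ `|coord c x - coord c p| <= d0)); rewrite Gp.
  apply: filterS2 ne ne' => x [cx xd] [cGx Gxd].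
  have := dP _ _ Gxd xd; rewrite /= !coordKP // => H.
  rewrite -mulrA; apply: le_trans (_ : (C * `|coord c (G x) - coord c x|) ^+ 2 <= _).
    by rewrite lerXn2r ?nnegrE // mulr_ge0 // ltW.
  by rewrite exprMn; apply: ler_wpM2l; [exact: sqr_ge0|exact: Gdisp].
- move=> p [cp p1] Gp; exists (2 / e); first by rewrite divr_gt0.
  have n2 : \forall v \near coord c p, patch_cube P 2 v.
    apply: (near_closed_ballP _ _).2; exists (patch_radius P) => // v vp.
    rewrite /patch_cube /= -(subrKA (coord c p)) mulrDl mul1r.
    apply: le_trans (ler_normD _ _) _; rewrite lerD //.
    by move: p1; rewrite /patch_cube /= mul1r.
  apply: filterS2 (near_dom cp) (near_coord cp n2) => x cx x2.
  have := Gdesc x cx; rewrite (patch_bump_1 r0 x2) mul1r.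
  by rewrite -ler_pdivlMl ?divr_gt0 // invf_div.
Unshelve. all: by end_near. Qed.

End Descent.

Section CriticalPoints.
Context {R : realType} {n : nat}.

Lemma sqr_norm_le_sum (v : 'rV[R]_n) : `|v| ^+ 2 <= \sum_k (v 0 k) ^+ 2.
Proof.
have [v0|/mx_norm_neq0 [[i j] /= E]] := eqVneq (mx_norm v) 0.
  by rewrite [in leLHS]/Num.Def.normr/= v0 expr2 mul0r sumr_ge0 // => k _; exact: sqr_ge0.
rewrite [in leLHS]/Num.Def.normr/= E real_normK ?num_real // (ord1 i).
by apply: (@ler_term_sum R _ (fun k => v 0 k ^+ 2)) => k; exact: sqr_ge0.
Qed.

(** Near [v0] the gradient is the Hessian applied to v - v0, up to a relatively small error;
    inverting the Hessian bounds v - v0 by the gradient. *)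
Lemma gradient_growth (f : 'rV[R]_n -> R^o) v0 : ck 2 f v0 ->
  (forall k, partial k f v0 = 0) -> \det (hessian f v0) != 0 ->
  exists2 B, 0 < B & \forall v \near v0, `|v - v0| ^+ 2 <= B * \sum_k partial k f v ^+ 2.
Proof.
move=> f2 f0 d0; set A := (hessian f v0)^T; set I := invmx A.
have uA : A \in unitmx by rewrite unitmxE det_tr unitfE.
pose B0 : R := 1 + \sum_j \sum_k `|I k j|.
have B00 : 0 < B0.
  by rewrite ltr_pwDl // sumr_ge0 // => j _; rewrite sumr_ge0.
have colB j : \sum_k `|I k j| <= B0.
  apply: le_trans (_ : \sum_j \sum_k `|I k j| <= _); last by rewrite lerDr.
  by apply: (@ler_term_sum R _ (fun j => \sum_k `|I k j|)) => i; rewrite sumr_ge0.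
(* [B0] bounds the inverse Hessian, so with this [e] the remainder accounts for at most half of |w|
   and can be absorbed. *)
pose e := 2^-1 / B0; have e0 : 0 < e by rewrite divr_gt0.
have near0 : \forall v \near v0, forall k,
    `|partial k f v - \sum_j hessian f v0 k j * (v - v0) 0 j| <= e * `|v - v0|.
  apply: (@filter_forall _ _ (fun k v =>
    `|partial k f v - \sum_j hessian f v0 k j * (v - v0) 0 j| <= e * `|v - v0|) _
    (nbhs_filter v0)) => k.
  have [r r0 rP] := ck1_strict (ck_partial k f2) e0.
  apply: (near_closed_ballP v0 _).2; exists r => // v vr.
  have := rP v v0 vr; rewrite subrr normr0 f0 subr0 => /(_ (ltW r0)).
  have E j : partial j (partial k f) v0 * (v 0 j - v0 0 j) =
    hessian f v0 k j * (v - v0) 0 j by rewrite /hessian !mxE.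
  by under eq_bigr do rewrite E.
exists ((2 * B0) ^+ 2); first by rewrite exprn_gt0 // mulr_gt0.
apply: filterS near0 => v vP.
pose g : 'rV[R]_n := \row_k partial k f v.
have gs : `|g| ^+ 2 <= \sum_k partial k f v ^+ 2.
  apply: le_trans (sqr_norm_le_sum g) _.
  by rewrite le_eqVlt; apply/orP; left; apply/eqP/eq_bigr => k _; rewrite mxE.
apply: le_trans (_ : (2 * B0 * `|g|) ^+ 2 <= _); last first.
  by rewrite exprMn; apply: ler_wpM2l => //; exact: sqr_ge0.
rewrite lerXn2r ?nnegrE ?mulr_ge0 ?(ltW B00) //.
set w := v - v0 in vP *; pose y := w *m A.
have yk k : `|y 0 k| <= `|g| + e * `|w|.
  have yE : y 0 k = \sum_j hessian f v0 k j * w 0 j.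
    by rewrite mxE; apply: eq_bigr => j _; rewrite [A _ _]mxE mulrC.
  rewrite yE -[X in `|X|](subKr (partial k f v)).
  apply: le_trans (ler_normB _ _) _; apply: lerD; last exact: vP.
  by have := rV_coord_le g k; rewrite mxE.
have wE : w = y *m I by rewrite /y -mulmxA mulmxV // mulmx1.
have : `|w| <= B0 * (`|g| + e * `|w|).
  have ge0 : 0 <= `|g| + e * `|w| by rewrite addr_ge0 // mulr_ge0 // ltW.
  apply: rV_norm_le => [|j]; first by rewrite mulr_ge0 // ltW.
  have wj : w 0 j = \sum_k y 0 k * I k j by rewrite {1}wE mxE.
  rewrite wj; apply: le_trans (ler_norm_sum _ _ _) _.
  apply: le_trans (_ : \sum_k `|I k j| * (`|g| + e * `|w|) <= _).
    by apply: ler_sum => k _; rewrite normrM mulrC; apply: ler_wpM2l.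
  by rewrite -mulr_suml; exact: (ler_wpM2r ge0 (colB j)).
have -> : B0 * (`|g| + e * `|w|) = B0 * `|g| + 2^-1 * `|w|.
  by rewrite /e; field; exact: lt0r_neq0.
lra.
Qed.

End CriticalPoints.

Section GradientLike.
Context {R : realType} {n : nat} (M : smooth_manifold R n).

Record gradient_like (h : M -> R) (phi : M -> M) : Prop := GradientLike {
  gl_smooth : smooth_fun h;
  gl_descends : descends h phi;
  gl_critical : forall p, phi p = p -> exists c, [/\ atlas c, chart_dom c p,
    forall k, partial k (function_rep c h) (coord c p) = 0 &
    exists2 kappa, 0 < kappa & \forall x \near p,
      kappa * `|coord c x - coord c p| ^+ 2 <= h x - h (phi x)] }.

Lemma controlled_diffeo (m : nat) (P : 'I_m -> patch M) (h : M -> R) :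
  (forall i, good_patch (P i)) -> smooth_fun h ->
  exists phi : diffeo M, [/\ descends h phi, moves_little h phi &
    forall i k, controls h phi (P i) k].
Proof.
move=> gP sh.
suff H (s : seq ('I_m * 'I_n)) : exists phi : diffeo M, [/\ descends h phi,
    moves_little h phi & forall ik, ik \in s -> controls h phi (P ik.1) ik.2].
  have [phi [d1 m1 c1]] := H (enum {: 'I_m * 'I_n}); exists phi; split=> // i k.
  by apply: (c1 (i, k)); rewrite mem_enum.
elim: s => [|[i k] s [psi [d2 m2 c2]]].
  by exists (diffeo_id M); split=> //; [exact: descends_id|exact: moves_little_id].
have [G [d1 m1 c1]] := controlled_step sh k (gP i).
exists (diffeo_comp G psi); split.
- exact: descends_comp.
- exact: moves_little_comp.
- move=> [j l]; rewrite inE => /orP[/eqP[-> ->]|jl] /=; first exact: controls_compl.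
  exact: (controls_compr sh (gP j) d1 d2 m1 (c2 _ jl)).
Qed.

(** [gradient_growth] bounds |x - p|^2 by the squared partial derivatives, and [controls] bounds
    each of these by the drop of [h]. *)
Lemma gradient_like_of_morse (m : nat) (P : 'I_m -> patch M) (h : M -> R) :
  (forall i, good_patch (P i)) -> (forall x, exists i, patch_core (P i) x) ->
  smooth_fun h -> (forall i v, patch_cube (P i) 1 v ->
    nondegenerate (function_rep (patch_chart (P i)) h) v) ->
  exists phi : diffeo M, gradient_like h phi.
Proof.
move=> gP cP sh mh; have [phi [d1 m1 c1]] := controlled_diffeo gP sh.
exists phi; split=> // p pp; have [i [cp p1]] := cP p.
have [ac r0 Pc] := gP i.
set c := patch_chart (P i) in cp ac p1.
have [C CP] := choice (fun k => (exists2P _ _).1 (c1 i k p (conj cp p1) pp)).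
(* The control inequality at [p] itself: the drop is 0 there, so a fixed point is critical. *)
have f0 k : partial k (function_rep c h) (coord c p) = 0.
  have [_ /nbhs_singleton] := CP k; rewrite pp subrr mulr0 => H.
  by apply/eqP; rewrite -sqrf_eq0 eq_le H sqr_ge0.
have d0 : \det (hessian (function_rep c h) (coord c p)) != 0.
  by have [[k]|//] := mh i _ p1; rewrite f0 eqxx.
exists c; split=> //.
have [B B0 BP] := gradient_growth (sh c ac 2 p cp) f0 d0.
have S0 : 0 < 1 + \sum_k C k.
  by rewrite ltr_pwDl // sumr_ge0 // => k _; have [/ltW] := CP k.
have BS : 0 < B * (1 + \sum_k C k) by rewrite mulr_gt0.
exists (B * (1 + \sum_k C k))^-1; first by rewrite invr_gt0.
have nC : \forall x \near p, forall k,
    partial k (function_rep c h) (coord c x) ^+ 2 <= C k * (h x - h (phi x)).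
  apply: (@filter_forall _ _ (fun k x =>
    partial k (function_rep c h) (coord c x) ^+ 2 <= C k * (h x - h (phi x))) _
    (nbhs_filter p)) => k.
  by have [] := CP k.
apply: filterS2 nC (near_coord cp BP) => x xC xB.
rewrite ler_pdivrMl // -mulrA; apply: le_trans xB _; apply: ler_wpM2l; first exact: ltW.
have hx : 0 <= h x - h (phi x) by have [_ d _] := d1; rewrite subr_ge0.
rewrite mulrDl mul1r mulr_suml; apply: le_trans (_ : \sum_k C k * (h x - h (phi x)) <= _).
  by apply: ler_sum => k _.
by rewrite lerDr.
Qed.

End GradientLike.

Lemma gradient_like_exists (R : realType) (p : nat) (M : smooth_manifold R p.+1) :
  compact [set: M] -> exists (h : M -> R) (phi : diffeo M), gradient_like h phi.
Proof.
move=> cM; have [m [P [gP cP]]] := patch_cover cM.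
have [h sh mh] := morse_function gP.
by exists h; exact: gradient_like_of_morse gP cP sh mh.
Qed.

(** * Neighbourhoods in the C^1 topology *)

Section ChartBall.
Context {R : realType} {n : nat} (M : smooth_manifold R n).
Implicit Types (c d : chart R n M) (x : M) (r : R).

Definition chart_ball c x r : set M :=
  [set z | chart_dom c z /\ `|coord c z - coord c x| <= r].

Definition cube_in_chart c x r :=
  chart_dom c x /\ forall v, `|v - coord c x| <= r -> chart_im c v.

Lemma near_cube_in_chart c x : chart_dom c x -> \forall r \near (0 : R)^'+, cube_in_chart c x r.
Proof.
move=> cx; have [r r0 rP] := (near_closed_ballP _ _).1 (near_im (coord_im cx)).
near=> s; split=> // v vs; apply: rP; apply: le_trans vs _.
by near: s; exact: nbhs_right_le.
Unshelve. all: by end_near. Qed.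

Lemma chart_ball_nbhs c x r : chart_dom c x -> 0 < r -> nbhs x (chart_ball c x r).
Proof.
move=> cx r0; have : \forall v \near coord c x, `|v - coord c x| <= r.
  by apply: (near_closed_ballP _ _).2; exists r.
move=> /(near_coord cx) H; exact: (filterS2 _ _ (near_dom cx) H).
Qed.

Lemma chart_ballE c x r : cube_in_chart c x r ->
  chart_ball c x r = coord_inv c @` [set v | `|v - coord c x| <= r].
Proof.
move=> [cx xr]; apply/seteqP; split=> z /=.
  by move=> [cz zr]; exists (coord c z) => //; rewrite coordKP.
by move=> [v vr <-]; have cv := xr v vr; split; [exact: coord_inv_dom|rewrite coord_invK].
Qed.

Lemma coord_chart_ball c x r : cube_in_chart c x r ->
  coord c @` chart_ball c x r = [set v | `|v - coord c x| <= r].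
Proof.
move=> [cx xr]; apply/seteqP; split=> v /=; first by move=> [z [cz zr] <-].
by move=> vr; have cv := xr v vr; exists (coord_inv c v); rewrite ?coord_invK //;
  split; [exact: coord_inv_dom|rewrite coord_invK].
Qed.

Lemma compact_chart_ball c x r : cube_in_chart c x r -> compact (chart_ball c x r).
Proof.
move=> xr; rewrite (chart_ballE xr); apply: continuous_compact; last exact: compact_cube.
apply: continuous_in_subspaceT => v /[!inE] /= vr.
by apply: continuous_coord_inv; have [_] := xr; exact.
Qed.

Lemma near_chart_ball_sub c x (U : set M) : chart_dom c x -> nbhs x U ->
  \forall r \near (0 : R)^'+, chart_ball c x r `<=` U.
Proof.
move=> cx xU.
have : \forall v \near coord c x, U (coord_inv c v).
  by apply: near_coord_inv; [exact: coord_im|rewrite coordKP].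
move=> /near_closed_ballP [r r0 rP]; near=> s => z [cz zs].
rewrite -(coordKP cz); apply: rP; apply: le_trans zs _.
by near: s; exact: nbhs_right_le.
Unshelve. all: by end_near. Qed.

End ChartBall.

(** * Evaluation and uniform closeness *)

Section C1Topology.
Context {R : realType} {n : nat} (M : smooth_manifold R n).
Implicit Types (phi : diffeo M) (f : C1_function M) (c d : chart R n M).

Lemma open_subbase (T : Type) (I : choiceType) (D : set I) (b : I -> set T) (i : I) :
  D i -> exists2 D' : set (set T), D' `<=` finI_from D b & \bigcup_(A in D') A = b i.
Proof.
move=> Di; exists [set b i]; last by rewrite bigcup_set1.
move=> _ ->; exists (finmap.fset1 i).
  by move=> j; rewrite finmap.in_fset1 => /eqP ->; rewrite inE.
by rewrite set_fset1 bigcap_set1.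
Qed.

Lemma near_diffeo_C1 phi c d (K : set M) (e : R) : atlas c -> atlas d ->
  compact K -> K `<=` chart_dom c -> phi @` K `<=` chart_dom d -> 0 < e ->
  nbhs phi [set psi : diffeo M | psi @` K `<=` chart_dom d /\
    C1_close e (coord c @` K) (local_rep c d psi) (local_rep c d phi)].
Proof.
move=> ac ad cK Kc Kd e0.
have oN : open (diffeo_C1_nbhd phi c d K e).
  apply: (@open_subbase _ (set (diffeo M)) (@diffeo_C1_subbase _ _ M) id).
  by exists phi, c, d, K, e.
apply: open_nbhs_nbhs; split=> //; split=> // v vK.
by rewrite subrr normr0; split=> // i; rewrite subrr normr0.
Qed.

Lemma near_C1_function f c (K : set M) (e : R) : atlas c -> compact K ->
  K `<=` chart_dom c -> 0 < e ->
  nbhs f [set g : C1_function M |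
    C1_close e (coord c @` K) (function_rep c g) (function_rep c f)].
Proof.
move=> ac cK Kc e0.
have oN : open (C1_function_nbhd f c K e).
  apply: (@open_subbase _ (set (C1_function M)) (@C1_function_subbase _ _ M) id).
  by exists f, c, K, e.
apply: open_nbhs_nbhs; split=> // v vK.
by rewrite subrr normr0; split=> // i; rewrite subrr normr0.
Qed.

Lemma diffeo_continuous phi : continuous phi.
Proof. by have [] := diffeo_fun_smooth phi. Qed.

(** Joint continuity of evaluation: on a compact chart ball around [x], C^1 closeness gives uniform
    closeness in the target chart. *)
Lemma near_evaluation phi x (U : set M) : nbhs (phi x) U ->
  \forall zp \near (x, phi), U ((zp.2 : diffeo M) zp.1).
Proof.
move=> xU.
have [c ac cx] := @atlas_cover _ _ M x; have [d ad dx] := @atlas_cover _ _ M (phi x).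
have : \forall v \near coord d (phi x), U (coord_inv d v).
  by apply: near_coord_inv; [exact: coord_im|rewrite coordKP].
move=> /near_closed_ballP [e e0 eP]; have e2 : 0 < e / 2 by rewrite divr_gt0.
have nU : nbhs x (phi @^-1` chart_ball d (phi x) (e / 2)).
  by apply: diffeo_continuous; exact: chart_ball_nbhs.
near (0 : R)^'+ => r.
have r0 : 0 < r by near: r; exact: nbhs_right_gt.
have xr : cube_in_chart c x r by near: r; exact: near_cube_in_chart.
have rU : chart_ball c x r `<=` phi @^-1` chart_ball d (phi x) (e / 2).
  by near: r; exact: near_chart_ball_sub.
have Kc : chart_ball c x r `<=` chart_dom c by move=> z [].
have Kd : phi @` chart_ball c x r `<=` chart_dom d by move=> _ [z /rU [dz _] <-].
have H := near_diffeo_C1 ac ad (compact_chart_ball xr) Kc Kd e2.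
exists (chart_ball c x r, [set psi : diffeo M | psi @` chart_ball c x r `<=` chart_dom d /\
    C1_close (e / 2) (coord c @` chart_ball c x r) (local_rep c d psi) (local_rep c d phi)]).
  by split=> //=; exact: chart_ball_nbhs.
move=> [z psi] /= [zr [dpsi close]].
have dz : chart_dom d (psi z) by apply: dpsi; exists z.
rewrite -(coordKP dz); apply: eP.
have [cz _] := zr; have [_ pz] := rU z zr.
have [/ltW H1 _] := close (coord c z) (ex_intro2 _ _ z zr erefl).
move: H1; rewrite /local_rep /= coordKP // => H1.
rewrite -(subrKA (coord d (phi z))); apply: le_trans (ler_normD _ _) _.
by rewrite (splitr e) lerD.
Unshelve. all: by end_near. Qed.

(** [M] carries no metric, so uniform closeness is measured through the values of [h], the only
    quantity that the global argument compares. *)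
Lemma near_diffeo_uniform phi (h : M -> R) e : compact [set: M] ->
  continuous (h : M -> R^o) -> 0 < e ->
  nbhs phi [set psi : diffeo M | forall x, `|h (psi x) - h (phi x)| <= e].
Proof.
move=> /compact_near_coveringP cM ch e0; have e2 : 0 < e / 2 by rewrite divr_gt0.
have := cM _ _ (fun (psi : diffeo M) x => `|h (psi x) - h (phi x)| <= e) (nbhs_filter phi).
move=> H; suff : nbhs phi [set psi : diffeo M |
    [set: M] `<=` (fun x => `|h (psi x) - h (phi x)| <= e)].
  by apply: filterS => psi sub x; exact: sub.
apply: H => x _.
have near1 : nbhs (phi x) [set y | `|h (phi x) - h y| <= e / 2].
  exact: (cvgrPdist_le _ _).1 (ch (phi x)) _ e2.
have near2 : \forall z \near x, `|h (phi x) - h (phi z)| <= e / 2.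
  exact: continuous_near (@diffeo_continuous phi x) near1.
have near2' : \forall zp \near (x, phi), `|h (phi x) - h (phi zp.1)| <= e / 2.
  exact: (@cvg_fst _ _ (nbhs x) (nbhs phi) _ _ near2).
apply: filterS2 (near_evaluation near1) near2' => -[z psi] /= h1 h2.
rewrite -(subrKA (h (phi x))); apply: le_trans (ler_normD _ _) _.
by rewrite (splitr e) lerD // distrC.
Qed.

Lemma near_C1_function_uniform f e : compact [set: M] -> 0 < e ->
  nbhs f [set g : C1_function M | forall x, `|g x - f x| <= e].
Proof.
move=> /compact_near_coveringP cM e0.
have H := cM _ _ (fun (g : C1_function M) x => `|g x - f x| <= e) (nbhs_filter f).
suff : nbhs f [set g : C1_function M | [set: M] `<=` (fun x => `|g x - f x| <= e)].
  by apply: filterS => psi sub x; exact: sub.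
apply: H => x _; have [c ac cx] := @atlas_cover _ _ M x.
near (0 : R)^'+ => r.
have r0 : 0 < r by near: r; exact: nbhs_right_gt.
have xr : cube_in_chart c x r by near: r; exact: near_cube_in_chart.
have Kc : chart_ball c x r `<=` chart_dom c by move=> z [].
have H := near_C1_function f ac (compact_chart_ball xr) Kc e0.
exists (chart_ball c x r, [set g : C1_function M |
    C1_close e (coord c @` chart_ball c x r) (function_rep c g) (function_rep c f)]).
  by split=> //=; exact: chart_ball_nbhs.
move=> [z g] /= [zr close]; have [cz _] := zr.
have [/ltW + _] := close (coord c z) (ex_intro2 _ _ z zr erefl).
by rewrite /function_rep /= coordKP.
Unshelve. all: by end_near. Qed.

Lemma C1_function_continuous f : continuous (f : M -> R^o).
Proof.
move=> x; have [c ac cx] := @atlas_cover _ _ M x.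
have := C1_funP f ac; move=> /(Ck_onP _ _ (@open_chart_im _ _ _ c)) /(_ _ (coord_im cx)) k1.
apply: near_eq_continuous (continuous_comp (continuous_coord cx) (ck_continuous k1)).
by apply: filterS (near_dom cx) => z cz; rewrite /function_rep /= coordKP.
Qed.

End C1Topology.

(** * Dynamics near a critical point *)

Section BilinearForm.
Context {R : realType} {n : nat}.
Implicit Types (H : 'M[R]_n) (a b : 'rV[R]_n).

Definition bilin H a b : R := \sum_i a 0 i * \sum_j H i j * b 0 j.

Lemma bilinDl H a a' b : bilin H (a + a') b = bilin H a b + bilin H a' b.
Proof. by rewrite -big_split; apply: eq_bigr => i _ /=; rewrite mxE mulrDl. Qed.

Lemma bilinDr H a b b' : bilin H a (b + b') = bilin H a b + bilin H a b'.
Proof.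
rewrite -big_split; apply: eq_bigr => i _ /=; rewrite -mulrDr -big_split; congr (_ * _).
by apply: eq_bigr => j _ /=; rewrite mxE mulrDr.
Qed.

Lemma bilinZ H (t : R) a : bilin H (t *: a) (t *: a) = t ^+ 2 * bilin H a a.
Proof.
rewrite /bilin mulr_sumr; apply: eq_bigr => i _; rewrite mxE !mulr_sumr.
by apply: eq_bigr => j _; rewrite mxE; ring.
Qed.

Lemma bilin_bound H : exists2 B, 0 < B & forall a b, `|bilin H a b| <= B * `|a| * `|b|.
Proof.
exists (1 + \sum_i \sum_j `|H i j|).
  by rewrite ltr_pwDl // sumr_ge0 // => i _; exact: sumr_ge0.
move=> a b; rewrite -mulrA mulrDl mul1r.
apply: le_trans (_ : (\sum_i \sum_j `|H i j|) * (`|a| * `|b|) <= _); last first.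
  by rewrite lerDr mulr_ge0.
apply: le_trans (ler_norm_sum _ _ _) _; rewrite mulr_suml; apply: ler_sum => i _.
rewrite normrM mulrCA; apply: ler_pM => //; first exact: rV_coord_le.
apply: le_trans (ler_norm_sum _ _ _) _; rewrite mulr_suml; apply: ler_sum => j _.
by rewrite normrM; apply: ler_wpM2l => //; exact: rV_coord_le.
Qed.

Definition quad H a := bilin H a a / 2.

Lemma quadZ H (t : R) a : quad H (t *: a) = t ^+ 2 * quad H a.
Proof. by rewrite /quad bilinZ mulrA. Qed.

Lemma quad_bound H : exists2 B, 0 < B & (forall a, `|quad H a| <= B * `|a| ^+ 2) /\
  forall a b, `|quad H (a + b) - quad H a| <= B * `|b| * (`|a| + `|b|).
Proof.
have [B B0 HB] := bilin_bound H; exists B => //; split=> [a|a b].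
  rewrite normrM normfV normr_nat ler_pdivrMr //; apply: le_trans (HB a a) _.
  by rewrite expr2 mulrA ler_peMr ?mulr_ge0 ?(ltW B0) // ler1n.
have -> : quad H (a + b) - quad H a = (bilin H a b + bilin H b a + bilin H b b) / 2.
  by rewrite /quad bilinDl !bilinDr; field.
rewrite normrM normfV normr_nat ler_pdivrMr //.
apply: le_trans (ler_normD _ _) _; apply: le_trans (lerD (ler_normD _ _) (lexx _)) _.
apply: le_trans (lerD (lerD (HB a b) (HB b a)) (HB b b)) _.
have : 0 <= B * `|b| * `|b| by rewrite !mulr_ge0 // ltW.
have -> : B * `|a| * `|b| = B * `|b| * `|a| by ring.
have -> : B * `|b| * (`|a| + `|b|) = B * `|b| * `|a| + B * `|b| * `|b| by ring.
lra.
Qed.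

Lemma taylor2 (f : 'rV[R]_n -> R^o) v0 e : ck 2 f v0 ->
  (forall k, partial k f v0 = 0) -> 0 < e ->
  exists2 r, 0 < r & forall w, `|w| <= r ->
    `|f (w + v0) - f v0 - quad (hessian f v0) w| <= e * `|w| ^+ 2.
Proof.
move=> f2 f0 e0; set H := hessian f v0.
have e1 : 0 < e / n.+1%:R by rewrite divr_gt0 // ltr0Sn.
have near0 : \forall v \near v0, ck 1 f v /\ forall k,
    `|partial k f v - \sum_j H k j * (v - v0) 0 j| <= e / n.+1%:R * `|v - v0|.
  have H1 : \forall v \near v0, forall k,
      `|partial k f v - \sum_j H k j * (v - v0) 0 j| <= e / n.+1%:R * `|v - v0|.
    apply: (@filter_forall _ _ (fun k v =>
      `|partial k f v - \sum_j H k j * (v - v0) 0 j| <= e / n.+1%:R * `|v - v0|) _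
      (nbhs_filter v0)) => k.
    have [r r0 rP] := ck1_strict (ck_partial k f2) e1.
    apply: (near_closed_ballP v0 _).2; exists r => // v vr.
    have := rP v v0 vr; rewrite subrr normr0 f0 subr0 => /(_ (ltW r0)).
    have E j : partial j (partial k f) v0 * (v 0 j - v0 0 j) = H k j * (v - v0) 0 j.
      by rewrite /H /hessian !mxE.
    by under eq_bigr do rewrite E.
  exact: (filterS2 _ _ (ck_nbhs (ckS f2)) H1).
have [r r0 rP] := (near_closed_ballP _ _).1 near0.
exists r => // w wr.
have seg (s : R) : s \in `[0, 1] -> `|s *: w| <= r.
  rewrite in_itv /= => /andP[s0 s1]; rewrite normrZ (ger0_norm s0).
  by apply: le_trans wr; rewrite ler_piMl.
(* [g] compares [f] on the segment with its quadratic model. The mean value theorem on [0, 1]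
   reduces the claim to a bound on [dg], which follows from the first-order expansion of the
   gradient at [v0]. *)
pose g (s : R) : R := f (s *: w + v0) - s ^+ 2 * quad H w.
pose dg (s : R) : R := (\sum_k partial k f (s *: w + v0) * w 0 k) - 2 * s * quad H w.
have dgP (s : R) : s \in `[0, 1] -> is_derive s (1 : R) (g : R -> R^o) (dg s).
  move=> /seg sr; have [|f1 _] := rP (s *: w + v0); first by rewrite addrK.
  have [df dfE] := ck1_derive w f1.
  have d1 : is_derive s (1 : R) (fun s => f (s *: w + v0)) ('D_w f (s *: w + v0)).
    exact: is_derive_line.
  have d2 : is_derive s (1 : R) (fun s => s ^+ 2 * quad H w : R^o) (2 * s * quad H w).
    have dX : derivable (fun s : R => s ^+ 2 : R^o) s 1 by exact: exprn_derivable.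
    have dc : derivable (fun=> quad H w : R^o) s 1 by exact: derivable_cst.
    apply: DeriveDef; first exact: (derivableM dX dc).
    rewrite (deriveM dX dc) derive_cst scaler0 add0r exp_derive expr1.
    by rewrite -![_ *: _]/(_ * _) mulr1 mulrC.
  have [dd1 E1] := d1; have [dd2 E2] := d2.
  apply: DeriveDef; first exact: (derivableB dd1 dd2).
  by rewrite (deriveB dd1 dd2) E1 E2 dfE.
have H01 : (0 : R) <= 1 by [].
have oo_cc (s : R) : s \in `]0, 1[ -> s \in `[0, 1] by exact: subset_itv_oo_cc.
have dg_oo (s : R) : s \in `]0, 1[ -> is_derive s (1 : R) (g : R -> R^o) (dg s).
  by move=> /oo_cc; exact: dgP.
have cg : {within `[0, 1], continuous g}.
  by apply: derivable_within_continuous => s s01; have [] := dgP s s01.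
have [s sI] := @MVT_segment R g dg 0 1 H01 dg_oo cg.
rewrite /g scale1r scale0r add0r expr1n mul1r expr0n mul0r !subr0 mulr1 => E.
have -> : f (w + v0) - f v0 - quad H w = dg s.
  by rewrite -E; ring.
have [|_ ks] := rP (s *: w + v0); first by rewrite addrK; exact: seg.
rewrite addrK in ks.
have -> : dg s = \sum_k (partial k f (s *: w + v0) - \sum_j H k j * (s *: w) 0 j) * w 0 k.
  rewrite /dg; under [RHS]eq_bigr do rewrite mulrBl; rewrite sumrB; congr (_ - _).
  have -> : 2 * s * quad H w = s * bilin H w w by rewrite /quad; field.
  rewrite /bilin mulr_sumr; apply: eq_bigr => k _.
  rewrite mulrCA [RHS]mulrC; congr (_ * _); rewrite mulr_sumr.
  by apply: eq_bigr => j _; rewrite [(s *: w) 0 j]mxE; ring.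
apply: le_trans (ler_norm_sum _ _ _) _.
apply: le_trans (_ : \sum_(k < n) e / n.+1%:R * `|w| * `|w| <= _).
  apply: ler_sum => k _; rewrite normrM; apply: ler_pM => //; last exact: rV_coord_le.
  apply: le_trans (ks k) _; apply: ler_wpM2l; first exact: ltW.
  move: sI; rewrite in_itv /= => /andP[s0 s1].
  by rewrite normrZ (ger0_norm s0) ler_piMl.
rewrite sumr_const card_ord -[leLHS]mulr_natl.
have -> : n%:R * (e / n.+1%:R * `|w| * `|w|) = (n%:R / n.+1%:R) * (e * `|w| ^+ 2) by ring.
rewrite ler_piMl ?mulr_ge0 ?sqr_ge0 ?(ltW e0) //.
by rewrite ler_pdivrMr ?ltr0Sn // mul1r ler_nat.
Qed.

End BilinearForm.

(** * The quadratic form as a Lyapunov function of differences *)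

Section Lyapunov.
Context {R : realType} {n : nat}.

Definition differential_row (F : 'rV[R]_n -> 'rV[R]_n) (x w : 'rV[R]_n) : 'rV[R]_n :=
  \row_j \sum_i partial i (fun y => F y 0 j : R^o) x * w 0 i.

Lemma differential_rowZ F x (t : R) w :
  differential_row F x (t *: w) = t *: differential_row F x w.
Proof.
apply/rowP => j; rewrite !mxE mulr_sumr; apply: eq_bigr => i _.
by rewrite mxE; ring.
Qed.

Lemma differential_row_bound F x : exists2 L, 0 < L &
  forall w, `|differential_row F x w| <= L * `|w|.
Proof.
exists (1 + \sum_j \sum_i `|partial i (fun y => F y 0 j : R^o) x|).
  by rewrite ltr_pwDl // sumr_ge0 // => j _; exact: sumr_ge0.
move=> w; have L0 : 0 <= 1 + \sum_j \sum_i `|partial i (fun y => F y 0 j : R^o) x|.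
  by rewrite addr_ge0 // sumr_ge0 // => j _; exact: sumr_ge0.
apply: rV_norm_le => [|j]; first by rewrite mulr_ge0.
rewrite mxE; apply: le_trans (ler_norm_sum _ _ _) _.
apply: le_trans (_ : (\sum_i `|partial i (fun y => F y 0 j : R^o) x|) * `|w| <= _).
  rewrite mulr_suml; apply: ler_sum => i _; rewrite normrM.
  by apply: ler_wpM2l => //; exact: rV_coord_le.
apply: ler_wpM2r => //; apply: le_trans (_ : \sum_j \sum_i `|partial i (fun y => F y 0 j : R^o) x| <= _).
  apply: (@ler_term_sum R _ (fun j => \sum_i `|partial i (fun y => F y 0 j : R^o) x|)) => k.
  exact: sumr_ge0.
by rewrite lerDr.
Qed.

Lemma ck1_strict_row F x e : ck 1 F x -> 0 < e ->
  exists2 r, 0 < r & forall y z, `|y - x| <= r -> `|z - x| <= r ->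
    `|F y - F z - differential_row F x (y - z)| <= e * `|y - z|.
Proof.
move=> /ck_rowP F1 e0.
have nr : \forall r \near (0 : R)^'+, forall j y z, `|y - x| <= r -> `|z - x| <= r ->
    `|F y 0 j - F z 0 j - \sum_i partial i (fun y => F y 0 j : R^o) x * (y 0 i - z 0 i)| <= e * `|y - z|.
  apply: filter_forall => j; have [s s0 sP] := ck1_strict (F1 j) e0.
  near=> r => y z yr zr; apply: sP.
    by apply: le_trans yr _; near: r; exact: nbhs_right_le.
  by apply: le_trans zr _; near: r; exact: nbhs_right_le.
near (0 : R)^'+ => r; exists r; first by near: r; exact: nbhs_right_gt.
have H : forall j y z, `|y - x| <= r -> `|z - x| <= r ->
    `|F y 0 j - F z 0 j - \sum_i partial i (fun y => F y 0 j : R^o) x * (y 0 i - z 0 i)| <= e * `|y - z|.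
  by near: r.
move=> y z yr zr; apply: rV_norm_le => [|j]; first by rewrite mulr_ge0 // ltW.
have := H j y z yr zr; rewrite !mxE.
by under [in X in _ -> X]eq_bigr do rewrite !mxE.
Unshelve. all: by end_near. Qed.

Variables (f : 'rV[R]_n -> R^o) (F0 : 'rV[R]_n -> 'rV[R]_n) (v0 : 'rV[R]_n) (kappa : R).
Hypotheses (f2 : ck 2 f v0) (f0 : forall k, partial k f v0 = 0).
Hypotheses (F01 : ck 1 F0 v0) (F0v0 : F0 v0 = v0) (kappa0 : 0 < kappa).
Hypothesis decrease : \forall v \near v0, kappa * `|v - v0| ^+ 2 <= f v - f (F0 v).
Let q := quad (hessian f v0).
Let D := differential_row F0 v0.

(* The decrease of [f] under [F0], rescaled to the tangent space at [v0]. *)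
Lemma quad_differential w : q (D w) <= q w - kappa / 2 * `|w| ^+ 2.
Proof.
have [B B0 [_ qB]] := quad_bound (hessian f v0).
have [L L0 DL] := differential_row_bound F0 v0.
(* [C] collects three errors in units of e |u|^2: Taylor's formula at [u], Taylor's formula at its
   image [u'] of norm at most (L + 1) |u|, and the replacement of [u'] by [D u] in [q]. The choice
   of [e] makes their sum at most half of the drop. *)
pose C := 1 + (L + 1) ^+ 2 + B * (L + 1).
have L1 : 0 < L + 1 by rewrite addr_gt0.
have C0 : 0 < C.
  by rewrite addr_gt0 ?mulr_gt0 // addr_gt0 // exprn_gt0.
pose e := Num.min 1 (kappa / (2 * C)).
have e0 : 0 < e by rewrite lt_min ltr01 /= divr_gt0 // mulr_gt0.
have e1 : e <= 1 by rewrite ge_min lexx.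
have eC : e * C <= kappa / 2.
  apply: le_trans (_ : kappa / (2 * C) * C <= _).
    by apply: ler_wpM2r; [exact: ltW|rewrite ge_min lexx orbT].
  by rewrite le_eqVlt; apply/orP; left; apply/eqP; field; exact: lt0r_neq0.
have [r1 r10 r1P] := taylor2 f2 f0 e0.
have [r2 r20 r2P] := ck1_strict_row F01 e0.
have [r3 r30 r3P] := (near_closed_ballP _ _).1 decrease.
pose r := Num.min (r1 / (L + 1)) (Num.min r1 (Num.min r2 r3)).
have r0 : 0 < r by rewrite !lt_min divr_gt0 // r10 r20.
have main u : `|u| <= r -> q (D u) <= q u - kappa / 2 * `|u| ^+ 2.
  rewrite !le_min => /and4P[uL ur1 ur2 ur3].
  have := r3P (u + v0); rewrite addrK => /(_ ur3) h3.
  have := r2P (u + v0) v0; rewrite addrK subrr normr0 F0v0 => /(_ ur2 (ltW r20)).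
  set u' := F0 (u + v0) - v0; rewrite -/D => h2.
  have F0u : F0 (u + v0) = u' + v0 by rewrite subrK.
  have u'L : `|u'| <= (L + 1) * `|u|.
    rewrite -(subrK (D u) u'); apply: le_trans (ler_normD _ _) _.
    rewrite mulrDl mul1r addrC; apply: lerD; first exact: DL.
    by apply: le_trans h2 _; rewrite ler_piMl.
  have u'r1 : `|u'| <= r1.
    by apply: le_trans u'L _; rewrite mulrC -ler_pdivlMr.
  have := r1P u ur1; have := r1P u' u'r1; rewrite -F0u -/q => t1 t2.
  have h4 := qB (D u) (u' - D u); rewrite subrKC -/q in h4.
  set N := `|u| in u'L h2 t2 h3 *.
  have N0 : 0 <= N by exact: normr_ge0.
  have {}h4 : `|q u' - q (D u)| <= B * (e * N) * ((L + 1) * N).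
    apply: le_trans h4 _; apply: ler_pM.
    - by rewrite mulr_ge0 // ltW.
    - by rewrite addr_ge0.
    - by apply: ler_wpM2l => //; exact: ltW.
    - rewrite mulrDl mul1r; apply: lerD; first exact: DL.
      by apply: le_trans h2 _; rewrite ler_piMl.
  have {}t1 : `|f (F0 (u + v0)) - f v0 - q u'| <= e * ((L + 1) * N) ^+ 2.
    apply: le_trans t1 _; apply: ler_wpM2l; first exact: ltW.
    by rewrite lerXn2r ?nnegrE // mulr_ge0 // ltW.
  have eCN : e * C * N ^+ 2 <= kappa / 2 * N ^+ 2.
    by apply: ler_wpM2r => //; exact: sqr_ge0.
  have EC : e * C * N ^+ 2 = e * N ^+ 2 + e * ((L + 1) * N) ^+ 2 + B * (e * N) * ((L + 1) * N).
    by rewrite /C; ring.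
  move: t1 t2 h4 h3; rewrite !ler_norml => /andP[a1 a2] /andP[b1 b2] /andP[c1 c2] h3.
  have E2 : kappa * N ^+ 2 = kappa / 2 * N ^+ 2 + kappa / 2 * N ^+ 2 by field.
  by rewrite EC in eCN; rewrite E2 in h3; lra.
have [->|w0] := eqVneq w 0.
  have -> : D 0 = 0 by rewrite -(scale0r (0 : 'rV[R]_n)) /D differential_rowZ !scale0r.
  by rewrite normr0 expr2 !mul0r mulr0 subr0.
have w_gt0 : 0 < `|w| by rewrite normr_gt0.
(* Both sides are homogeneous of degree 2, so the estimate for short vectors extends to [w] by
   scaling. *)
pose t := r / `|w|; have t0 : 0 < t by rewrite divr_gt0.
have tw : t * `|w| <= r by rewrite divfK // lt0r_neq0.
have := main (t *: w); rewrite normrZ (gtr0_norm t0) => /(_ tw).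
rewrite /D differential_rowZ /q !quadZ -subr_ge0 => H.
have t2 : 0 < t ^+ 2 by exact: exprn_gt0.
rewrite -subr_ge0 -(pmulr_rge0 _ t2); apply: le_trans H _.
by rewrite le_eqVlt; apply/orP; left; apply/eqP; ring.
Qed.

Lemma lyapunov_stable : exists c e r : R, [/\ 0 < c, 0 < e, 0 < r &
  forall F : 'rV[R]_n -> 'rV[R]_n, forall v w, `|v - v0| <= r -> `|w - v0| <= r ->
    `|(F v - F w) - (F0 v - F0 w)| <= e * `|v - w| ->
    q (F v - F w) <= q (v - w) - c * `|v - w| ^+ 2].
Proof.
have [B B0 [_ qB]] := quad_bound (hessian f v0).
have [L L0 DL] := differential_row_bound F0 v0.
have L2 : 0 < L + 2 by rewrite addr_gt0.
(* F v - F w differs from [D (v - w)] by at most 2 e |v - w|: one [e] for F - F0, one for the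
   linearization of [F0]. This costs at most kappa / 4 of the margin kappa / 2 in
   [quad_differential]. *)
pose e := Num.min 1 (kappa / (8 * (B * (L + 2)))).
have BL : 0 < 8 * (B * (L + 2)) by rewrite !mulr_gt0.
have e0 : 0 < e by rewrite lt_min ltr01 /= divr_gt0.
have e1 : e <= 1 by rewrite ge_min lexx.
have eB : 2 * (B * e * (L + 2)) <= kappa / 4.
  have -> : 2 * (B * e * (L + 2)) = e * (8 * (B * (L + 2))) / 4 by field.
  apply: ler_wpM2r => //.
  by rewrite -ler_pdivlMr // ge_min lexx orbT.
have [r r0 rP] := ck1_strict_row F01 e0.
exists (kappa / 4), e, r; split=> //; first by rewrite divr_gt0.
move=> F v w vr wr H; have H2 := rP v w vr wr; rewrite -/D in H2.
set a := v - w in H H2 *; set b := F v - F w - D a.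
have bE : `|b| <= 2 * e * `|a|.
  rewrite /b -(subrKA (F0 v - F0 w)); apply: le_trans (ler_normD _ _) _.
  by apply: le_trans (lerD H H2) _; rewrite -mulrDl mulr_natl mulr2n.
have -> : F v - F w = D a + b by rewrite /b subrKC.
have := qB (D a) b; rewrite -/q => h.
have {}h : `|q (D a + b) - q (D a)| <= B * (2 * e * `|a|) * ((L + 2) * `|a|).
  apply: le_trans h _; apply: ler_pM.
  - by rewrite mulr_ge0 // ltW.
  - by rewrite addr_ge0.
  - by apply: ler_wpM2l => //; exact: ltW.
  - rewrite mulrDl; apply: lerD; first exact: DL.
    by apply: le_trans bE _; apply: ler_wpM2r => //; rewrite ler_piMr.
have := quad_differential a.
have : B * (2 * e * `|a|) * ((L + 2) * `|a|) <= kappa / 4 * `|a| ^+ 2.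
  have -> : B * (2 * e * `|a|) * ((L + 2) * `|a|) = 2 * (B * e * (L + 2)) * `|a| ^+ 2 by ring.
  by apply: ler_wpM2r => //; exact: sqr_ge0.
move: h; rewrite ler_norml => /andP[h1 h2] h3 h4.
have : kappa / 2 * `|a| ^+ 2 = kappa / 4 * `|a| ^+ 2 + kappa / 4 * `|a| ^+ 2 by field.
lra.
Qed.

End Lyapunov.

(** * Convergence of orbits confined to a cube *)

Section Attraction.
Context {R : realType} {n : nat}.

(* Along an orbit [u], [q (u k.+1 - u k)] decreases and is bounded, so the steps of the
   orbit tend to zero; and [q] forbids two distinct fixed points. *)
Lemma lyapunov_attraction (F : 'rV[R]_n -> 'rV[R]_n) (q : 'rV[R]_n -> R) v0 (r B c : R) :
  0 < r -> 0 < c -> 0 < B ->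
  (forall v, `|v - v0| <= r -> {for v, continuous F}) ->
  (forall a, `|q a| <= B * `|a| ^+ 2) ->
  (forall v w, `|v - v0| <= r -> `|w - v0| <= r ->
    q (F v - F w) <= q (v - w) - c * `|v - w| ^+ 2) ->
  exists2 a, `|a - v0| <= r & forall u : nat -> 'rV[R]_n,
    (forall k, `|u k - v0| <= r /\ u k.+1 = F (u k)) -> u @ \oo --> a.
Proof.
move=> r0 c0 B0 cF qB qF.
pose orbit (u : nat -> 'rV[R]_n) := forall k, `|u k - v0| <= r /\ u k.+1 = F (u k).
pose g v := `|F v - v|.
have cg v : `|v - v0| <= r -> {for v, continuous (g : _ -> R^o)}.
  move=> vr; apply: continuous_comp; last exact: norm_continuous.
  by apply: continuousB; [exact: cF|exact: cvg_id].
have small u : orbit u -> forall e, 0 < e -> \forall k \near \oo, g (u k) < e.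
  move=> ou e e0; pose s k : R := q (u k.+1 - u k).
  have sS k : s k.+1 <= s k - c * g (u k) ^+ 2.
    have [ur uS] := ou k; have [ur' uS'] := ou k.+1.
    by have := qF _ _ ur' ur; rewrite -uS' -uS /s /g -uS.
  have s_ge k : - (B * (r + r) ^+ 2) <= s k.
    have := qB (u k.+1 - u k); rewrite ler_norml => /andP[+ _]; apply: le_trans.
    rewrite lerN2; apply: ler_wpM2l; first exact: ltW.
    rewrite lerXn2r ?nnegrE ?addr_ge0 ?(ltW r0) //.
    rewrite -(subrKA v0); apply: le_trans (ler_normD _ _) _; apply: lerD.
      by have [] := ou k.+1.
    by rewrite distrC; have [] := ou k.
  have cs : cvgn s.
    apply: nonincreasing_is_cvgn.
      apply/nonincreasing_seqP => k; apply: le_trans (sS k) _.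
      by rewrite gerBl mulr_ge0 ?sqr_ge0 // ltW.
    by exists (- (B * (r + r) ^+ 2)) => _ [k _ <-].
  have ds : s k - s k.+1 @[k --> \oo] --> (0 : R).
    have -> : 0 = limn s - limn s by rewrite subrr.
    apply: cvgB; first exact: cs.
    by have := cs; rewrite -(cvg_shiftS s).
  have ce : 0 < c * e ^+ 2 by rewrite mulr_gt0 // exprn_gt0.
  have /cvgrPdist_lt/(_ _ ce) := ds.
  apply: filterS => k; rewrite sub0r normrN => /(le_lt_trans (ler_norm _)) H.
  have : c * g (u k) ^+ 2 < c * e ^+ 2.
    by apply: le_lt_trans H; have := sS k; lra.
  rewrite ltr_pM2l // ltr_pXn2r ?nnegrE //; first exact: normr_ge0.
  exact: ltW.
have uniq a b : `|a - v0| <= r -> `|b - v0| <= r -> F a = a -> F b = b -> a = b.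
  move=> ar br Fa Fb; have := qF a b ar br; rewrite Fa Fb => H.
  have : `|a - b| ^+ 2 <= 0 by rewrite -(pmulr_rle0 _ c0); lra.
  move=> H2; have : `|a - b| ^+ 2 == 0 by rewrite eq_le H2 sqr_ge0.
  by rewrite expf_eq0 /= normr_eq0 subr_eq0 => /eqP.
(* If no orbit stays in the cube, the claim is vacuous and any point of the cube will do. *)
have [[u ou]|/forallNP no] := pselect (exists u, orbit u); last first.
  by exists v0 => [|u ou]; [rewrite subrr normr0 ltW|exfalso; apply: (no u)].
have minimum (S : set 'rV[R]_n) : compact S -> S !=set0 -> S `<=` [set v | `|v - v0| <= r] ->
    exists2 a, S a & forall v, S v -> g a <= g v.
  move=> cS S0 Sr; have [|a aS aP] := @compact_EVT_min _ R g S S0 cS.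
    apply: continuous_in_subspaceT => v /[!inE] Sv.
    by apply: cg; exact: Sr.
  exists a; first by rewrite inE in aS.
  by move=> v Sv; apply: aP; rewrite inE.
have K0 : [set v | `|v - v0| <= r] !=set0 by exists v0; rewrite /= subrr normr0 ltW.
have [a ar aP] := minimum _ (@compact_cube R n v0 r) K0 (@subset_refl _ _).
(* The steps along the orbit [u] tend to 0, so the minimum of |F v - v| on the cube is 0 and [a] is
   a fixed point. *)
have ga : g a = 0.
  apply/eqP; rewrite eq_le normr_ge0 andbT leNgt; apply/negP => ga0.
  have [k _ /(_ k (leqnn k)) kg] := small u ou _ ga0.
  by have [ur _] := ou k; have := aP _ ur; rewrite leNgt => /negP; apply; exact: kg.
have Fa : F a = a by move/eqP: ga; rewrite normr_eq0 subr_eq0 => /eqP.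
exists a => // w ow; apply/cvgrPdist_lt => e e0.
(* By uniqueness no fixed point lies at distance at least [e] from [a], so the steps are bounded
   below there by compactness, and a late orbit point cannot be in [S]. *)
pose S := [set v : 'rV[R]_n | `|v - v0| <= r] `&` [set v | e <= `|v - a|].
have cS : compact S.
  apply: (subclosed_compact _ (@compact_cube R n v0 r)); last by move=> v [].
  apply: closedI.
    by apply: compact_closed; [exact: norm_hausdorff|exact: compact_cube].
  apply: (@closed_comp _ _ (fun v : 'rV[R]_n => `|v - a|) [set t | e <= t]); last exact: closed_ge.
  move=> v _; apply: continuous_comp; last exact: norm_continuous.
  by apply: continuousB; [exact: cvg_id|exact: cst_continuous].
have [S0|S0] := pselect (S !=set0); last first.
  near=> k; rewrite distrC ltNge; apply/negP => ek; apply: S0; exists (w k); split=> //.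
  by have [] := ow k.
have [b [br be] bP] := minimum S cS S0 (@subIsetl _ _ _).
have gb0 : 0 < g b.
  rewrite normr_gt0 subr_eq0; apply/negP => /eqP Fb.
  by move: be; rewrite /= (uniq _ _ br ar Fb Fa) subrr normr0 leNgt e0.
apply: filterS (small w ow _ gb0) => k gk; rewrite distrC ltNge; apply/negP => ek.
have [wr _] := ow k.
by have := bP (w k) (conj wr ek); rewrite leNgt gk.
Unshelve. all: by end_near. Qed.

End Attraction.

Lemma partial_row (R : realType) (n m : nat) (F : 'rV[R]_n -> 'rV[R]_m) x i j :
  ck 1 F x -> partial i F x 0 j = partial i (fun y => F y 0 j : R^o) x.
Proof.
move=> F1; have dF := @ck_derivable _ _ _ _ _ _ i F1.
by rewrite /partial derive_mx // mxE.
Qed.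

(** [box_mean_value] with zero slopes, applied to the coordinates of F - G: C^1 closeness becomes a
    small Lipschitz constant, the input of [lyapunov_stable]. *)
Lemma C1_close_lipschitz (R : realType) (n : nat) (F G : 'rV[R]_n -> 'rV[R]_n)
    (x : 'rV[R]_n) (r e : R) : 0 < e ->
  (forall v, `|v - x| <= r -> ck 1 F v /\ ck 1 G v) ->
  C1_close (e / n.+1%:R) [set v | `|v - x| <= r] F G ->
  forall v w, `|v - x| <= r -> `|w - x| <= r ->
    `|(F v - F w) - (G v - G w)| <= e * `|v - w|.
Proof.
move=> e0 FG1 close v w vr wr.
have en : 0 < e / n.+1%:R by rewrite divr_gt0 // ltr0Sn.
apply: rV_norm_le => [|j]; first by rewrite mulr_ge0 // ltW.
pose u (y : 'rV[R]_n) : R^o := F y 0 j - G y 0 j.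
have uE z : `|z - x| <= r -> forall i,
    derivable u z (delta_mx 0 i) /\ `|partial i u z - 0| <= e / n.+1%:R.
  move=> zr i; have [F1 G1] := FG1 z zr.
  have dF := @ck_derivable _ _ _ _ _ _ i ((ck_rowP _ _ _).1 F1 j).
  have dG := @ck_derivable _ _ _ _ _ _ i ((ck_rowP _ _ _).1 G1 j).
  split; first exact: (derivableB dF dG).
  have -> : partial i u z = (partial i F z - partial i G z) 0 j.
    by rewrite !mxE (partial_row i j F1) (partial_row i j G1) -(deriveB dF dG).
  rewrite subr0; apply: le_trans (rV_coord_le _ _) _.
  by have [_ /(_ i) /ltW] := close z zr.
have := @box_mean_value R n u (fun=> 0) x r (e / n.+1%:R) uE w v wr vr.
rewrite big1 => [|i _]; last by rewrite mul0r.
have -> : ((F v - F w) - (G v - G w)) 0 j = u v - u w - 0.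
  by rewrite /u !mxE; ring.
move=> /le_trans; apply; rewrite -mulrA; apply: ler_wpM2l; first exact: ltW.
rewrite ler_pdivrMl ?ltr0Sn //.
have := @rV_sum_le R n (v - w); under eq_bigr do rewrite !mxE.
by move=> /le_trans; apply; rewrite ler_wpM2r // ler_nat.
Qed.

Section CriticalAttraction.
Context {R : realType} {n : nat} (M : smooth_manifold R n).
Variables (h : M -> R) (phi : diffeo M).
Hypothesis gl : gradient_like h phi.

(** [q] is quantified before [x]: all orbits confined to the ball share one limit, which is what
    makes the set of limits finite. *)
Definition attracts (c : chart R n M) (p : M) (r : R) (psi : M -> M) :=
  exists q : M, forall x, (forall k, chart_ball c p r (iter k psi x)) ->
    (fun k => iter k psi x) @ \oo --> q.

Lemma critical_attracts p : phi p = p -> exists c, exists r : R, [/\ atlas c, 0 < r,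
  cube_in_chart c p r & nbhs phi [set psi : diffeo M | attracts c p r psi]].
Proof.
move=> pp; have [c [ac cp f0 [kappa kappa0 kP]]] := gl_critical gl pp.
set f := function_rep c h in f0; set v0 := coord c p in f0.
have f2 : ck 2 f v0 by exact: (gl_smooth gl ac 2 cp).
pose F0 := local_rep c c phi.
have cphi : chart_dom c (phi p) by rewrite pp.
have F01 : ck 1 F0 v0 := smooth_map_ck 1 (diffeo_fun_smooth phi) ac ac cp cphi.
have F0v0 : F0 v0 = v0 by rewrite /F0 /local_rep /= coordKP // pp.
have nphi : \forall x \near p, chart_dom c (phi x).
  apply: (continuous_near (@diffeo_continuous _ _ _ phi p)).
  exact: near_dom.
have decrease : \forall v \near v0, kappa * `|v - v0| ^+ 2 <= f v - f (F0 v).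
  have H : \forall x \near p, chart_dom c (phi x) /\
      kappa * `|coord c x - coord c p| ^+ 2 <= h x - h (phi x).
    exact: (filterS2 _ _ nphi kP).
  have H' : \forall v \near v0, chart_dom c (phi (coord_inv c v)) /\
      kappa * `|coord c (coord_inv c v) - coord c p| ^+ 2 <=
        h (coord_inv c v) - h (phi (coord_inv c v)).
    apply: (near_coord_inv (P := fun x => chart_dom c (phi x) /\
      kappa * `|coord c x - coord c p| ^+ 2 <= h x - h (phi x)) (coord_im cp)).
    by rewrite coordKP.
  apply: filterS2 (near_im (coord_im cp)) H' => v cv [cpv].
  by rewrite coord_invK // /f /F0 /local_rep /function_rep /= (coordKP cpv).
have [a [e [r1 [a0 e0 r10 lyap]]]] := lyapunov_stable f2 f0 F01 F0v0 kappa0 decrease.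
near (0 : R)^'+ => r.
have r0 : 0 < r by near: r; exact: nbhs_right_gt.
have rr1 : r <= r1 by near: r; exact: nbhs_right_le.
have pr : cube_in_chart c p r by near: r; exact: near_cube_in_chart.
have Kd : phi @` chart_ball c p r `<=` chart_dom c.
  have H : chart_ball c p r `<=` [set x | chart_dom c (phi x)].
    by near: r; exact: near_chart_ball_sub.
  by move=> _ [x /H ? <-].
have Kc : chart_ball c p r `<=` chart_dom c by move=> z [].
exists c, r; split=> //.
have en : 0 < e / n.+1%:R by rewrite divr_gt0 // ltr0Sn.
apply: filterS (near_diffeo_C1 ac ac (compact_chart_ball pr) Kc Kd en).
move=> psi [Kpsi]; rewrite (coord_chart_ball pr); rewrite -/v0 -/F0.
set F := local_rep c c psi => close.
have inK v : `|v - v0| <= r -> exists x, [/\ chart_dom c x, coord c x = v,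
    chart_dom c (phi x) & chart_dom c (psi x)].
  move=> vr; have cv := pr.2 v vr; exists (coord_inv c v).
  have Kv : chart_ball c p r (coord_inv c v).
    by split; [exact: coord_inv_dom|rewrite coord_invK].
  split; [exact: coord_inv_dom|exact: coord_invK| |].
  - by apply: Kd; exists (coord_inv c v).
  - by apply: Kpsi; exists (coord_inv c v).
have FG1 v : `|v - v0| <= r -> ck 1 F v /\ ck 1 F0 v.
  move=> /inK [x [cx <- phix psix]]; split; apply: smooth_map_ck => //.
    exact: diffeo_fun_smooth.
  exact: diffeo_fun_smooth.
have lip := C1_close_lipschitz e0 FG1 close.
have [B B0 [qB _]] := quad_bound (hessian f v0).
have [b br bP] := @lyapunov_attraction R n F (quad (hessian f v0)) v0 r B a r0 a0 B0
  (fun v vr => ck_continuous (FG1 v vr).1) qB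
  (fun v w vr wr => lyap F v w (le_trans vr rr1) (le_trans wr rr1) (lip v w vr wr)).
exists (coord_inv c b) => x xP.
have ub : (fun k => coord c (iter k psi x)) @ \oo --> b.
  apply: bP => k; have [cx xr] := xP k; split=> //.
  by rewrite /F /local_rep /= coordKP.
have cb := continuous_coord_inv (pr.2 b br).
have := cvg_comp _ _ ub cb.
suff -> : (coord_inv c \o (fun k => coord c (iter k psi x))) = (fun k => iter k psi x) by [].
by apply/funext => k /=; rewrite coordKP //; have [] := xP k.
Unshelve. all: by end_near. Qed.

End CriticalAttraction.

(** * Global dynamics *)

Section Episodes.
Context {R : realType} {T : Type} {m : nat}.
(** Two sizes of neighbourhoods are used. The hulls fix the definite drop [d]; the cores are then
    chosen so small that the gain of [h] in them is negligible against [d]. Between core and hull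
    [h] does not grow. *)
Variables (psi : T -> T) (h : T -> R) (core hull : 'I_m -> set T) (level : 'I_m -> R) (d : R).
Hypothesis d0 : 0 < d.
Hypothesis drop_hull : forall x, (exists i, hull i x) \/ h (psi x) <= h x - d.
Hypothesis drop_core : forall x, (exists i, core i x) \/ h (psi x) <= h x.
Hypothesis core_hull : forall i x, core i x -> hull i x.
Hypothesis core_level : forall i x, core i x -> level i <= h x + d / 8.
Hypothesis core_step : forall i x, core i x -> hull i (psi x) /\ h (psi x) <= level i + d / 8.
Hypothesis hull_disjoint : forall i j x, hull i x -> hull j x -> i = j.
Hypothesis hull_step : forall i j x, hull i x -> hull j (psi x) -> i = j.

Let outside x := ~ exists i, hull i x.

(* After leaving the hulls at level [a + d] the orbit is always in one of three
   states: below [a]; in the hull of a point whose level is at most [a + d / 8];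
   or just escaped from such a hull, in which case the next step drops by [d]. *)
Lemma drop_after_outside x k : outside x -> h (iter k.+1 psi x) <= h x - 3 / 4 * d.
Proof.
move=> ox; have d_gt0 := d0; set a := h x - d.
(* After the drop of [d] at most [d / 4] is regained: [d / 8] between a core point and the level,
   and [d / 8] between the level and the next point. *)
suff : h (iter k.+1 psi x) <= a \/
    (exists i, [/\ hull i (iter k.+1 psi x), level i <= a + d / 8 &
       h (iter k.+1 psi x) <= level i + d / 8]) \/
    (outside (iter k.+1 psi x) /\ h (iter k.+1 psi x) <= a + d / 4).
  by rewrite /a => -[|[[i [_]]|[_]]]; lra.
elim: k => [|k IH]; first by left; have [//|] := drop_hull x.
rewrite iterS; move: (iter k.+1 psi x) IH => z [za|[[i [zi ia zl]]|[oz za]]].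
- have [[i ci]|zd] := drop_core z; last by left; exact: le_trans zd za.
  have [pi pl] := core_step ci; have cl := core_level ci.
  by right; left; exists i; split=> //; lra.
- have [[j cj]|zd] := drop_core z.
    have ij := hull_disjoint zi (core_hull cj); rewrite -ij in cj.
    have [pi pl] := core_step cj.
    by right; left; exists i.
  have [[j pj]|no] := pselect (exists j, hull j (psi z)).
    have ij := hull_step zi pj; rewrite -ij in pj.
    by right; left; exists i; split=> //; exact: le_trans zd zl.
  by right; right; split=> //; lra.
- by left; have [//|] := drop_hull z; lra.
Qed.

(** Each visit outside the hulls costs [3 / 4 * d] for good, so a lower bound of [h] allows only
    finitely many. From then on [hull_step] prevents a change of hull. *)
Lemma eventually_in_hull b x : (forall x, b <= h x) ->
  exists K i, forall k, (K <= k)%N -> hull i (iter k psi x).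
Proof.
move=> hb; apply: contrapT => no.
have often K : exists2 k, (K <= k)%N & outside (iter k psi x).
  apply: contrapT => no2; apply: no.
  have inside k : (K <= k)%N -> exists i, hull i (iter k psi x).
    by move=> Kk; apply: contrapT => ok; apply: no2; exists k.
  have [i iP] := inside K (leqnn K); exists K, i => k.
  elim: k => [|k IH]; first by rewrite leqn0 => /eqP K0; rewrite -K0.
  rewrite leq_eqVlt => /orP[/eqP <- //|]; rewrite ltnS => Kk.
  have [j jP] := inside k.+1 (leqW Kk).
  by have := hull_step (IH Kk) jP => ij; rewrite ij.
have [k0 _ ok0] := often 0.
have chain j : exists2 k, outside (iter k psi x) &
    h (iter k psi x) <= h (iter k0 psi x) - j%:R * (3 / 4 * d).
  elim: j => [|j [k ok hk]]; first by exists k0; rewrite // mul0r subr0.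
  have [l kl ol] := often k.+1; exists l => //.
  have := drop_after_outside (l - k.+1) ok; rewrite -iterD -subSn // subSS.
  by rewrite subnK; [rewrite -natr1 mulrDl; lra|exact: ltnW].
pose j := Num.truncn ((h (iter k0 psi x) - b) / (3 / 4 * d)).
have d34 : 0 < 3 / 4 * d by rewrite mulr_gt0 // divr_gt0.
have [k _ hk] := chain j.+1.
have := truncnS_gt ((h (iter k0 psi x) - b) / (3 / 4 * d)); rewrite -/j.
rewrite ltr_pdivrMr // => H.
by have := hb (iter k psi x); lra.
Qed.

End Episodes.

Section SeparatedNeighbourhoods.

Lemma separated_nbhs (T : topologicalType) (I : finType) (p : I -> T) :
  hausdorff_space T -> injective p -> exists U : I -> set T,
    (forall i, nbhs (p i) (U i)) /\ forall i j z, U i z -> U j z -> i = j.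
Proof.
move=> hT pI.
have sep (ij : I * I) : exists AB : set T * set T, ij.1 <> ij.2 ->
    [/\ nbhs (p ij.1) AB.1, nbhs (p ij.2) AB.2 & forall z, AB.1 z -> ~ AB.2 z].
  have [->|ne] := eqVneq ij.1 ij.2; first by exists (setT, setT).
  move: hT; rewrite open_hausdorff => /(_ (p ij.1) (p ij.2)) [|[A B] /= [Ap Bp] [oA oB AB]].
    by apply: contra ne => /eqP /pI ->.
  exists (A, B) => _; split=> /=.
  - by apply: open_nbhs_nbhs; split=> //; rewrite inE in Ap.
  - by apply: open_nbhs_nbhs; split=> //; rewrite inE in Bp.
  - by move=> z Az Bz; have : (A `&` B) z by []; rewrite (eqP AB).
have [AB ABP] := choice sep.
exists (fun i => [set z | forall j, i <> j -> (AB (i, j)).1 z /\ (AB (j, i)).2 z]); split.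
  move=> i; apply: (@filter_forall _ _ (fun j z => i <> j -> (AB (i, j)).1 z /\ (AB (j, i)).2 z)
    _ (nbhs_filter (p i))) => j.
  have [->|ij] := eqVneq i j; first by apply: filterE.
  have ij' : i <> j by move/eqP: ij.
  have ji' : j <> i by move=> ji; apply: ij'.
  have [/= n1 _ _] := ABP (i, j) ij'; have [/= _ n2 _] := ABP (j, i) ji'.
  by apply: filterS2 n1 n2 => z.
move=> i j z Ui Uj; apply: contrapT => ij.
have [/= _ _ dis] := ABP (i, j) ij.
have ji : j <> i by move=> ji; apply: ij.
have [A1 _] := Ui j ij; have [_ A2] := Uj i ji.
exact: (dis z).
Qed.

End SeparatedNeighbourhoods.

Lemma cvg_shift_back (T : topologicalType) (u : nat -> T) (K : nat) (l : T) :
  (fun k => u (k + K)%N) @ \oo --> l -> u @ \oo --> l.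
Proof.
move=> ul A /ul [N _ NA]; exists (N + K)%N => // k /= Nk.
have KN : (K <= k)%N by apply: leq_trans Nk; exact: leq_addl.
have := NA (k - K)%N; rewrite /= subnK //; apply.
by rewrite leq_subRL // addnC.
Qed.

(** * Finitely many limits and a wandering open set, for all nearby diffeomorphisms *)

Section RobustDynamics.
Context {R : realType} {n : nat} (M : smooth_manifold R n).
Variables (h : M -> R) (phi : diffeo M).
Hypotheses (cM : compact [set: M]) (gl : gradient_like h phi).

Let ch : continuous (h : M -> R^o) := smooth_fun_continuous (gl_smooth gl).
Let hd x : h (phi x) <= h x. Proof. by have [_ H _] := gl_descends gl; exact: H. Qed.
Let hfix x : h (phi x) = h x -> phi x = x.
Proof. by have [_ _ H] := gl_descends gl; exact: H. Qed.

Let cE : continuous ((fun x => h x - h (phi x)) : M -> R^o).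
Proof.
move=> x; apply: continuousB; first exact: (@ch x).
exact: (@continuous_comp M M R^o phi h x (@diffeo_continuous _ _ _ phi x) (@ch (phi x))).
Qed.

Let E_gt0 x : phi x <> x -> 0 < h x - h (phi x).
Proof.
move=> px; rewrite subr_gt0 lt_neqAle hd andbT; apply/negP => /eqP E.
exact/px/hfix.
Qed.

(** Another fixed point near a fixed point would have drop 0, against the quadratic lower bound;
    near a nonfixed point the drop stays positive. *)
Lemma fixed_isolated x : \forall z \near x, phi z = z -> z = x.
Proof.
have [px|px] := pselect (phi x = x).
  have [c [ac cx _ [kappa k0 kP]]] := gl_critical gl px.
  apply: filterS2 (near_dom cx) kP => z cz zk pz.
  have : `|coord c z - coord c x| ^+ 2 <= 0.
    by rewrite -(pmulr_rle0 _ k0); rewrite pz subrr in zk.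
  move=> H; have : `|coord c z - coord c x| ^+ 2 == 0 by rewrite eq_le H sqr_ge0.
  rewrite expf_eq0 /= normr_eq0 subr_eq0 => /eqP /(congr1 (coord_inv c)).
  by rewrite !coordKP.
have : \forall z \near x, 0 < h z - h (phi z).
  apply: (@continuous_near M R^o (fun x => h x - h (phi x)) x (fun t : R => 0 < t) (@cE x)).
  exact: (lt_nbhsr (E_gt0 px)).
by apply: filterS => z + pz; rewrite pz subrr ltxx.
Qed.

Lemma finite_fixed_points : exists (m : nat) (p : 'I_m -> M),
  [/\ injective p, forall i, phi (p i) = p i & forall x, phi x = x -> exists i, x = p i].
Proof.
have [s sP] := compact_finite_cover cM fixed_isolated.
pose t := [seq x <- undup s | `[< phi x = x >]].
exists (size t), (tnth (in_tuple t)); split.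
- apply/tuple_uniqP => /=; by rewrite filter_uniq // undup_uniq.
- move=> i; have : tnth (in_tuple t) i \in in_tuple t by exact: mem_tnth.
  by rewrite /= mem_filter => /andP[/asboolP].
- move=> x px; have [y ys yx] := sP x.
  have xt : x \in in_tuple t.
    by rewrite /= mem_filter mem_undup (yx px) ys andbT; apply/asboolP; rewrite -(yx px).
  exact: (tnthP _ _ xt).
Qed.

(** Of the drop [2 * d], one [d] is left to compensate the deviation of a diffeomorphism that is
    uniformly [d]-close to [phi] as measured by [h]. *)
Lemma drop_off_nbhs (m : nat) (p : 'I_m -> M) (V : 'I_m -> set M) :
  (forall x, phi x = x -> exists i, x = p i) -> (forall i, nbhs (p i) (V i)) ->
  exists2 d : R, 0 < d & forall x, (exists i, V i x) \/ 2 * d <= h x - h (phi x).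
Proof.
move=> pfix nV.
have := cM; move=> /compact_near_coveringP cM'.
have H := cM' _ _ (fun (d : R) x => (exists i, V i x) \/ 2 * d <= h x - h (phi x))
  (at_right_proper_filter (0 : R)).
have near0 : \forall d \near (0 : R)^'+, [set: M] `<=`
    (fun x => (exists i, V i x) \/ 2 * d <= h x - h (phi x)).
  apply: H => x _; have [px|px] := pselect (phi x = x).
    have [i ->] := pfix x px; exists (V i, setT); first by split=> //; exact: filterT.
    by move=> [z d] /= [Vz _]; left; exists i.
  pose e := (h x - h (phi x)) / 2; have e0 : 0 < e by rewrite divr_gt0 // E_gt0.
  exists ([set z | e < h z - h (phi z)], [set d | d <= e / 2]).
    split=> /=; last by apply: nbhs_right_le; rewrite divr_gt0.
    apply: (@continuous_near M R^o (fun x => h x - h (phi x)) x (fun t : R => e < t) (@cE x)).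
    apply: lt_nbhsr.
    by rewrite /e ltr_pdivrMr // mulr_natr mulr2n ltrDl E_gt0.
  by move=> [z d] /= [z1 d1]; right; lra.
near (0 : R)^'+ => d; exists d; first by near: d; exact: nbhs_right_gt.
have sub : [set: M] `<=` (fun x => (exists i, V i x) \/ 2 * d <= h x - h (phi x)) by near: d.
by move=> x; exact: sub.
Unshelve. all: by end_near. Qed.

Lemma robust_dynamics x0 : phi x0 <> x0 -> exists W : set M, nbhs x0 W /\
  nbhs phi [set psi : diffeo M |
    (exists (m : nat) (q : 'I_m -> M), forall x, exists i,
       (fun k => iter k psi x) @ \oo --> q i) /\
    forall x k, W x -> ~ W (iter k.+1 psi x)].
Proof.
move=> px0; have [m [p [pI pfix pall]]] := finite_fixed_points.
(* [x0] is separated together with the fixed points, so that its neighbourhood is disjoint from all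
   hulls. *)
pose p' (i : option 'I_m) := if i is Some i then p i else x0.
have p'I : injective p'.
  move=> [i|] [j|] //=; first by move=> /pI ->.
    by move=> E; case: px0; rewrite -E pfix.
  by move=> E; case: px0; rewrite E pfix.
have [U [nU Udis]] := separated_nbhs (@manifold_hausdorff _ _ M) p'I.
have crit i : exists cr : chart R n M * R, [/\ atlas cr.1, 0 < cr.2,
    cube_in_chart cr.1 (p i) cr.2 &
    nbhs phi [set psi : diffeo M | attracts cr.1 (p i) cr.2 psi]].
  by have [c [r H]] := critical_attracts gl (pfix i); exists (c, r).
have [cr crP] := choice crit.
have ev i (V : set M) : nbhs (p i) V -> exists AN : set M * set (diffeo M),
    [/\ nbhs (p i) AN.1, nbhs phi AN.2 & forall z (psi : diffeo M), AN.1 z -> AN.2 psi -> V (psi z)].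
  move=> nV; have [|[A N] /= [nA nN] AN] := @near_evaluation _ _ _ phi (p i) V.
    by rewrite pfix.
  by exists (A, N); split=> // z psi Az Npsi; exact: (AN (z, psi)).
have [AN ANP] := choice (fun i => ev i (U (Some i)) (nU (Some i))).
(* The chart ball serves the attraction, [U (Some i)] the disjointness, and [(AN i).1] ensures that
   one step stays in [U (Some i)], hence enters no other hull. *)
pose hull i := chart_ball (cr i).1 (p i) (cr i).2 `&` U (Some i) `&` (AN i).1.
have nhull i : nbhs (p i) (hull i).
  have [_ r0 [cp _] _] := crP i; have [nA _ _] := ANP i.
  by apply: filterI => //; apply: filterI; [exact: chart_ball_nbhs|exact: (nU (Some i))].
have [d d0 dP] := drop_off_nbhs pall nhull.
pose L i := [set z | `|h (p i) - h z| <= d / 8].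
have nL i : nbhs (p i) (L i).
  have d8 : 0 < d / 8 by rewrite divr_gt0.
  exact: (cvgrPdist_le _ _).1 (@ch (p i)) _ d8.
have [BN BNP] := choice (fun i => ev i (hull i `&` L i) (filterI (nhull i) (nL i))).
pose core i := hull i `&` L i `&` (BN i).1.
have ncore i : nbhs (p i) (core i).
  by have [nB _ _] := BNP i; apply: filterI => //; exact: filterI.
have [e e0 eP] := drop_off_nbhs pall ncore.
(* On [L0] the values of [h] differ by at most [d / 2], less than the permanent drop [3 / 4 * d]; so
   an orbit starting in this set outside the hulls never returns. *)
pose L0 := [set z | `|h x0 - h z| <= d / 4].
have nL0 : nbhs x0 L0.
  have d4 : 0 < d / 4 by rewrite divr_gt0.
  exact: (cvgrPdist_le _ _).1 (@ch x0) _ d4.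
exists (U None `&` L0); split; first by apply: filterI => //; exact: (nU None).
have uni (a : R) : 0 < a -> nbhs phi [set psi : diffeo M | forall x, `|h (psi x) - h (phi x)| <= a].
  by move=> a0; exact: near_diffeo_uniform.
have attr : nbhs phi [set psi : diffeo M | forall i, attracts (cr i).1 (p i) (cr i).2 psi].
  apply: (@filter_forall _ _ (fun i (psi : diffeo M) => attracts (cr i).1 (p i) (cr i).2 psi)
    _ (nbhs_filter phi)) => i; by have [] := crP i.
have nAN : nbhs phi [set psi : diffeo M | forall i, (AN i).2 psi /\ (BN i).2 psi].
  apply: (@filter_forall _ _ (fun i (psi : diffeo M) => (AN i).2 psi /\ (BN i).2 psi)
    _ (nbhs_filter phi)) => i; have [_ n1 _] := ANP i; have [_ n2 _] := BNP i.
  exact: filterI.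
apply: filterS (filterI (filterI (uni d d0) (uni e e0)) (filterI attr nAN)).
move=> psi /= [[ud ue] [att AB]].
have F1 x : (exists i, hull i x) \/ h (psi x) <= h x - d.
  have [|H] := dP x; [by left|right].
  by have := ud x; rewrite ler_norml => /andP[_]; lra.
have F2 x : (exists i, core i x) \/ h (psi x) <= h x.
  have [|H] := eP x; [by left|right].
  by have := ue x; rewrite ler_norml => /andP[_]; lra.
have F3 i x : core i x -> hull i x by move=> [[]].
have F4 i x : core i x -> h (p i) <= h x + d / 8.
  by move=> [[_ +] _]; rewrite /L /= ler_norml => /andP[_]; lra.
have F5 i x : core i x -> hull i (psi x) /\ h (psi x) <= h (p i) + d / 8.
  move=> [_ Bx]; have [_ _ H] := BNP i; have [hp Lp] := H x psi Bx (AB i).2.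
  by split=> //; move: Lp; rewrite /L /= ler_norml => /andP[+ _]; lra.
have F6 i j x : hull i x -> hull j x -> i = j.
  by move=> [[_ Ui] _] [[_ Uj] _]; have [->] := Udis _ _ _ Ui Uj.
have F7 i j x : hull i x -> hull j (psi x) -> i = j.
  move=> [_ Ax] [[_ Uj] _]; have [_ _ H] := ANP i.
  by have [->] := Udis _ _ _ (H x psi Ax (AB i).1) Uj.
split; last first.
  move=> x k [Ux Lx] [_ Lk].
  have ox : ~ exists i, hull i x.
    by move=> [i [[_ Ui] _]]; have := Udis _ _ _ Ux Ui.
  have := drop_after_outside d0 F1 F2 F3 F4 F5 F6 F7 k ox.
  move: Lx Lk; rewrite /L0 /= !ler_norml => /andP[H1 _] /andP[_ H2].
  move: (iter k.+1 psi x) H2 => z H2; lra.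
have [|||b _ bP] := @compact_EVT_min M R h [set: M]; [by exists x0|exact: cM| |].
  exact: continuous_subspaceT.
have [q qP] := choice att.
exists m, q => x.
have [|K [i iP]] := eventually_in_hull d0 F1 F2 F3 F4 F5 F6 F7 x (b := h b).
  by move=> y; apply: bP; rewrite inE.
exists i; have := qP i (iter K psi x) _.
move=> H; have {}H := H (fun k => _).
apply: (@cvg_shift_back M _ K).
have -> : (fun k => iter (k + K) psi x) = (fun k => iter k psi (iter K psi x)).
  by apply/funext => k; rewrite iterD.
apply: H => k; rewrite -iterD; have [[+ _] _] := iP (k + K)%N (leq_addl _ _).
exact.
Unshelve. all: by end_near. Qed.

End RobustDynamics.

(** * The spectra *)

Lemma iter_cancel (T : Type) (f g : T -> T) k : cancel g f -> cancel (iter k g) (iter k f).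
Proof.
by move=> gf; elim: k => // k IH x; rewrite iterSr iterS gf IH.
Qed.

(** * The observable and its values *)

Section BumpFunction.
Context {R : realType} {n : nat} (M : smooth_manifold R n).
Variables (c : chart R n M) (x0 : M) (r : R).
Hypotheses (ac : atlas c) (r0 : 0 < r) (x0r : cube_in_chart c x0 (4 * r)).

Definition chart_bump : M -> R := extend_fun c (cube_bump (coord c x0) r).

Lemma chart_bump_out x : ~ chart_ball c x0 (4 * r) x -> chart_bump x = 0.
Proof.
move=> xr; have [cx|cx] := pselect (chart_dom c x); last exact: extend_fun_out.
rewrite /chart_bump extend_funE // cube_bump_0 //.
have : ~ `|coord c x - coord c x0| <= 4 * r by move=> H; apply: xr.
move=> /negP; rewrite -ltNge => /ltW; apply: le_trans.
by apply: ler_wpM2r; [exact: ltW|rewrite ler_nat].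
Qed.

Lemma smooth_chart_bump : smooth_fun chart_bump.
Proof.
have K0 : compact [set v | `|v - coord c x0| <= 4 * r] by exact: compact_cube.
apply: (smooth_extend_fun ac K0) => [v /= vr|v /= vr|k v _].
- by have [_] := x0r; exact.
- rewrite cube_bump_0 //; move/negP: vr; rewrite -ltNge => /ltW; apply: le_trans.
  by apply: ler_wpM2r; [exact: ltW|rewrite ler_nat].
- exact: ck_cube_bump.
Qed.

Definition bump_function : C1_function M := C1Function (smooth_fun_C1 smooth_chart_bump).

(** The intermediate value theorem along the [k]-th axis of the chart, from the centre, where the
    bump is 1, to distance [4 * r], where it is 0. *)
Lemma bump_values (k : 'I_n) (f : C1_function M) (e y : R) :
  (forall x, `|f x - chart_bump x| <= e) -> e <= y <= 1 - e -> exists x, f x = y.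
Proof.
move=> fe /andP[ey ye]; pose g (t : R) := f (coord_inv c (t *: delta_mx 0 k + coord c x0)).
have r4 : 0 <= 4 * r by rewrite mulr_ge0 // ltW.
have seg t : t \in `[0, 4 * r] -> chart_im c (t *: delta_mx 0 k + coord c x0).
  rewrite in_itv /= => /andP[t0 t4]; have [_] := x0r; apply; rewrite addrK.
  by apply: le_trans (norm_delta_mx _ _) _; rewrite ger0_norm.
have cg : {within `[0, 4 * r], continuous g}.
  apply: continuous_in_subspaceT => t /[!inE] /= /seg ct.
  have c1 : {for t, continuous (fun t : R => t *: delta_mx 0 k + coord c x0)}.
    by apply: continuousD; [exact: scalel_continuous|exact: cst_continuous].
  have c2 := continuous_comp c1 (continuous_coord_inv ct).
  exact: (continuous_comp c2 (@C1_function_continuous _ _ _ f _)).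
have [cx0 x0im] := x0r.
have g0 : 1 - e <= g 0.
  have := fe x0; rewrite /chart_bump extend_funE // cube_bump_1 //; last first.
    by rewrite subrr normr0 mulr_ge0 // ltW.
  by rewrite /g scale0r add0r coordKP // ler_norml => /andP[+ _]; lra.
have g4 : g (4 * r) <= e.
  have c4 : chart_im c ((4 * r) *: delta_mx 0 k + coord c x0).
    by apply: seg; rewrite in_itv /= r4 lexx.
  have := fe (coord_inv c ((4 * r) *: delta_mx 0 k + coord c x0)).
  rewrite /chart_bump extend_funE; last exact: coord_inv_dom.
  rewrite coord_invK // cube_bump_0 //; first by rewrite subr0 => /(le_trans (ler_norm _)).
  rewrite addrK; apply: le_trans (rV_coord_le _ k); rewrite !mxE !eqxx mulr1 ger0_norm //.
  by apply: ler_wpM2r; [exact: ltW|rewrite ler_nat].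
have [|t _ gt] := @IVT R g 0 (4 * r) y r4 cg.
  by rewrite ge_min le_max (le_trans g4 ey) (le_trans ye g0) orbT.
by exists (coord_inv c (t *: delta_mx 0 k + coord c x0)).
Qed.

End BumpFunction.

Section Spectra.
Context {R : realType} {n : nat} (M : smooth_manifold R n).

Lemma finite_lagrange_spectrum (psi : M -> M) (f : C1_function M) (m : nat) (q : 'I_m -> M) :
  (forall x, exists i, (fun k => iter k psi x) @ \oo --> q i) ->
  finite_set (lagrange_spectrum psi f).
Proof.
move=> qP; apply: (@sub_finite_set _ _ [set f (q i) | i in [set: 'I_m]]); last first.
  by apply: finite_image; exact: finite_finset.
move=> y [x]; have [i xi] := qP x; move=> E; exists i => //.
have H : (fun j => (f (iter j psi x))%:E) @ \oo --> (f (q i))%:E.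
  apply: cvg_EFin; first by near=> k.
  exact: (cvg_comp _ _ xi (@C1_function_continuous _ _ _ f (q i))).
have cH : cvgn (fun j => (f (iter j psi x))%:E) by apply/cvg_ex; exists (f (q i))%:E.
have := is_cvg_limn_esupE cH; rewrite E (cvg_lim _ H) //.
by move=> [].
Unshelve. all: by end_near. Qed.

Lemma markov_interval (psi : diffeo M) (f : C1_function M) (W : set M) (b y : R) :
  (forall x k, W x -> ~ W (iter k.+1 psi x)) -> (forall x, ~ W x -> f x <= b) ->
  b < y -> (exists x, f x = y) -> markov_spectrum psi (diffeo_inv psi) f y.
Proof.
move=> wander fb by_ [x fx]; exists x.
have Wf z : b < f z -> W z.
  by move=> bz; apply: contrapT => /fb; rewrite leNgt bz.
have Wx : W x by apply: Wf; rewrite fx.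
apply/eqP; rewrite eq_le; apply/andP; split; last first.
  by apply: ereal_sup_ubound; exists (Posz 0) => //=; rewrite fx.
apply: ge_ereal_sup => _ [[[|k]|k] _ <-]; rewrite lee_fin /=.
- by rewrite fx.
- by apply: le_trans (ltW by_); apply: fb; exact: wander.
(* Negative times: a past visit to [W] would be followed by the visit at time 0, a forward
   return. *)
- apply: le_trans (ltW by_); apply: fb => Wz; apply: (wander _ k Wz).
  have := @iter_cancel M psi (diffeo_inv psi) k.+1 (diffeo_invK psi) x.
  by move=> /= ->.
Qed.

End Spectra.

Theorem theorem2 (R : realType) (n : nat) (M : smooth_manifold R n)
    (n_ge1 : (1 <= n)%N) (M_compact : compact [set: M])
    (M_nonempty : [set: M] !=set0) :
  exists U : set (diffeo M * C1_function M),
    [/\ open U, U !=set0 &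
        forall (phi : diffeo M) (f : C1_function M), U (phi, f) ->
          finite_set (lagrange_spectrum phi f) /\
          interior (markov_spectrum phi (diffeo_inv phi) f) !=set0].
Proof.
case: n n_ge1 M M_compact M_nonempty => // p _ M cM [x1 _].
have [h [phi gl]] := gradient_like_exists cM.
(* Fixed points are isolated, whereas in positive dimension every chart ball contains points other
   than its centre. *)
have [x0 px0] : exists x0, phi x0 <> x0.
  have [px1|] := pselect (phi x1 = x1); last by exists x1.
  have [c ac cx1] := @atlas_cover _ _ M x1.
  have iso := fixed_isolated gl x1.
  near (0 : R)^'+ => t.
  have t0 : 0 < t by near: t; exact: nbhs_right_gt.
  have [_ tim] : cube_in_chart c x1 t by near: t; exact: near_cube_in_chart.
  have tiso : chart_ball c x1 t `<=` [set z | phi z = z -> z = x1].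
    by near: t; exact: near_chart_ball_sub.
  pose v : 'rV[R]_p.+1 := t *: delta_mx 0 0 + coord c x1.
  have vt : `|v - coord c x1| <= t.
    by rewrite addrK; apply: le_trans (norm_delta_mx _ _) _; rewrite gtr0_norm.
  exists (coord_inv c v) => pv.
  have /tiso /(_ pv) : chart_ball c x1 t (coord_inv c v).
    by split; [apply: coord_inv_dom; exact: tim|rewrite coord_invK //; exact: tim].
  move=> /(congr1 (coord c)); rewrite coord_invK; last exact: tim.
  move=> /(congr1 (fun w : 'rV[R]_p.+1 => w 0 0 - coord c x1 0 0)).
  rewrite /v !mxE !eqxx mulr1 addrK subrr => t00.
  by move: t0; rewrite t00 ltxx.
have [W [nW robust]] := robust_dynamics cM gl px0.
have [c ac cx0] := @atlas_cover _ _ M x0.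
have [r [r0 x0r rW]] : exists r : R, [/\ 0 < r, cube_in_chart c x0 (4 * r) &
    chart_ball c x0 (4 * r) `<=` W].
  near (0 : R)^'+ => s; exists (s / 4).
  have -> : 4 * (s / 4) = s by field.
  split.
  - by rewrite divr_gt0 //; near: s; exact: nbhs_right_gt.
  - by near: s; exact: near_cube_in_chart.
  - by near: s; exact: near_chart_ball_sub.
pose f0 := bump_function ac r0 x0r.
pose good := [set pf : diffeo M * C1_function M |
  finite_set (lagrange_spectrum pf.1 pf.2) /\
  interior (markov_spectrum pf.1 (diffeo_inv pf.1) pf.2) !=set0].
exists (interior good); split; first exact: open_interior.
  exists (phi, f0).
  (* With error 1/12 the observable is at most 1/12 off [W] and takes every value in [1/12, 11/12];
     the interval (1/3, 2/3) lies well inside. *)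
  have e12 : 0 < 12^-1 :> R by rewrite invr_gt0.
  exists ([set psi : diffeo M |
    (exists (m : nat) (q : 'I_m -> M), forall x, exists i,
       (fun k => iter k psi x) @ \oo --> q i) /\
    forall x k, W x -> ~ W (iter k.+1 psi x)],
    [set g : C1_function M | forall x, `|g x - f0 x| <= 12^-1]).
    by split=> //=; exact: near_C1_function_uniform.
  move=> [psi g] /= [[[m [q qP]] wander] gf0]; split; first exact: finite_lagrange_spectrum qP.
  exists (2^-1); have : \forall y \near (2^-1 : R), 3^-1 < y < 2 / 3.
    near=> y; apply/andP; split; near: y.
      by apply: lt_nbhsr; lra.
    by apply: lt_nbhsl; lra.
  apply: filterS => y /andP[y1 y2].
  apply: (markov_interval (W := W) (b := 12^-1) wander).
  - move=> x Wx; have := gf0 x; rewrite /f0 /= chart_bump_out //; last by move=> /rW.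
    by rewrite subr0 => /(le_trans (ler_norm _)).
  - lra.
  - by apply: (bump_values r0 x0r ord0 gf0); apply/andP; split; lra.
by move=> psi g /interior_subset.
Unshelve. all: by end_near. Qed.
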